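(* There exist a graph $X$ with $\pi_1(X)\cong F_2$ free of rank $2$, a finite regular cover $Y\to X$ with $Y$ connected, and a nonzero homology class $v\in H_1(Y;\mathbb{Q})$ such that the set $$\{\widetilde{\phi}_*(v)\;:\;\phi\in\operatorname{Out}(F_2)\text{ lifts to }Y\}\subseteq H_1(Y;\mathbb{Q})$$ is finite.
   Context: $\operatorname{Out}(F_2)$ is identified with the group of homotopy classes of homotopy equivalences of $X$. An element $\phi\in\operatorname{Out}(F_2)$ lifts to $Y$ if a homotopy equivalence of $X$ representing $\phi$ lifts to a map $\widetilde{\phi}:Y\to Y$; $\widetilde{\phi}_*$ is the induced map on $H_1(Y;\mathbb{Q})$. In the displayed set, $\widetilde{\phi}$ ranges over all lifts of $\phi$ (two lifts differ by the finite deck group, up to homotopy). *)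

(* Defs.v *)
From HB Require Import structures.
From mathcomp Require Import all_boot all_order all_algebra.
From mathcomp Require Import all_classical all_reals topology normedtype homotopy.
From mathcomp Require Import lra.

Set Implicit Arguments.
Unset Strict Implicit.
Unset Printing Implicit Defensive.

Import Order.TTheory GRing.Theory Num.Theory.
Import numFieldNormedType.Exports.

Local Open Scope classical_set_scope.
Local Open Scope ring_scope.


(* A letter (g, s) is the generator g if s is false, and its inverse if s is
   true; elements of the free group are the freely reduced words. *)
Definition letter := (bool * bool)%type.

Definition letter_inv (x : letter) : letter := (x.1, ~~ x.2).
Arguments letter_inv : simpl never.

Definition word_push (x : letter) (w : seq letter) : seq letter :=
  if w is y :: w' then (if y == letter_inv x then w' else x :: w) else [:: x].

Definition word_reduce (w : seq letter) : seq letter := foldr word_push [::] w.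

Definition reduced (w : seq letter) : bool :=
  sorted (fun x y => y != letter_inv x) w.

Lemma letter_invK : involutive letter_inv.
Proof. by case=> g s; rewrite /letter_inv /= negbK. Qed.

Lemma word_push_reduced x w : reduced w -> reduced (word_push x w).
Proof.
case: w => [|y w] //= yw; case: ifP => [_|/negbT xy /=]; last by rewrite xy.
by case: w yw => //= z w /andP[].
Qed.

Lemma word_reduce_reduced w : reduced (word_reduce w).
Proof. by elim: w => //= x w; apply: word_push_reduced. Qed.

Lemma word_reduce_id w : reduced w -> word_reduce w = w.
Proof.
elim: w => [//|x w IH] xw.
rewrite -[LHS]/(word_push x (word_reduce w)).
by case: w xw IH => //= y w /andP[/negbTE xy yw] ->; rewrite //= xy.
Qed.

Lemma word_pushK x w : reduced w ->
  word_push (letter_inv x) (word_push x w) = w.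
Proof.
case: w => [|y w] /=; first by rewrite letter_invK eqxx.
have [->|xy] := eqVneq y (letter_inv x); last by rewrite /= letter_invK eqxx.
case: w => [|z w] //=; rewrite letter_invK => /andP[zx _].
by rewrite (negbTE zx).
Qed.

Lemma word_reduce_cat u v :
  word_reduce (u ++ v) = foldr word_push (word_reduce v) u.
Proof. by rewrite /word_reduce foldr_cat. Qed.

Lemma foldr_push_reduced u v : reduced v -> reduced (foldr word_push v u).
Proof. by move=> rv; elim: u => //= x u; apply: word_push_reduced. Qed.

Lemma foldr_push_reduce u v : reduced v ->
  foldr word_push v (word_reduce u) = foldr word_push v u.
Proof.
move=> rv; elim: u => //= x u <-.
have := word_reduce_reduced u; case: (word_reduce u) => [|y w] //= _.
case: eqP => //= ->.
have := @word_pushK (letter_inv x) _ (foldr_push_reduced w rv).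
by rewrite letter_invK => ->.
Qed.

Definition word_inv (w : seq letter) : seq letter := rev (map letter_inv w).

Lemma foldr_push_inv w v : reduced v ->
  foldr word_push (foldr word_push v w) (word_inv w) = v.
Proof.
move=> rv; elim: w => //= x w IH.
rewrite /word_inv map_cons rev_cons -cats1 foldr_cat /= word_pushK //.
exact: foldr_push_reduced.
Qed.

Lemma word_invK : involutive word_inv.
Proof.
by move=> w; rewrite /word_inv map_rev revK mapK //; exact: letter_invK.
Qed.

Definition F2 := {w : seq letter | reduced w}.
HB.instance Definition _ := Choice.on F2.

Definition F2_of (w : seq letter) : F2 :=
  exist _ (word_reduce w) (word_reduce_reduced w).

Definition F2_one : F2 := F2_of [::].
Definition F2_mul (u v : F2) : F2 := F2_of (val u ++ val v).
Definition F2_inv (u : F2) : F2 := F2_of (word_inv (val u)).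

Lemma F2_mulA : associative F2_mul.
Proof.
move=> [u ru] [v rv] [w rw]; apply: val_inj => /=.
rewrite !word_reduce_cat (word_reduce_id rw).
rewrite [X in foldr _ X _]word_reduce_id; last exact: foldr_push_reduced.
rewrite -word_reduce_cat -[RHS]/(foldr _ _ (word_reduce (u ++ v))).
by rewrite foldr_push_reduce // foldr_cat.
Qed.

Lemma F2_mul1g : left_id F2_one F2_mul.
Proof. by move=> [u ru]; apply: val_inj => /=; rewrite word_reduce_id. Qed.

Lemma F2_mulg1 : right_id F2_one F2_mul.
Proof.
by move=> [u ru]; apply: val_inj => /=; rewrite cats0 word_reduce_id.
Qed.

Lemma F2_mulVg : left_inverse F2_one F2_inv F2_mul.
Proof.
move=> [u ru]; apply: val_inj => /=.
rewrite word_reduce_cat foldr_push_reduce ?word_reduce_reduced//.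
exact: (@foldr_push_inv u [::]).
Qed.

Lemma F2_mulgV : right_inverse F2_one F2_inv F2_mul.
Proof.
move=> [u ru]; apply: val_inj => /=.
rewrite word_reduce_cat word_reduce_id ?word_reduce_reduced//.
by have := @foldr_push_inv (word_inv u) [::] isT; rewrite word_invK.
Qed.

HB.instance Definition _ :=
  isGroup.Build F2 F2_mulA F2_mul1g F2_mulg1 F2_mulVg F2_mulgV.


Definition unit_itv (R : realType) : set R := `[0, 1].
Arguments unit_itv R : clear implicits.
Definition I01 (R : realType) : Type := set_type (unit_itv R).

Section interval.
Context {R : realType}.

HB.instance Definition _ := Topological.copy (I01 R) (set_type (unit_itv R)).

Lemma mem_itv0 : (0 : R) \in unit_itv R.
Proof. by rewrite inE /unit_itv /= in_itv /= lexx ler01. Qed.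

Lemma mem_itv1 : (1 : R) \in unit_itv R.
Proof. by rewrite inE /unit_itv /= in_itv /= lexx ler01. Qed.

Definition I0 : I01 R := exist _ 0 mem_itv0.
Definition I1 : I01 R := exist _ 1 mem_itv1.

Lemma I0_neq_I1 : I0 != I1.
Proof. by apply/eqP => /(congr1 val)/= /esym/eqP; rewrite oner_eq0. Qed.

HB.instance Definition _ := isBiPointed.Build (I01 R) I0_neq_I1.

Lemma mem_clamp (r : R) : Num.max 0 (Num.min 1 r) \in unit_itv R.
Proof.
by rewrite inE /unit_itv /= in_itv /= le_max lexx ge_max ler01 ge_min lexx.
Qed.

Definition clamp (r : R) : I01 R := exist _ (Num.max 0 (Num.min 1 r)) (mem_clamp r).

Lemma clampK (t : I01 R) : clamp (val t) = t.
Proof.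
apply: val_inj => /=; have := valP t; rewrite inE /unit_itv /= in_itv /=.
by move=> /andP[t0 t1]; rewrite (min_idPr t1) (max_idPr t0).
Qed.

Lemma clamp0 (r : R) : r <= 0 -> clamp r = I0.
Proof.
move=> r0; apply: val_inj => /=.
by rewrite (min_idPr (le_trans r0 ler01)) (max_idPl r0).
Qed.

Lemma clamp1 (r : R) : 1 <= r -> clamp r = I1.
Proof.
by move=> r1; apply: val_inj => /=; rewrite (min_idPl r1) (max_idPr ler01).
Qed.

Lemma continuous_to_subtype (T U : topologicalType) (A : set U)
    (f : T -> set_type A) :
  continuous (val \o f) -> continuous f.
Proof.
move=> /continuousP cf; apply/continuousP => _ [B oB <-].
exact: cf.
Qed.

Lemma clamp_continuous : continuous clamp.
Proof.
apply: (@continuous_to_subtype _ _ (unit_itv R)) => r.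
apply: continuous_max; first exact: cvg_cst.
by apply: continuous_min; [exact: cvg_cst|exact: cvg_id].
Qed.

End interval.

Section path_cat.
Context {R : realType} {X : topologicalType} {x y z : X}.
Variables (g : {path I01 R from x to y}) (h : {path I01 R from y to z}).

Let cat_fun (r : R) : X :=
  if r <= 2^-1 then g (clamp (2 * r)) else h (clamp (2 * r - 1)).

Definition path_cat (t : I01 R) : X :=
  if val t <= 2^-1 then g (clamp (2 * val t)) else h (clamp (2 * val t - 1)).

Let cat_fun_continuous : continuous cat_fun.
Proof.
have cg : continuous (g \o clamp \o (fun r : R => 2 * r)).
  move=> r; apply: continuous_comp; first exact: mulrl_continuous.
  apply: continuous_comp; [exact: clamp_continuous|exact: cts_fun].
have ch : continuous (h \o clamp \o (fun r : R => 2 * r - 1)).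
  move=> r; apply: continuous_comp.
    by apply: cvgB; [exact: mulrl_continuous|exact: cvg_cst].
  apply: continuous_comp; [exact: clamp_continuous|exact: cts_fun].
apply/continuous_subspace_setT.
have -> : [set: R] = [set r | r <= 2^-1] `|` [set r | 2^-1 <= r].
  by apply/seteqP; split=> r //= _; apply/orP; exact: le_total.
apply: withinU_continuous; [exact: closed_le|exact: closed_ge| |].
- apply: (@subspace_eq_continuous _ _ _ (g \o clamp \o (fun r : R => 2 * r))).
    by move=> r; rewrite inE => /= r2; rewrite /from_subspace /cat_fun r2.
  exact: (continuous_subspaceT cg).
- apply: (@subspace_eq_continuous _ _ _
      (h \o clamp \o (fun r : R => 2 * r - 1))).
    move=> r; rewrite inE => /= r2; rewrite /from_subspace /cat_fun.
    case: ifP => // r2'; have -> : r = 2^-1 by apply/le_anti/andP.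
    rewrite clamp0; last by lra.
    rewrite clamp1; last by lra.
    by rewrite [LHS](path_zero (s := h)) [RHS](path_one (s := g)).
  exact: (continuous_subspaceT ch).
Qed.

Lemma path_cat_continuous : continuous path_cat.
Proof.
rewrite -[path_cat]/(cat_fun \o (set_val : unit_itv R -> R)) => t.
apply: continuous_comp; last exact: cat_fun_continuous.
exact: initial_continuous.
Qed.

Lemma path_cat0 : path_cat I0 = x.
Proof.
rewrite /path_cat /= invr_ge0 ler0n mulr0 clamp0 //.
exact: (path_zero (s := g)).
Qed.

Lemma path_cat1 : path_cat I1 = z.
Proof.
rewrite /path_cat /= ifF; last by apply/negbTE; rewrite -ltNge; lra.
rewrite clamp1; last by lra.
exact: (path_one (s := h)).
Qed.

HB.instance Definition _ := isContinuous.Build _ _ path_cat path_cat_continuous.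
HB.instance Definition _ := isPath.Build (I01 R) X x z path_cat
  path_cat0 path_cat1.

End path_cat.

Section fundamental_group.
Variables (R : realType) (X : topologicalType).

Definition path_homotopic (x y : X) (g h : {path I01 R from x to y}) : Prop :=
  exists H : continuousType (I01 R * I01 R)%type X,
    [/\ forall s, H (s, I0) = g s, forall s, H (s, I1) = h s,
        forall t, H (I0, t) = x & forall t, H (I1, t) = y].

(* A function on loops that identifies exactly the homotopic ones, is
   multiplicative and surjective is the same thing as a group isomorphism from
   pi_1(X, x) onto F2. *)
Definition pi1_isog_F2 (x : X) : Prop :=
  exists f : {path I01 R from x to x} -> F2,
    [/\ forall g h, f g = f h <-> path_homotopic g h,
        forall g h, f (path_cat g h) = (f g * f h)%g &
        forall w : F2, exists g, f g = w].

End fundamental_group.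

Section homotopy_equivalences.
Variable R : realType.

Definition homotopic (X Y : topologicalType) (f g : continuousType X Y) : Prop :=
  exists H : continuousType (X * I01 R)%type Y,
    (forall x, H (x, I0) = f x) /\ (forall x, H (x, I1) = g x).

Definition homotopy_equivalence (X : topologicalType)
    (f : continuousType X X) : Prop :=
  exists g : continuousType X X,
    homotopic (g \o f) idfun /\ homotopic (f \o g) idfun.

Definition homotopy_class (X : topologicalType) (f : continuousType X X) :
    set (continuousType X X) :=
  [set g | homotopic f g].

(* The set of homotopy classes of self homotopy equivalences; for a graph X with
   pi_1(X) isomorphic to F2, this is Out(F_2). *)
Definition Out_of (X : topologicalType) : set (set (continuousType X X)) :=
  [set homotopy_class f | f in @homotopy_equivalence X].

End homotopy_equivalences.

Arguments Out_of R X : clear implicits.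


(* A graph is a CW complex of dimension at most 1, with set of vertices V and
   characteristic maps of the edges c: the points that are not vertices lie in
   exactly one open edge, and X carries the weak topology. *)
Definition is_graph (R : realType) (X : topologicalType) : Prop :=
  exists (V : set X) (E : Type) (c : E -> continuousType (I01 R) X),
    let inner (t : I01 R) := 0 < val t < 1 in
    [/\ forall e, V (c e I0) /\ V (c e I1),
        forall e t, inner t -> ~ V (c e t),
        forall e e' t t', inner t -> inner t' -> c e t = c e' t' ->
          e = e' /\ t = t',
        forall x, V x \/ (exists e t, inner t /\ x = c e t) &
        forall A : set X, (forall e, closed (c e @^-1` A)) -> closed A].


Section coverings.
Context {X Y : topologicalType} (p : continuousType Y X).

(* s is the inverse of the restriction of p; its values outside U are
   irrelevant. *)
Definition homeo_onto (W : set Y) (U : set X) : Prop :=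
  exists s : X -> Y,
    [/\ {within U, continuous s},
        forall y, W y -> U (p y) /\ s (p y) = y &
        forall x, U x -> W (s x) /\ p (s x) = x].

Definition evenly_covered (U : set X) : Prop :=
  exists (J : Type) (W : J -> set Y),
    [/\ forall j, open (W j), trivIset [set: J] W,
        p @^-1` U = \bigcup_j W j & forall j, homeo_onto (W j) U].

Definition covering : Prop :=
  (forall x, exists y, p y = x) /\
  (forall x, exists U, [/\ open U, U x & evenly_covered U]).

Definition deck (h : continuousType Y Y) : Prop :=
  p \o h =1 p /\
  exists h' : continuousType Y Y, cancel h h' /\ cancel h' h.

Definition regular_covering : Prop :=
  covering /\ forall y y', p y = p y' -> exists2 h, deck h & h y = y'.

Definition finite_fibres : Prop := forall x, finite_set (p @^-1` [set x]).

Definition is_lift (f : continuousType X X) (ft : continuousType Y Y) : Prop :=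
  p \o ft =1 f \o p.

End coverings.


Definition std_simplex (R : realType) (n : nat) : set 'rV[R]_n.+1 :=
  [set t | (forall i, 0 <= t ord0 i) /\ \sum_i t ord0 i = 1].
Arguments std_simplex : clear implicits.

Definition Delta (R : realType) (n : nat) : Type := set_type (std_simplex R n).
HB.instance Definition _ (R : realType) (n : nat) :=
  Topological.copy (Delta R n) (set_type (std_simplex R n)).

Section faces.
Context {R : realType} {n : nat}.
Variable i : 'I_n.+2.

Definition face_row (t : 'rV[R]_n.+1) : 'rV[R]_n.+2 :=
  \row_j (if unlift i j is Some k then t ord0 k else 0).

Lemma face_row_simplex (t : Delta R n) :
  face_row (val t) \in std_simplex R n.+1.
Proof.
have := valP t; rewrite !inE => -[t0 t1]; split.
  by move=> j; rewrite mxE; case: unliftP => // k _.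
rewrite -t1 (bigD1_ord i) //= mxE unlift_none add0r.
by apply: eq_bigr => k _; rewrite mxE liftK.
Qed.

Definition face (t : Delta R n) : Delta R n.+1 :=
  exist _ (face_row (val t)) (face_row_simplex t).

Lemma face_row_continuous : continuous face_row.
Proof.
move=> t A [P tP PA].
have Pt j : \forall u \near t, P ord0 j (face_row u ord0 j).
  have := tP ord0 j; rewrite /face_row !mxE => Pj.
  suff : \forall u \near t, P ord0 j (if unlift i j is Some k then
      (u : 'rV[R]_n.+1) ord0 k else 0).
    by apply: filterS => u; rewrite mxE.
  case: (unlift i j) Pj => [k|] Pj; first exact: (@coord_continuous R _ _ ord0 k).
  apply: filterS (filterT (F := nbhs t)) => u _; exact: nbhs_singleton Pj.
apply: filterS (filter_forall _ Pt) => u Pu.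
by apply: PA => a b; rewrite ord1; exact: Pu.
Qed.

Lemma face_continuous : continuous face.
Proof.
apply: (@continuous_to_subtype _ _ (std_simplex R n.+1)).
rewrite -[_ \o _]/(face_row \o (set_val : std_simplex R n -> 'rV[R]_n.+1)) => t.
apply: continuous_comp; last exact: face_row_continuous.
exact: initial_continuous.
Qed.

HB.instance Definition _ := isContinuous.Build _ _ face face_continuous.

End faces.

Section homology.
Variable R : realType.

Definition singular (n : nat) (Y : topologicalType) : Type :=
  continuousType (Delta R n) Y.
HB.instance Definition _ n Y := Choice.copy (singular n Y)
  (continuousType (Delta R n) Y).

Definition singular_face n Y (i : 'I_n.+2) (s : singular n.+1 Y) :
    singular n Y :=
  s \o face i.

Definition singular_comp n (Y Z : topologicalType) (f : continuousType Y Z)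
    (s : singular n Y) : singular n Z :=
  f \o s.

(* c s is the coefficient of s; the singular n-chains of Y are the c with
   finite support. *)
Definition chain (n : nat) (Y : topologicalType) : Type := singular n Y -> rat.

Definition finitely_supported n Y (c : chain n Y) : Prop :=
  finite_set [set s | c s != 0].

Definition boundary n Y (c : chain n.+1 Y) : chain n Y := fun t =>
  \sum_(i < n.+2) (-1) ^+ i * \sum_(s \in [set s | singular_face i s = t]) c s.

Definition chain_map n (Y Z : topologicalType) (f : continuousType Y Z)
    (c : chain n Y) : chain n Z := fun t =>
  \sum_(s \in [set s | singular_comp f s = t]) c s.

Definition cycle1 Y (z : chain 1 Y) : Prop :=
  finitely_supported z /\ forall t, boundary z t = 0.

Definition homologous Y (z z' : chain 1 Y) : Prop :=
  exists w : chain 2 Y,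
    finitely_supported w /\ forall s, z s - z' s = boundary w s.

(* Homology classes are represented as cosets of the boundaries in the cycles.
*)
Definition homology_class Y (z : chain 1 Y) : set (chain 1 Y) :=
  [set z' | cycle1 z' /\ homologous z' z].

Definition H1 Y : set (set (chain 1 Y)) :=
  [set homology_class z | z in @cycle1 Y].

Definition H1_zero Y : set (chain 1 Y) := homology_class (fun=> 0).

Definition H1_map (Y Z : topologicalType) (f : continuousType Y Z)
    (v : set (chain 1 Y)) : set (chain 1 Z) :=
  \bigcup_(z in v) homology_class (chain_map f z).

End homology.

Arguments H1 R Y : clear implicits.
Arguments H1_zero R Y : clear implicits.

(* Main.v *)
Require Import Defs.
From HB Require Import structures.
From mathcomp Require Import all_boot all_order all_algebra.
From mathcomp Require Import all_classical all_reals topology normedtype homotopy.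
From mathcomp Require Import ring lra zify.

Set Implicit Arguments.
Unset Strict Implicit.
Unset Printing Implicit Defensive.

Import Order.TTheory GRing.Theory Num.Theory.
Import numFieldNormedType.Exports.

Local Open Scope classical_set_scope.
Local Open Scope ring_scope.

(** A double cover suffices. Its deck group is {1, T}, and the rational first
    homology of Y splits into a T-invariant and a T-anti-invariant part. When X has
    fundamental group F_2 and Y is the double cover that unwraps one generator, the
    anti-invariant part is a line. It is spanned by zeta = T beta - beta, where beta
    is a lift of the other generator (geometrically: a lift of the commutator of the
    generators, that is, a boundary curve of a covering of the punctured torus).

    Let ft be a lift of a homotopy equivalence f. Since ft T and ft lift the same
    map, either ft T = ft, and then ft kills zeta, or ft T = T ft
    ([lift_flip]). In the second case ft acts on the line by a scalar n. This scalar
    is an integer, because T c - c is an integral multiple of zeta for every loop c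
    of Y ([anti_loop_zeta]). It is invertible: if g is a homotopy inverse of f, the
    free homotopy from beta, projected to X, to its image under f g lifts to a free
    homotopy from beta to ft D, where D is a closed lift of the image under g
    ([free_homotopy_lift]). If T D - D = m zeta, then zeta = m n zeta, and m n = 1
    as zeta is not zero ([zeta_not_bounds]). So the orbit of the class of zeta has
    at most three elements ([lift_action]). This uses no description of the
    automorphisms of F_2.

    X is the complete graph on four vertices without an edge, realized by
    barycentric coordinates. Open stars of vertices are cones, two of them meet at
    most in an open edge, and points of one edge are joined by a straight segment.
    Coverings of X are described by voltages on its edges, and the basic tool is
    parallel transport: a lift of a path or of a square is a function with values in
    the fibre that is locally constant up to the change of star, and it exists by
    bisection ([parallel_ex]). Transport with fibre F_2 gives the isomorphism from
    the fundamental group ([pi1_theta]); fibre bool gives lifts to Y; fibre int gives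
    the winding number that detects zeta.

    For the injectivity on the fundamental group a loop is replaced by an edge
    path ([simplicial_approximation]) and then by a product of triangles at one
    vertex, one for each letter of a word. Reductions of words are performed at
    constant length, with pauses in place of the cancelled letters, so that every
    move is a straight-line homotopy. For the homology, antisymmetrized edges are
    differences of a potential on the vertices up to multiples of zeta, so that the
    antisymmetrization of a loop telescopes ([anti_path]). *)

(** * Realization of a finite graph in barycentric coordinates *)

(** Adjacency is reflexive, so that an edge may degenerate to a vertex and walks
    may pause. The base vertex is a default value, and the vertex that walks can
    be made to return to. *)
Record graph := Graph {
  vert :> finType;
  base : vert;
  gadj : rel vert;
  gadj_refl : reflexive gadj;
  gadj_sym : symmetric gadj }.

Section realization.
Variables (R : realType) (G : graph).
Implicit Types (f : G -> R) (u v w : G).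

(** Barycentric coordinates whose support lies in one edge. Asking for one edge,
    instead of pairwise adjacency of the support, excludes the interior of the
    triangles of the graph. *)
Definition in_graph f : Prop :=
  [/\ forall v, 0 <= f v, \sum_v f v = 1 &
      exists u v, gadj u v /\ forall w, f w != 0 -> w = u \/ w = v].

Definition realization : set 'rV[R]_#|G| :=
  [set x | in_graph (fun v => x ord0 (enum_rank v))].

Definition geom : Type := set_type realization.
HB.instance Definition _ := Topological.copy geom (set_type realization).

Definition crd (x : geom) v : R := val x ord0 (enum_rank v).

Lemma crd_in (x : geom) : in_graph (crd x).
Proof. by have := valP x; rewrite inE. Qed.

Lemma row_in f : in_graph f -> (\row_i f (enum_val i)) \in realization.
Proof.
move=> fP; rewrite inE /realization /=.
by under eq_fun do rewrite mxE enum_rankK.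
Qed.

Lemma in_graph_pt v : in_graph (fun w => (w == v)%:R).
Proof.
split=> [w||]; first by rewrite ler0n.
  by rewrite (bigD1 v) //= eqxx big1 ?addr0// => w /negbTE ->.
exists v, v; split; first exact: gadj_refl.
by move=> w; have [->|] := eqVneq w v; [left|rewrite eqxx].
Qed.

(** A total function, so that maps into the realization can be written down by
    their coordinates; the value at the base vertex is a default. *)
Definition to_graph f : geom :=
  if pselect (in_graph f) is left fP
  then exist (fun x => x \in realization) _ (row_in fP)
  else exist (fun x => x \in realization) _ (row_in (in_graph_pt (base G))).

Lemma to_graphE f v : in_graph f -> crd (to_graph f) v = f v.
Proof.
by rewrite /to_graph; case: pselect => // fP _; rewrite /crd /= mxE enum_rankK.
Qed.

Lemma crd_ext (x y : geom) : crd x =1 crd y -> x = y.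
Proof.
move=> xy; apply: val_inj; apply/rowP => i.
by have := xy (enum_val i); rewrite /crd enum_valK.
Qed.

Lemma crd_continuous v : continuous (crd ^~ v).
Proof.
move=> x; rewrite /crd.
apply: (@continuous_comp _ _ _ (set_val : realization -> _)
  (fun y : 'rV[R]_#|G| => y ord0 (enum_rank v))).
  exact: initial_continuous.
exact: coord_continuous.
Qed.

Lemma geom_continuous_at (Z : topologicalType) (F : Z -> geom) z :
  (forall v, {for z, continuous (fun z => crd (F z) v)}) ->
  {for z, continuous F}.
Proof.
move=> cF; suff cvF : {for z, continuous (val \o F)}.
  move=> A; rewrite nbhsE => -[B [[C oC <-] CFz] BA].
  have nC : \forall z' \near z, C (val (F z')).
    exact: cvF C (open_nbhs_nbhs (conj oC CFz)).
  by apply: filterS nC => z' Cz'; exact: BA.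
move=> A [P zP PA].
have Pz j : \forall z' \near z, P ord0 j ((val \o F) z' ord0 j).
  have := cF (enum_val j); rewrite /crd enum_valK; apply; exact: (zP ord0 j).
apply: filterS (filter_forall _ Pz) => z' Pz'.
by apply: PA => a b; rewrite ord1; exact: Pz'.
Qed.

Lemma geom_continuous (Z : topologicalType) (F : Z -> geom) :
  (forall v, continuous (fun z => crd (F z) v)) -> continuous F.
Proof. by move=> cF z; apply: geom_continuous_at => v; exact: cF. Qed.

Lemma crd_ge0 x v : 0 <= crd x v.
Proof. by have [] := crd_in x. Qed.

Lemma crd_sum x : \sum_v crd x v = 1.
Proof. by have [] := crd_in x. Qed.

Lemma crd_gt0 x v : (0 < crd x v) = (crd x v != 0).
Proof. by rewrite lt_def crd_ge0 andbT. Qed.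

Lemma crd_simplex x : exists u v, gadj u v /\
  forall w, 0 < crd x w -> w = u \/ w = v.
Proof.
have [_ _ [u [v [uv uvP]]]] := crd_in x; exists u, v; split=> // w.
by rewrite crd_gt0; exact: uvP.
Qed.

Lemma crd_adj x u v : 0 < crd x u -> 0 < crd x v -> gadj u v.
Proof.
move=> xu xv; have [a [b [ab abP]]] := crd_simplex x.
by have [->|->] := abP _ xu; have [->|->] := abP _ xv;
  rewrite ?gadj_refl// gadj_sym.
Qed.

Lemma crd_two x u v w : 0 < crd x u -> 0 < crd x v -> 0 < crd x w ->
  [\/ u = v, v = w | u = w].
Proof.
move=> xu xv xw; have [a [b [ab abP]]] := crd_simplex x.
by have [->|->] := abP _ xu; have [->|->] := abP _ xv;
  have [->|->] := abP _ xw; constructor.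
Qed.

Lemma vtx_ex x : exists v, 0 < crd x v.
Proof.
apply/existsP; apply: contraT => /existsPn x0.
have := crd_sum x; rewrite big1 => [/esym/eqP|v _]; first by rewrite oner_eq0.
by apply/eqP; have := x0 v; rewrite crd_gt0 negbK.
Qed.

(** Some vertex whose open star contains x. It is not continuous in x: the jumps of
    vtx along a path are what parallel transport records. *)
Definition vtx x : G := xchoose (vtx_ex x).

Lemma vtx_gt0 x : 0 < crd x (vtx x).
Proof. exact: (xchooseP (vtx_ex x)). Qed.

Lemma star_near v (Z : topologicalType) (F : Z -> geom) z :
  {for z, continuous F} -> 0 < crd (F z) v ->
  \forall z' \near z, 0 < crd (F z') v.
Proof.
move=> cF Fv.
have : (fun z => crd (F z) v) @ z --> crd (F z) v.
  exact: (cvg_comp _ _ cF (@crd_continuous v _)).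
by move=> /(_ _ (lt_nbhsr Fv)).
Qed.

Definition pt v : geom := to_graph (fun w => (w == v)%:R).

Lemma crd_pt v w : crd (pt v) w = (w == v)%:R.
Proof. by rewrite /pt to_graphE//; exact: in_graph_pt. Qed.

Lemma crd_pt_gt0 v w : (0 < crd (pt v) w) = (w == v).
Proof. by rewrite crd_pt; case: eqP => _; rewrite ?ltr01 ?ltxx. Qed.

Lemma vtx_pt v : vtx (pt v) = v.
Proof. by apply/eqP; rewrite -crd_pt_gt0 vtx_gt0. Qed.

(** Two points of a common closed edge; the segment between them stays in the
    realization, which makes straight-line homotopies available. *)
Definition joined (x y : geom) : Prop :=
  exists u v, gadj u v /\
    forall w, 0 < crd x w \/ 0 < crd y w -> w = u \/ w = v.

Lemma joined_refl x : joined x x.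
Proof.
by have [u [v [uv H]]] := crd_simplex x; exists u, v; split=> // w [] /H.
Qed.

Lemma joined_star x y v w : 0 < crd x v -> 0 < crd x w ->
  (forall u, 0 < crd y u -> u = v \/ u = w) -> joined x y.
Proof.
move=> xv xw yP; case: (eqVneq v w) xv yP => [->|nvw] xv yP.
  have [a [b [ab abP]]] := crd_simplex x; exists a, b; split=> // u [/abP//|].
  by move=> /yP[->|->]; exact: abP.
exists v, w; split; first exact: crd_adj xv xw.
move=> u [xu|/yP//].
case: (crd_two xu xv xw) => [->|E|->]; [by left| |by right].
by rewrite E eqxx in nvw.
Qed.

End realization.

(** * Bisection of the interval and of the square *)

Section bisection.
Variable R : realType.

(** Compactness of the interval in the form in which paths use it: an additive
    property of subintervals that holds for short ones passes to [0, 1]. The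
    supremum of the t with P 0 t is attained and equals 1. *)
Lemma bisect (P : R -> R -> Prop) :
  (forall a b c, 0 <= a -> a <= b -> b <= c -> c <= 1 ->
    P a b -> P b c -> P a c) ->
  (forall x, 0 <= x -> x <= 1 -> exists2 e, 0 < e & forall a b,
    0 <= a -> b <= 1 -> x - e < a -> a <= x -> x <= b -> b < x + e -> P a b) ->
  P 0 1.
Proof.
move=> glue loc; pose A := [set t | [/\ 0 <= t, t <= 1 & P 0 t]].
have A0 : A 0.
  have [e e0 eP] := loc 0 (lexx _) ler01.
  by split=> //; apply: eP => //; lra.
have hA : has_sup A by split; [exists 0|exists 1 => t []].
have s0 : 0 <= sup A by apply: sup_upper_bound.
have s1 : sup A <= 1 by apply: ge_sup; [exists 0|move=> t []].
have [e e0 eP] := loc _ s0 s1.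
have [t [t0 t1 Pt] st] := sup_adherent e0 hA.
have ts : t <= sup A by apply: sup_upper_bound.
(* a point beyond the supremum, unless the supremum is 1 *)
pose b := Num.min 1 (sup A + e / 2).
have sb : sup A <= b by rewrite le_min s1/=; lra.
have be : b <= sup A + e / 2 by rewrite ge_min lexx orbT.
have b1 : b <= 1 by rewrite ge_min lexx.
have Pb : P 0 b.
  apply: (glue 0 t b) => //; first by lra.
  by apply: eP => //; lra.
have : b <= sup A by apply: sup_upper_bound => //; split=> //; lra.
rewrite /b; have [h|h] := leP 1 (sup A + e / 2); last by lra.
by move=> _; move: Pb; rewrite /b; move/min_idPl: h => ->.
Qed.

(** Bisection in x of the property of holding on a whole strip; strips are reached by
    bisection in y, the width being the minimum of finitely many widths. *)
Lemma bisect2 (P : R -> R -> R -> R -> Prop) :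
  (forall a b c s t, 0 <= a -> a <= b -> b <= c -> c <= 1 ->
    0 <= s -> s <= t -> t <= 1 -> P a b s t -> P b c s t -> P a c s t) ->
  (forall a b s t u, 0 <= a -> a <= b -> b <= 1 ->
    0 <= s -> s <= t -> t <= u -> u <= 1 -> P a b s t -> P a b t u -> P a b s u) ->
  (forall x y, 0 <= x -> x <= 1 -> 0 <= y -> y <= 1 ->
    exists2 e, 0 < e & forall a b s t,
      [/\ 0 <= a, b <= 1, x - e < a <= x & x <= b < x + e] ->
      [/\ 0 <= s, t <= 1, y - e < s <= y & y <= t < y + e] ->
      P a b s t) ->
  P 0 1 0 1.
Proof.
move=> glue1 glue2 loc; apply: (@bisect (fun a b => P a b 0 1)).
  by move=> a b c a0 ab bc c1; apply: glue1.
move=> x x0 x1.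
pose Q s t := exists2 e, (0 < e) & forall a b,
  0 <= a -> b <= 1 -> x - e < a -> a <= x -> x <= b -> b < x + e -> P a b s t.
suff : Q 0 1 by [].
apply: bisect => [s t u s0 st tu u1 [e e0 eP] [e' e'0 e'P]|y y0 y1].
  exists (Num.min e e'); first by rewrite lt_min e0 e'0.
  move=> a b a0 b1 xa ax xb bx.
  have := ge_min e e e'; have := ge_min e' e e'; rewrite !lexx orbT /= => m1 m2.
  apply: (glue2 a b s t u) => //; [lra|apply: eP => //; lra|apply: e'P => //; lra].
have [e e0 eP] := loc x y x0 x1 y0 y1; exists e => // s t s0 t1 ys sy yt ty.
by exists e => // a b *; apply: eP; split=> //; apply/andP.
Qed.

End bisection.

Section clip.
Variable R : realType.
Implicit Types a b r : R.

(** Paths and squares are handled as maps on the whole line or plane; composing with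
    clip makes them constant outside [a, b]. *)
Definition clip a b r : R := Num.max a (Num.min b r).

Lemma clip_continuous a b : continuous (clip a b).
Proof.
move=> r; apply: continuous_max; first exact: cvg_cst.
by apply: continuous_min; [exact: cvg_cst|exact: cvg_id].
Qed.

Lemma clip_ge a b r : a <= clip a b r.
Proof. by rewrite /clip le_max lexx. Qed.

Lemma clip_le a b r : a <= b -> clip a b r <= b.
Proof. by move=> ab; rewrite /clip ge_max ab ge_min lexx. Qed.

Lemma clip_id a b r : a <= r -> r <= b -> clip a b r = r.
Proof. by move=> ar rb; rewrite /clip (min_idPr rb) (max_idPr ar). Qed.

Lemma clip_lo a b r : a <= b -> r <= a -> clip a b r = a.
Proof.
by move=> ab ra; rewrite /clip (min_idPr (le_trans ra ab)) (max_idPl ra).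
Qed.

Lemma clip_hi a b r : a <= b -> b <= r -> clip a b r = b.
Proof. by move=> ab br; rewrite /clip (min_idPl br) (max_idPr ab). Qed.

Lemma clip_glue_left a b c r : a <= b -> b <= c -> b <= r -> clip b c r = clip a c r.
Proof.
move=> ab bc br; have bm : b <= Num.min c r by rewrite le_min bc br.
by rewrite /clip (max_idPr bm) (max_idPr (le_trans ab bm)).
Qed.

Lemma clip_glue_right a b c r : a <= b -> b <= c -> r <= b -> clip a b r = clip a c r.
Proof.
by move=> ab bc rb; rewrite /clip (min_idPr rb) (min_idPr (le_trans rb bc)).
Qed.

End clip.

(** * Straight segments in a realization *)

Section comb.
Variables (R : realType) (G : graph).
Implicit Types (x y : geom R G) (t : R).

Definition comb t x y : geom R G :=
  to_graph (fun v => (1 - t) * crd x v + t * crd y v).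

Lemma crd_comb t x y v : joined x y -> 0 <= t -> t <= 1 ->
  crd (comb t x y) v = (1 - t) * crd x v + t * crd y v.
Proof.
move=> [a [b [ab abP]]] t0 t1; have t1' : 0 <= 1 - t by lra.
rewrite /comb to_graphE//; split=> [w||].
- by rewrite addr_ge0// mulr_ge0// crd_ge0.
- by rewrite big_split/= -!mulr_sumr !crd_sum; lra.
exists a, b; split=> // w; apply: contra_neqP => nab.
have [xw yw] : crd x w = 0 /\ crd y w = 0.
  by split; apply/eqP; apply: contra_notT nab; rewrite -crd_gt0 => ?;
    apply: abP; [left|right].
by rewrite xw yw !mulr0 addr0.
Qed.

Lemma comb0 x y : joined x y -> comb 0 x y = x.
Proof. by move=> j; apply: crd_ext => v; rewrite crd_comb//; ring. Qed.

Lemma comb1 x y : joined x y -> comb 1 x y = y.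
Proof. by move=> j; apply: crd_ext => v; rewrite crd_comb//; ring. Qed.

Lemma combxx t x : 0 <= t -> t <= 1 -> comb t x x = x.
Proof.
by move=> *; apply: crd_ext => v; rewrite crd_comb//;
  [ring|exact: joined_refl].
Qed.

Lemma comb_supp t x y v : joined x y -> 0 <= t -> t <= 1 ->
  0 < crd (comb t x y) v -> 0 < crd x v \/ 0 < crd y v.
Proof.
move=> j t0 t1; rewrite crd_comb// => h.
have [x0|] := ltP 0 (crd x v); first by left.
have [y0|] := ltP 0 (crd y v); first by right.
move=> y0 x0; have /eqP : crd x v = 0 by apply/le_anti; rewrite x0 crd_ge0.
have /eqP : crd y v = 0 by apply/le_anti; rewrite y0 crd_ge0.
by move=> /eqP yE /eqP xE; move: h; rewrite xE yE !mulr0 addr0 ltxx.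
Qed.

Lemma comb_continuous (Z : topologicalType) (t : Z -> R) (x y : Z -> geom R G) :
  (forall z, joined (x z) (y z)) -> (forall z, 0 <= t z /\ t z <= 1) ->
  continuous t -> continuous x -> continuous y ->
  continuous (fun z => comb (t z) (x z) (y z)).
Proof.
move=> j t01 ct cx cy; apply: geom_continuous => v.
under eq_fun => z do rewrite (crd_comb _ (j z) (proj1 (t01 z)) (proj2 (t01 z))).
have ccx : continuous (fun z => crd (x z) v).
  by move=> z; exact: (cvg_comp _ _ (cx z) (@crd_continuous _ _ v _)).
have ccy : continuous (fun z => crd (y z) v).
  by move=> z; exact: (cvg_comp _ _ (cy z) (@crd_continuous _ _ v _)).
move=> z; apply: cvgD; apply: cvgM => //; [|exact: ccx|exact: ct|exact: ccy].
by apply: cvgB; [exact: cvg_cst|exact: ct].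
Qed.

End comb.

(** * Continuity and connectedness *)

Lemma cont_comp (A B C : topologicalType) (f : A -> B) (g : B -> C) :
  continuous f -> continuous g -> continuous (g \o f).
Proof. by move=> cf cg x; exact: (cvg_comp _ _ (cf x) (cg (f x))). Qed.

Lemma cont_pair (A B C : topologicalType) (f : A -> B) (g : A -> C) :
  continuous f -> continuous g -> continuous (fun x => (f x, g x)).
Proof. by move=> cf cg x; apply: (cvg_pair (cf x) (cg x)). Qed.

Lemma cont_id (A : topologicalType) : continuous (fun x : A => x).
Proof. by move=> x; exact: cvg_id. Qed.

Lemma cont_cst (A B : topologicalType) (b : B) : continuous (fun x : A => b).
Proof. by move=> x; exact: cvg_cst. Qed.

Lemma cont_fst (A B : topologicalType) : continuous (fun x : A * B => x.1).
Proof. by move=> x; exact: cvg_fst. Qed.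

Lemma cont_snd (A B : topologicalType) : continuous (fun x : A * B => x.2).
Proof. by move=> x; exact: cvg_snd. Qed.

Section real_valued.
Variables (R : realType) (A : topologicalType) (f g : A -> R).
Hypotheses (cf : continuous f) (cg : continuous g).

Lemma cont_add : continuous (fun x => f x + g x).
Proof. by move=> x; apply: cvgD; [exact: cf|exact: cg]. Qed.

Lemma cont_sub : continuous (fun x => f x - g x).
Proof. by move=> x; apply: cvgB; [exact: cf|exact: cg]. Qed.

Lemma cont_mul : continuous (fun x => f x * g x).
Proof. by move=> x; apply: cvgM; [exact: cf|exact: cg]. Qed.

End real_valued.

Lemma connected_clopen (Z : topologicalType) (B : set Z) z0 :
  connected [set: Z] -> B z0 ->
  (forall z, B z -> \forall z' \near z, B z') ->
  (forall z, ~ B z -> \forall z' \near z, ~ B z') -> forall z, B z.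
Proof.
move=> cZ B0 Bo Bc z; suff -> : B = setT by [].
have oB : open B by rewrite openE => y /Bo.
apply: cZ; [by exists z0|exists B; rewrite ?setTI//|].
exists B; rewrite ?setTI//.
by rewrite -[B]setCK; apply: open_closedC; rewrite openE => y /Bc.
Qed.

Lemma connected_line (R : realType) : connected [set: R].
Proof. by apply/connected_intervalP => x y _ _ z _. Qed.

(** * Parallel transport along maps into a graph *)

Section transport.
Variables (R : realType) (G : graph).

(** Bijections between copies of a fibre S, one for each oriented edge. They are the
    transition functions of a covering with fibre S; taking S = F2, bool and int
    gives the universal cover, a double cover and an infinite cyclic cover. *)
Record voltage (S : Type) := Voltage {
  volt :> G -> G -> S -> S;
  volt_id : forall u s, volt u u s = s;
  voltK : forall u v, gadj u v -> cancel (volt u v) (volt v u) }.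

Section fibre.
Variables (S : Type) (phi : voltage S).

(** A lift of F to the covering described by phi. The fibre over x is identified with
    S through the star of vtx x, and h has to be locally constant up to the change
    of star. *)
Definition parallel (Z : topologicalType) (F : Z -> geom R G) (h : Z -> S) :=
  forall z, \forall z' \near z, h z' = phi (vtx (F z)) (vtx (F z')) (h z).

(** At most two of the three vertices are different, because a point lies in a
    single edge; a cocycle condition on triangles is void. *)
Lemma volt_cocycle (x : geom R G) u v w s :
  0 < crd x u -> 0 < crd x v -> 0 < crd x w ->
  phi v w (phi u v s) = phi u w s.
Proof.
move=> xu xv xw; case: (crd_two xu xv xw) => [->|->|E]; rewrite ?volt_id//.
by rewrite -E volt_id voltK//; exact: crd_adj xu xv.
Qed.

Lemma parallel_comp (Z Z' : topologicalType) (F : Z -> geom R G) h (g : Z' -> Z) :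
  continuous g -> parallel F h -> parallel (F \o g) (h \o g).
Proof. by move=> cg Fh z; exact: (cg z _ (Fh (g z))). Qed.

Lemma parallel_star (Z : topologicalType) (F : Z -> geom R G) v s :
  continuous F -> (forall z, 0 < crd (F z) v) ->
  parallel F (fun z => phi v (vtx (F z)) s).
Proof.
move=> cF Fv z; have := star_near (cF z) (vtx_gt0 (F z)).
apply: filterS => z' Fz'; apply/esym; apply: (@volt_cocycle (F z')) => //.
exact: vtx_gt0.
Qed.

Lemma parallel_edge (Z : topologicalType) (F : Z -> geom R G) v w s :
  gadj v w -> (forall z u, 0 < crd (F z) u -> u = v \/ u = w) ->
  parallel F (fun z => phi v (vtx (F z)) s).
Proof.
move=> vw Fvw z; apply: nearW => z'.
by have [->|->] := Fvw _ _ (vtx_gt0 (F z)); have [->|->] := Fvw _ _ (vtx_gt0 (F z'));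
  rewrite ?volt_id ?voltK.
Qed.

Lemma parallel_cst (Z : topologicalType) (x : geom R G) s :
  @parallel Z (cst x) (cst s).
Proof. by move=> z; apply: nearW => z'; rewrite /cst volt_id. Qed.

Lemma parallel_eq (Z : topologicalType) (F F' : Z -> geom R G) h :
  F =1 F' -> parallel F h -> parallel F' h.
Proof. by move=> /funext ->. Qed.

(** Both agreement and disagreement are open conditions, the latter because the
    voltages are injective. *)
Lemma parallel_uniq (Z : topologicalType) (F : Z -> geom R G) h h' z0 :
  connected [set: Z] -> continuous F -> parallel F h -> parallel F h' ->
  h z0 = h' z0 -> h =1 h'.
Proof.
move=> cZ cF Fh Fh' e0; apply: (connected_clopen cZ e0) => z /= e.
  by apply: filterS2 (Fh z) (Fh' z) => z' -> ->; rewrite e.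
apply: filterS3 (Fh z) (Fh' z) (star_near (cF z) (vtx_gt0 (F z))).
move=> z' -> -> Fz' e'; apply: e; apply: (can_inj (@voltK _ phi _ _ _) e').
by apply: crd_adj Fz' _; exact: vtx_gt0.
Qed.

Lemma parallel_glue (Z : topologicalType) (F F1 F2 : Z -> geom R G)
    (p : Z -> R) b h1 h2 :
  continuous p ->
  (forall z, p z <= b -> F1 z = F z) -> (forall z, b <= p z -> F2 z = F z) ->
  parallel F1 h1 -> parallel F2 h2 -> (forall z, p z = b -> h1 z = h2 z) ->
  parallel F (fun z => if p z <= b then h1 z else h2 z).
Proof.
move=> cp E1 E2 P1 P2 h12 z.
have [pb|pb|pb] := ltgtP (p z) b.
- have near_b : \forall z' \near z, p z' < b := cp z _ (lt_nbhsl pb).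
  apply: filterS2 near_b (P1 z) => z' pz' ->.
  by rewrite !E1 ?ltW.
- have near_b : \forall z' \near z, b < p z' := cp z _ (lt_nbhsr pb).
  apply: filterS2 near_b (P2 z) => z' pz' ->.
  by rewrite leNgt pz' /= !E2 ?ltW.
- apply: filterS2 (P1 z) (P2 z) => z' -> ->.
  rewrite -(h12 _ pb) (E1 z) ?pb// (E2 z) ?pb//.
  by case: leP => [pz'|/ltW pz']; [rewrite E1|rewrite E2].
Qed.

Definition rect (a b c d : R) (z : R * R) : R * R := (clip a b z.1, clip c d z.2).

Lemma rect_continuous a b c d : continuous (rect a b c d).
Proof.
apply: cont_pair.
  exact: (cont_comp (@cont_fst _ _) (@clip_continuous _ a b)).
exact: (cont_comp (@cont_snd _ _) (@clip_continuous _ c d)).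
Qed.

(** Lifts over a small rectangle exist because its image lies in one star. Two
    rectangles with a common side are glued: the lifts agree at one corner, hence
    along the side, which is connected. *)
Lemma parallel_ex (F : R * R -> geom R G) s : continuous F ->
  exists2 h, parallel (F \o rect 0 1 0 1) h & h (0, 0) = s.
Proof.
move=> cF; move: s.
apply: (@bisect2 R (fun a b c d => forall s,
  exists2 h, parallel (F \o rect a b c d) h & h (a, c) = s)).
- move=> a b c d e a0 ab bc c1 d0 de e1 H1 H2 s.
  have [h1 P1 e1'] := H1 s; have [h2 P2 e2] := H2 (h1 (b, d)).
  exists (fun z => if z.1 <= b then h1 z else h2 z); last by rewrite /= ab.
  apply: (parallel_glue _ _ _ P1 P2).
  + exact: cont_fst.
  + by move=> z zb; rewrite /= /rect (clip_glue_right ab bc).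
  + by move=> z zb; rewrite /= /rect (clip_glue_left ab bc).
  + case=> x y /= ->.
    pose l (t : R) := (b, t).
    have cl : continuous l by apply: cont_pair; [exact: cont_cst|exact: cont_id].
    have E : F \o rect b c d e \o l =1 F \o rect a b d e \o l.
      by move=> t; rewrite /= /rect/= (clip_lo bc (lexx b)) (clip_hi ab (lexx b)).
    have := @parallel_uniq _ _ _ _ d (@connected_line R) _ (parallel_comp cl P1)
      (parallel_eq E (parallel_comp cl P2)).
    rewrite /= e2 => H; apply: (H _ erefl).
    by apply: cont_comp => //; apply: cont_comp => //; exact: rect_continuous.
- move=> a b d e f a0 ab b1 d0 de ef f1 H1 H2 s.
  have [h1 P1 e1'] := H1 s; have [h2 P2 e2] := H2 (h1 (a, e)).
  exists (fun z => if z.2 <= e then h1 z else h2 z); last by rewrite /= de.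
  apply: (parallel_glue _ _ _ P1 P2).
  + exact: cont_snd.
  + by move=> z zb; rewrite /= /rect (clip_glue_right de ef).
  + by move=> z zb; rewrite /= /rect (clip_glue_left de ef).
  + case=> x y /= ->.
    pose l (t : R) := (t, e).
    have cl : continuous l by apply: cont_pair; [exact: cont_id|exact: cont_cst].
    have E : F \o rect a b e f \o l =1 F \o rect a b d e \o l.
      by move=> t; rewrite /= /rect/= (clip_lo ef (lexx e)) (clip_hi de (lexx e)).
    have := @parallel_uniq _ _ _ _ a (@connected_line R) _ (parallel_comp cl P1)
      (parallel_eq E (parallel_comp cl P2)).
    rewrite /= e2 => H; apply: (H _ erefl).
    by apply: cont_comp => //; apply: cont_comp => //; exact: rect_continuous.
- move=> x y x0 x1 y0 y1.
  have [[A B] [/= [e1 e1P e1S] [e2 e2P e2S]] AS] :=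
    star_near (cF (x, y)) (vtx_gt0 (F (x, y))).
  exists (Num.min e1 e2); first by rewrite lt_min e1P e2P.
  move=> a b c d [a0 b1 /andP[xa ax] /andP[xb bx]] [c0 d1 /andP[yc cy] /andP[yd dy]] s.
  have := ge_min e1 e1 e2; have := ge_min e2 e1 e2; rewrite !lexx orbT /= => m2 m1.
  set v := vtx (F (x, y)) in AS.
  have st z : 0 < crd ((F \o rect a b c d) z) v.
    apply: (AS (_, _)); split=> /=.
      apply: e1S; rewrite /= ltr_distlC.
      have := clip_ge a b z.1; have := @clip_le _ a b z.1 (le_trans ax xb).
      by move=> *; apply/andP; split; lra.
    apply: e2S; rewrite /= ltr_distlC.
    have := clip_ge c d z.2; have := @clip_le _ c d z.2 (le_trans cy yd).
    by move=> *; apply/andP; split; lra.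
  pose w := vtx ((F \o rect a b c d) (a, c)).
  exists (fun z => phi v (vtx ((F \o rect a b c d) z)) (phi w v s)).
    by apply: parallel_star => //; apply: cont_comp => //; exact: rect_continuous.
  by rewrite voltK//; apply: crd_adj (st (a, c)); exact: vtx_gt0.
Qed.

Lemma parallel_ex1 (F : R -> geom R G) s : continuous F ->
  exists2 h, parallel (F \o clip 0 1) h & h 0 = s.
Proof.
move=> cF; have [h Ph h0] := @parallel_ex (F \o fst) s (cont_comp (@cont_fst _ _) cF).
exists (fun t => h (t, 0)) => //.
have cl : continuous (fun t : R => (t, 0 : R)).
  by apply: cont_pair; [exact: cont_id|exact: cont_cst].
exact: parallel_comp cl Ph.
Qed.

End fibre.
End transport.

(** * Edge paths and contiguity *)

Section edge_paths.
Variables (R : realType) (G : graph).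
Implicit Types (v w : G) (ws : seq G) (t : R).
Local Notation delta v := (fun u : G => (u == v)%:R : R).

(** The point v moves to w during the first unit of time, and the rest of the walk
    follows with time shifted by one. Written as one sum, in which the part of the
    walk that is not reached yet contributes zero, so that continuity is evident. *)
Fixpoint epath v ws t (u : G) : R :=
  if ws is w :: ws' then
    delta v u + clip 0 1 t * (delta w u - delta v u)
    + (epath w ws' (t - 1) u - delta w u)
  else delta v u.

Definition edge_path v ws t : geom R G := to_graph (epath v ws t).

Lemma epath_lo v ws t u : t <= 0 -> epath v ws t u = delta v u.
Proof.
elim: ws v t => //= w ws IH v t t0; rewrite IH; last by lra.
by rewrite clip_lo//; ring.
Qed.

Lemma epath_head v w ws t u : t <= 1 ->
  epath v (w :: ws) t u = (1 - clip 0 1 t) * delta v u + clip 0 1 t * delta w u.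
Proof. by move=> t1 /=; rewrite epath_lo; [ring|lra]. Qed.

Lemma epath_tail v w ws t u : 1 <= t ->
  epath v (w :: ws) t u = epath w ws (t - 1) u.
Proof. by move=> t1 /=; rewrite clip_hi//; ring. Qed.

Lemma joined_pt v w : gadj v w -> joined (pt R v) (pt R w).
Proof.
move=> vw; exists v, w; split=> // u.
by rewrite !crd_pt_gt0 => -[] /eqP; [left|right].
Qed.

Lemma edge_path_lo v ws t : t <= 0 -> edge_path v ws t = pt R v.
Proof.
by move=> t0; rewrite /edge_path /pt; congr to_graph; apply/funext => u;
  exact: epath_lo.
Qed.

Lemma edge_path_head v w ws t : t <= 1 ->
  edge_path v (w :: ws) t = comb (clip 0 1 t) (pt R v) (pt R w).
Proof.
move=> t1; rewrite /edge_path /comb; congr to_graph; apply/funext => u.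
by rewrite epath_head// !crd_pt.
Qed.

Lemma edge_path_tail v w ws t : 1 <= t ->
  edge_path v (w :: ws) t = edge_path w ws (t - 1).
Proof.
by move=> t1; rewrite /edge_path; congr to_graph; apply/funext => u;
  exact: epath_tail.
Qed.

Lemma edge_path_hi v ws t : (size ws)%:R <= t ->
  edge_path v ws t = pt R (last v ws).
Proof.
elim: ws v t => [|w ws IH] v t /= tn; first by [].
have n0 : 0 <= (size ws)%:R :> R by rewrite ler0n.
have : (size ws).+1%:R = (size ws)%:R + 1 :> R by rewrite -natr1.
by move=> E; rewrite E in tn; rewrite edge_path_tail ?IH//; lra.
Qed.

Lemma epath_in v ws t : path (@gadj G) v ws -> in_graph (epath v ws t).
Proof.
elim: ws v t => [|w ws IH] v t; first by move=> _; exact: in_graph_pt.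
case/andP=> vw pws.
have [t1|/ltW t1] := leP t 1; last first.
  by have -> : epath v (w :: ws) t = epath w ws (t - 1);
    [apply/funext => u; exact: epath_tail|exact: IH].
have := crd_in (comb (clip 0 1 t) (pt R v) (pt R w)).
congr in_graph; apply/funext => u; rewrite crd_comb ?clip_ge ?clip_le//.
  by rewrite epath_head// !crd_pt.
exact: joined_pt.
Qed.

Lemma edge_path_continuous v ws : path (@gadj G) v ws ->
  continuous (edge_path v ws).
Proof.
move=> pws; apply: geom_continuous => u.
under eq_fun => t do rewrite (to_graphE _ (epath_in t pws)).
elim: ws v {pws} => [|w ws IH] v /=; first exact: cont_cst.
apply: cont_add.
  apply: cont_add; first exact: cont_cst.
  by apply: cont_mul; [exact: clip_continuous|exact: cont_cst].
apply: cont_sub; last exact: cont_cst.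
apply: (cont_comp (f := fun t => t - 1) (g := fun t => epath w ws t u)).
  by apply: cont_sub; [exact: cont_id|exact: cont_cst].
exact: IH.
Qed.

Definition in_edge (l : seq G) : bool :=
  [exists u : G, exists v : G, gadj u v && all (mem [:: u; v]) l].

Lemma in_edgeP (l : seq G) : reflect
  (exists u v, gadj u v /\ forall w, w \in l -> w = u \/ w = v) (in_edge l).
Proof.
apply: (iffP existsP) => [[u /existsP[v /andP[uv /allP luv]]]|[u [v [uv luv]]]].
  exists u, v; split=> // w /luv; rewrite !inE => /orP[] /eqP; by [left|right].
exists u; apply/existsP; exists v; rewrite uv; apply/allP => w /luv.
by rewrite !inE => -[->|->]; rewrite eqxx ?orbT.
Qed.

Lemma in_edge_adj (l : seq G) u v : in_edge l -> u \in l -> v \in l -> gadj u v.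
Proof.
move=> /in_edgeP[a [b [ab abP]]] /abP[->|->] /abP[->|->];
by rewrite ?gadj_refl// gadj_sym.
Qed.

(** Contiguity of walks as simplicial maps: for each step the images of both
    endpoints under both walks lie in one edge. *)
Fixpoint contiguous v ws v' ws' : bool :=
  match ws, ws' with
  | w :: ws1, w' :: ws1' => in_edge [:: v; v'; w; w'] && contiguous w ws1 w' ws1'
  | [::], [::] => gadj v v'
  | _, _ => false
  end.

Lemma contiguous_path v ws v' ws' : contiguous v ws v' ws' ->
  path (@gadj G) v ws /\ path (@gadj G) v' ws'.
Proof.
elim: ws v v' ws' => [|w ws IH] v v' [|w' ws'] //= /andP[e /IH[-> ->]].
by rewrite !(in_edge_adj e) // !inE eqxx ?orbT.
Qed.

Lemma contiguous_size v ws v' ws' : contiguous v ws v' ws' ->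
  size ws = size ws'.
Proof.
by elim: ws v v' ws' => [|w ws IH] v v' [|w' ws'] //= /andP[_ /IH ->].
Qed.

Lemma contiguous_refl v ws : path (@gadj G) v ws -> contiguous v ws v ws.
Proof.
elim: ws v => [|w ws IH] v /=; first by rewrite gadj_refl.
move=> /andP[vw /IH ->]; rewrite andbT; apply/in_edgeP; exists v, w; split=> //.
by move=> u; rewrite !inE => /or4P[] /eqP; [left|left|right|right].
Qed.

Lemma contiguous_cat v a b v' a' b' : size a = size a' ->
  contiguous v a v' a' -> contiguous (last v a) b (last v' a') b' ->
  contiguous v (a ++ b) v' (a' ++ b').
Proof.
by elim: a v v' a' => [|w a IH] v v' [|w' a'] //= [sa] /andP[-> /IH] /= + /[dup];
  move=> /(_ sa) + H; apply.
Qed.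

Lemma joined_comb s t (v w v' w' : G) : in_edge [:: v; v'; w; w'] ->
  0 <= s -> s <= 1 -> 0 <= t -> t <= 1 ->
  joined (comb s (pt R v) (pt R w)) (comb t (pt R v') (pt R w')).
Proof.
move=> e s0 s1 t0 t1.
have vw : gadj v w by apply: (in_edge_adj e); rewrite !inE eqxx ?orbT.
have vw' : gadj v' w' by apply: (in_edge_adj e); rewrite !inE eqxx ?orbT.
move/in_edgeP: e => [a [b [ab abP]]]; exists a, b; split=> // u.
by move=> [] /comb_supp[]//; try (exact: joined_pt); rewrite crd_pt_gt0 => /eqP ->;
  apply: abP; rewrite !inE eqxx ?orbT.
Qed.

(** Contiguous walks are joined by straight segments at every time, hence
    homotopic by a straight-line homotopy. *)
Lemma contiguous_joined v ws v' ws' t : contiguous v ws v' ws' ->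
  joined (edge_path v ws t) (edge_path v' ws' t).
Proof.
elim: ws v v' ws' t => [|w ws IH] v v' [|w' ws'] t //=; first exact: joined_pt.
move=> /andP[e /IH H]; have [t1|/ltW t1] := leP t 1.
  by rewrite !edge_path_head//; apply: joined_comb; rewrite ?clip_ge ?clip_le.
by rewrite !edge_path_tail.
Qed.

(** The hypothesis of simplicial approximation: on the i-th unit interval F runs in
    the intersection of the stars of the two endpoints of the i-th step. *)
Definition near_walk (F : R -> geom R G) v ws : Prop :=
  forall i t, (i < size ws)%N -> i%:R <= t -> t <= i.+1%:R ->
    0 < crd (F t) (nth v (v :: ws) i) /\ 0 < crd (F t) (nth v ws i).

Lemma near_walk_path F v ws : near_walk F v ws -> path (@gadj G) v ws.
Proof.
move=> H; apply/(pathP v) => i isz.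
have [|//|a b] := H i i%:R isz; first by rewrite lexx.
  by rewrite ler_nat.
exact: crd_adj a b.
Qed.

Lemma near_walk_joined F v ws t : near_walk F v ws ->
  0 <= t -> t <= (size ws)%:R -> (0 < size ws)%N ->
  joined (F t) (edge_path v ws t).
Proof.
elim: ws v t F => [|w ws IH] v t F //= H t0 tn _.
have vw : gadj v w by have /= /andP[] := near_walk_path H.
have [t1|/ltW t1] := leP t 1.
  have [Fv Fw] := H 0%N t isT t0 t1.
  apply: (joined_star Fv Fw) => u; rewrite edge_path_head//.
  move=> /comb_supp[]; rewrite ?clip_ge ?clip_le//; first exact: joined_pt.
    by rewrite crd_pt_gt0 => /eqP; left.
  by rewrite crd_pt_gt0 => /eqP; right.
have tE : F t = (fun u => F (u + 1)) (t - 1) by rewrite /= subrK.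
have [ws0|ws0] := eqVneq ws [::].
  rewrite {}ws0 in H tn *.
  have {t1 tn} tE' : t = 1 by apply/le_anti; rewrite tn t1.
  have [_ Fw] := H 0%N 1 isT ler01 (lexx _).
  rewrite tE' edge_path_tail// subrr edge_path_lo//.
  by apply: (joined_star Fw Fw) => u; rewrite crd_pt_gt0 => /eqP; left.
rewrite edge_path_tail// tE; apply: (IH w (t - 1) (fun u => F (u + 1))).
- move=> i u isz iu ui; have := H i.+1 (u + 1) isz.
  have E j : j.+1%:R = j%:R + 1 :> R by rewrite -natr1.
  rewrite !E in ui * => /(_ _ _)[||a b]; [lra|lra|].
  by move: a b => /=; rewrite !(set_nth_default w)//= ltnW.
- by rewrite subr_ge0.
- by rewrite -natr1 in tn; lra.
- by rewrite lt0n size_eq0.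
Qed.

End edge_paths.

(** * Transport along paths *)

Section carries.
Variables (R : realType) (G : graph) (S : Type) (phi : voltage G S).
Implicit Types (F : R -> geom R G) (s : S).

(** Transport along F from time 0 to time 1 takes s to s'. A relation, because F
    need not be continuous for it to be stated. *)
Definition carries F s s' : Prop :=
  exists h, [/\ parallel phi (F \o clip 0 1) h, h 0 = s & h 1 = s'].

Lemma clip01K (t : R) : clip 0 1 (clip 0 1 t) = clip 0 1 t.
Proof. by rewrite clip_id ?clip_ge ?clip_le. Qed.

Lemma carries_ex F s : continuous F -> exists s', carries F s s'.
Proof.
by move=> cF; have [h Ph h0] := parallel_ex1 phi s cF; exists (h 1), h.
Qed.

Lemma carries_fun F s a b : continuous F ->
  carries F s a -> carries F s b -> a = b.
Proof.
move=> cF [h [Ph h0 <-]] [h' [Ph' h0' <-]].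
apply: (parallel_uniq (z0 := 0) (@connected_line R) _ Ph Ph').
  by apply: cont_comp => //; exact: clip_continuous.
by rewrite h0 h0'.
Qed.

Lemma carries_eq F F' s s' :
  (forall t, 0 <= t -> t <= 1 -> F t = F' t) -> carries F s s' -> carries F' s s'.
Proof.
move=> FF' [h [Ph h0 h1]]; exists h; split=> //.
by apply: parallel_eq Ph => t /=; rewrite FF' ?clip_ge ?clip_le.
Qed.

Lemma carries_cat F F1 F2 s s' s'' :
  (forall t, 0 <= t -> t <= 2^-1 -> F t = F1 (2 * t)) ->
  (forall t, 2^-1 <= t -> t <= 1 -> F t = F2 (2 * t - 1)) ->
  carries F1 s s' -> carries F2 s' s'' -> carries F s s''.
Proof.
move=> E1 E2 [h1 [P1 h10 h11]] [h2 [P2 h20 h21]].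
pose l1 (t : R) := 2 * t; pose l2 (t : R) := 2 * t - 1.
have c1 : continuous l1 by apply: cont_mul; [exact: cont_cst|exact: cont_id].
have c2 : continuous l2 by apply: cont_sub; [exact: c1|exact: cont_cst].
exists (fun t => if t <= 2^-1 then h1 (l1 t) else h2 (l2 t)); split.
- apply: (parallel_glue (p := id) (F := F \o clip 0 1) _ _ _
    (parallel_comp c1 P1) (parallel_comp c2 P2)) => /=.
  + exact: cont_id.
  + move=> t t2; have [t0|t0] := leP 0 t.
      by rewrite (_ : clip 0 1 t = t) ?clip_id ?/l1 -?E1//; lra.
    by rewrite !clip_lo ?/l1 ?E1 ?mulr0//; lra.
  + move=> t t2; have [t1|t1] := leP t 1.
      by rewrite (_ : clip 0 1 t = t) ?clip_id ?/l2 -?E2//; lra.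
    have -> : clip 0 1 t = 1 by rewrite clip_hi//; lra.
    have -> : clip 0 1 (l2 t) = 1 by rewrite clip_hi// /l2; lra.
    by rewrite E2 ?invf_le1//; [congr F2; lra|lra].
  + move=> t ->.
    have -> : l1 2^-1 = 1 by rewrite /l1; lra.
    have -> : l2 2^-1 = 0 by rewrite /l2; lra.
    by rewrite h11 h20.
- by rewrite ifT ?invr_ge0// /l1 mulr0.
- by rewrite ifF ?/l2 -?h21; [congr h2; lra|apply/negbTE; rewrite -ltNge; lra].
Qed.

(** Transport around the boundary of a square is trivial, since a lift over the
    whole square exists. *)
Lemma carries_square (K : R * R -> geom R G) s a b c d : continuous K ->
  carries (fun t => K (t, 0)) s a -> carries (fun t => K (1, t)) a b ->
  carries (fun t => K (0, t)) s c -> carries (fun t => K (t, 1)) c d ->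
  b = d.
Proof.
move=> cK C1 C2 C3 C4.
have [h Ph h0] := parallel_ex phi s cK.
have H (l : R -> R * R) x y : continuous l ->
    rect 0 1 0 1 \o l =1 l \o clip 0 1 -> carries (K \o l) x y ->
    h (l 0) = x -> h (l 1) = y.
  move=> cl E C e; apply: (@carries_fun (K \o l) x _ _ _ _ C).
    exact: cont_comp.
  exists (h \o l); split=> //.
  apply: parallel_eq (parallel_comp cl Ph) => t /=.
  by congr K; exact: E.
have E0 : clip 0 1 0 = 0 :> R by rewrite clip_id.
have E1 : clip 0 1 1 = 1 :> R by rewrite clip_id.
have ha : h (1, 0) = a.
  apply: (H (fun t => (t, 0)) _ _ _ _ C1 h0).
    by apply: cont_pair; [exact: cont_id|exact: cont_cst].
  by move=> t; rewrite /rect /= E0.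
have hb : h (1, 1) = b.
  apply: (H (fun t => (1, t)) _ _ _ _ C2 ha).
    by apply: cont_pair; [exact: cont_cst|exact: cont_id].
  by move=> t; rewrite /rect /= E1.
have hc : h (0, 1) = c.
  apply: (H (fun t => (0, t)) _ _ _ _ C3 h0).
    by apply: cont_pair; [exact: cont_cst|exact: cont_id].
  by move=> t; rewrite /rect /= E0.
rewrite -hb; apply: (H (fun t => (t, 1)) _ _ _ _ C4 hc).
  by apply: cont_pair; [exact: cont_id|exact: cont_cst].
by move=> t; rewrite /rect /= E1.
Qed.

Lemma carries_cst x s : carries (cst x) s s.
Proof. by exists (cst s); split=> //; exact: parallel_cst. Qed.

Fixpoint walk_volt v ws s : S :=
  if ws is w :: ws' then walk_volt w ws' (phi v w s) else s.

(** Along one edge v - w the lift is the voltage from v to the current vertex, and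
    the tail of the walk is a path of its own after a shift of time. *)
Lemma parallel_edge_path v ws s h : path (@gadj G) v ws ->
  parallel phi (edge_path (R := R) v ws) h -> h 0 = s ->
  h (size ws)%:R = walk_volt v ws s.
Proof.
elim: ws v s h => [//|w ws IH] v s h pws Ph h0.
have /andP[vw pw] : gadj v w && path (@gadj G) w ws by [].
have h1 : h 1 = phi v w s.
  pose F t := comb (clip 0 1 t) (pt R v) (pt R w).
  have PF : parallel phi F (h \o clip 0 1).
    apply: parallel_eq (parallel_comp (@clip_continuous R 0 1) Ph) => t /=.
    by rewrite edge_path_head ?clip_le// clip01K.
  have PF' : parallel phi F (fun t => phi v (vtx (F t)) s).
    apply: (@parallel_edge R G S phi _ F v w s vw) => t u /comb_supp[].
    - exact: joined_pt.
    - exact: clip_ge.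
    - exact: clip_le.
    - by rewrite crd_pt_gt0 => /eqP; left.
    - by rewrite crd_pt_gt0 => /eqP; right.
  have cF : continuous F.
    apply: comb_continuous => [t|t| | |]; try exact: cont_cst.
    - exact: joined_pt.
    - by rewrite clip_ge clip_le.
    - exact: clip_continuous.
  have := @parallel_uniq _ _ _ _ _ F _ _ 0 (@connected_line R) cF PF PF'.
  have j := joined_pt R vw.
  rewrite /= /F !clip_id// comb0// vtx_pt volt_id => /(_ h0) /(_ 1).
  by rewrite /= !clip_id// comb1// vtx_pt.
(* time shifted by one, frozen before the walk reaches w *)
pose l (t : R) := 1 + Num.max 0 t.
have cl : continuous l.
  apply: cont_add; first exact: cont_cst.
  by move=> t; apply: continuous_max; [exact: cvg_cst|exact: cvg_id].
have Pl : parallel phi (edge_path w ws) (h \o l).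
  apply: parallel_eq (parallel_comp cl Ph) => t /=.
  rewrite edge_path_tail; last by rewrite lerDl le_max lexx.
  rewrite /l addrAC subrr add0r; case: (leP 0 t) => // /ltW t0.
  by rewrite !edge_path_lo.
rewrite /= -(IH _ _ _ pw Pl); last by rewrite /= /l maxxx addr0.
by rewrite /= /l (max_idPr (ler0n _ _)) -natr1 addrC.
Qed.

Lemma carries_edge_path v ws s F : path (@gadj G) v ws ->
  (forall t, F t = edge_path v ws ((size ws)%:R * t)) ->
  carries F s (walk_volt v ws s).
Proof.
move=> pws FE.
have cF : continuous F.
  rewrite (_ : F = edge_path v ws \o (fun t => (size ws)%:R * t)); last exact/funext.
  apply: cont_comp; last exact: edge_path_continuous.
  by apply: cont_mul; [exact: cont_cst|exact: cont_id].
have [s' C] := carries_ex s cF; suff <- : s' = walk_volt v ws s by [].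
have [n0|n0] := posnP (size ws).
  have ws0 : ws = [::] by apply/eqP; rewrite -size_eq0 n0.
  apply: (carries_fun cF C); rewrite ws0.
  apply: (@carries_eq (cst (pt R v))); last exact: carries_cst.
  by move=> t _ _; rewrite FE ws0.
have [h [Ph h0 <-]] := C.
have n0' : (size ws)%:R != 0 :> R by rewrite pnatr_eq0 -lt0n.
pose l (t : R) := t * (size ws)%:R^-1.
have cl : continuous l by apply: cont_mul; [exact: cont_id|exact: cont_cst].
have Pl : parallel phi (edge_path v ws) (h \o l).
  apply: parallel_eq (parallel_comp cl Ph) => t /=; rewrite FE.
  have [t0|/ltW t0] := leP 0 t; last first.
    rewrite clip_lo// ?mulr0 ?edge_path_lo//.
    by rewrite /l mulr_le0_ge0// invr_ge0 ler0n.
  have [tn|/ltW tn] := leP t (size ws)%:R.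
    rewrite clip_id /l; first by rewrite mulrC mulfVK.
      by rewrite mulr_ge0// invr_ge0.
    by rewrite ler_pdivrMr ?mul1r// ltr0n.
  rewrite clip_hi ?mulr1 ?edge_path_hi//.
  by rewrite /l ler_pdivlMr ?mul1r// ltr0n.
rewrite -(parallel_edge_path pws Pl); last by rewrite /= /l mul0r.
by rewrite /= /l mulfV.
Qed.

End carries.

Section approximation.
Variables (R : realType) (G : graph).

(** Bisection applied to the existence of a common radius on a subinterval. *)
Lemma lebesgue_number (F : R -> geom R G) : continuous F -> exists2 e, 0 < e &
  forall a, 0 <= a -> a <= 1 -> exists v, forall b, a - e < b -> b < a + e ->
    0 < crd (F b) v.
Proof.
move=> cF; apply: (@bisect R (fun s t => exists2 e, 0 < e &
  forall a, s <= a -> a <= t -> exists v, forall b, a - e < b -> b < a + e ->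
    0 < crd (F b) v)).
  move=> a b c _ _ _ _ [e e0 eP] [e' e'0 e'P].
  exists (Num.min e e'); first by rewrite lt_min e0 e'0.
  have := ge_min e e e'; have := ge_min e' e e'; rewrite !lexx orbT /= => m2 m1.
  move=> x ax xc; have [xb|/ltW xb] := leP x b.
    by have [v vP] := eP _ ax xb; exists v => y y1 y2; apply: vP; lra.
  by have [v vP] := e'P _ xb xc; exists v => y y1 y2; apply: vP; lra.
move=> x x0 x1; have [e /= e0 eP] := star_near (cF x) (vtx_gt0 (F x)).
exists (e / 2); first by rewrite divr_gt0.
move=> a b _ _ xa ax xb bx; exists (e / 2); first by rewrite divr_gt0.
move=> c ac cb; exists (vtx (F x)) => y y1 y2; apply: eP.
by rewrite /= ltr_distlC; apply/andP; split; lra.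
Qed.

End approximation.

(** * Homotopy relative to the endpoints and simplicial approximation *)

Lemma glue_continuous (R : realType) (Z T : topologicalType) (p : Z -> R) b
    (f1 f2 : Z -> T) :
  continuous p -> continuous f1 -> continuous f2 ->
  (forall z, p z = b -> f1 z = f2 z) ->
  continuous (fun z => if p z <= b then f1 z else f2 z).
Proof.
move=> cp c1 c2 f12 z A; have [pb|pb|pb] := ltgtP (p z) b.
- move=> /(c1 z) A1; have pz : \forall z' \near z, p z' < b := cp z _ (lt_nbhsl pb).
  by apply: filterS2 pz A1 => z' /ltW pz' /=; rewrite pz'.
- move=> /(c2 z) A2; have pz : \forall z' \near z, b < p z' := cp z _ (lt_nbhsr pb).
  by apply: filterS2 pz A2 => z'; rewrite ltNge /= => /negbTE ->.
- rewrite (f12 _ pb) => nA; have A2 := c2 z _ nA.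
  rewrite -(f12 _ pb) in nA; have A1 := c1 z _ nA.
  have A1' : \forall z' \near z, A (f1 z') := A1.
  have A2' : \forall z' \near z, A (f2 z') := A2.
  by apply: filterS2 A1' A2' => z' ? ? /=; case: ifP.
Qed.

Section rel_homotopy.
Variables (R : realType) (X : topologicalType).
Implicit Types F : R -> X.

(** The homotopy K is only constrained on the unit square, so that F and F' may be
    arbitrary outside [0, 1]. *)
Definition homotopic_rel F F' : Prop := exists K : R * R -> X, [/\ continuous K,
  forall t, 0 <= t <= 1 -> K (t, 0) = F t,
  forall t, 0 <= t <= 1 -> K (t, 1) = F' t,
  forall r, 0 <= r <= 1 -> K (0, r) = F 0 &
  forall r, 0 <= r <= 1 -> K (1, r) = F 1].

Lemma homotopic_rel_ends F F' : homotopic_rel F F' -> F 0 = F' 0 /\ F 1 = F' 1.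
Proof.
move=> [K [_ _ K1 K2 K3]].
by rewrite -(K2 1) ?lexx ?ler01// -(K3 1) ?lexx ?ler01// !K1 ?lexx ?ler01.
Qed.

Lemma homotopic_rel_sym F F' : homotopic_rel F F' -> homotopic_rel F' F.
Proof.
move=> FF'; have [E0 E1] := homotopic_rel_ends FF'.
have [K [cK K0 K1 K2 K3]] := FF'; exists (fun z => K (z.1, 1 - z.2)).
have O (r : R) : 0 <= r <= 1 -> 0 <= 1 - r <= 1.
  by move=> /andP[r0 r1]; apply/andP; split; lra.
split=> /= [|t|t|r|r].
- apply: (cont_comp (f := fun z : R * R => (z.1, 1 - z.2)) _ cK).
  by apply: cont_pair; [exact: cont_fst|apply: cont_sub; [exact: cont_cst|exact: cont_snd]].
- by rewrite subr0; exact: K1.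
- by rewrite subrr; exact: K0.
- by move=> /O /K2 ->.
- by move=> /O /K3 ->.
Qed.

Lemma homotopic_rel_trans F F' F'' :
  homotopic_rel F F' -> homotopic_rel F' F'' -> homotopic_rel F F''.
Proof.
move=> FF'; have [E0 E1] := homotopic_rel_ends FF'.
move: FF' => [K [cK K0 K1 K2 K3]] [K' [cK' K'0 K'1 K'2 K'3]].
pose l1 (z : R * R) := (clip 0 1 z.1, 2 * z.2).
pose l2 (z : R * R) := (clip 0 1 z.1, 2 * z.2 - 1).
have c0 : continuous (fun z : R * R => clip 0 1 z.1).
  exact: (cont_comp (@cont_fst _ _) (@clip_continuous R 0 1)).
have c2 : continuous (fun z : R * R => 2 * z.2).
  by apply: cont_mul; [exact: cont_cst|exact: cont_snd].
exists (fun z => if z.2 <= 2^-1 then K (l1 z) else K' (l2 z)); split=> /=.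
- apply: glue_continuous.
  + exact: cont_snd.
  + by apply: (cont_comp (f := l1) _ cK); apply: cont_pair.
  + apply: (cont_comp (f := l2) _ cK'); apply: cont_pair => //.
    by apply: cont_sub => //; exact: cont_cst.
  + move=> [x y] /= ->; rewrite /l1 /l2 /=.
    have -> : 2 * 2^-1 = 1 :> R by lra.
    by rewrite subrr K1 ?K'0 // clip_ge clip_le.
- move=> t /andP[t0 t1]; rewrite ifT ?invr_ge0// /l1 /= mulr0 clip_id// K0//.
  exact/andP.
- move=> t /andP[t0 t1]; rewrite ifF; last by apply/negbTE; rewrite -ltNge; lra.
  rewrite /l2 /= clip_id//; have -> : 2 * 1 - 1 = 1 :> R by lra.
  by rewrite K'1// t0.
- move=> r /andP[r0 r1]; rewrite /l1 /l2 /= clip_id//; case: leP => r2.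
    by rewrite K2//; apply/andP; split; lra.
  by rewrite K'2//; apply/andP; split; lra.
- move=> r /andP[r0 r1]; rewrite /l1 /l2 /= clip_id//; case: leP => r2.
    by rewrite K3//; apply/andP; split; lra.
  by rewrite K'3//; apply/andP; split; lra.
Qed.

End rel_homotopy.

Section straight.
Variables (R : realType) (G : graph).
Implicit Types F : R -> geom R G.

(** The straight-line homotopy. *)
Lemma homotopic_rel_joined F F' : continuous F -> continuous F' ->
  (forall t, 0 <= t -> t <= 1 -> joined (F t) (F' t)) ->
  F 0 = F' 0 -> F 1 = F' 1 -> homotopic_rel F F'.
Proof.
move=> cF cF' j E0 E1.
exists (fun z => comb (clip 0 1 z.2) (F (clip 0 1 z.1)) (F' (clip 0 1 z.1))).
have j' t : joined (F (clip 0 1 t)) (F' (clip 0 1 t)).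
  by apply: j; rewrite ?clip_ge ?clip_le.
have c0 : continuous (fun z : R * R => clip 0 1 z.1).
  exact: (cont_comp (@cont_fst _ _) (@clip_continuous R 0 1)).
split=> /= [|t /andP[t0 t1]|t /andP[t0 t1]|r _|r _].
- apply: comb_continuous => [z|z| | |]; first exact: j'.
  + by rewrite clip_ge clip_le.
  + exact: (cont_comp (@cont_snd _ _) (@clip_continuous R 0 1)).
  + exact: (cont_comp c0 cF).
  + exact: (cont_comp c0 cF').
- by rewrite clip_id// comb0// clip_id.
- by rewrite clip_id// comb1// clip_id.
- by rewrite (@clip_id _ 0 1 0)// -E0 combxx ?clip_ge ?clip_le.
- by rewrite (@clip_id _ 0 1 1)// -E1 combxx ?clip_ge ?clip_le.
Qed.

Lemma homotopic_rel_refl F : continuous F -> homotopic_rel F F.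
Proof. by move=> cF; apply: homotopic_rel_joined => // t _ _; exact: joined_refl. Qed.

Lemma carries_homotopic_rel (S : Type) (phi : voltage G S) F F' s a :
  continuous F -> continuous F' -> homotopic_rel F F' ->
  carries phi F s a -> carries phi F' s a.
Proof.
move=> cF cF' FF' C; have [E0 E1] := homotopic_rel_ends FF'.
have [K [cK K0 K1 K2 K3]] := FF'.
have [a' C'] := carries_ex phi s cF'.
suff -> : a = a' by [].
have H t : 0 <= t -> t <= 1 -> 0 <= t <= 1 by move=> -> ->.
apply: (@carries_square _ _ _ phi K s a a s a' cK).
- by apply: carries_eq C => t t0 t1; rewrite K0 ?H.
- by apply: carries_eq (carries_cst _ (F 1) a) => t t0 t1; rewrite K3 ?H.
- by apply: carries_eq (carries_cst _ (F 0) s) => t t0 t1; rewrite K2 ?H.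
- by apply: carries_eq C' => t t0 t1; rewrite K1 ?H.
Qed.

Definition edge_loop v (ws : seq G) (t : R) : geom R G :=
  edge_path v ws ((size ws)%:R * t).

Lemma edge_loop0 v ws : edge_loop v ws 0 = pt R v.
Proof. by rewrite /edge_loop mulr0 edge_path_lo. Qed.

Lemma edge_loop1 v ws : edge_loop v ws 1 = pt R (last v ws).
Proof. by rewrite /edge_loop mulr1 edge_path_hi. Qed.

Lemma edge_loop_continuous v ws : path (@gadj G) v ws ->
  continuous (edge_loop v ws).
Proof.
move=> pws; apply: cont_comp; last exact: edge_path_continuous.
by apply: cont_mul; [exact: cont_cst|exact: cont_id].
Qed.

(** Chains of contiguities between walks of one length. Keeping the length fixed
    avoids reparametrizations: each step is a straight-line homotopy, and the only
    operation on homotopies that is needed is transitivity. *)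
Inductive walk_equiv (v : G) : seq G -> seq G -> Prop :=
| walk_equiv_refl ws : path (@gadj G) v ws -> walk_equiv v ws ws
| walk_equiv_step ws ws' ws'' : contiguous v ws v ws' ->
    last v ws = last v ws' -> walk_equiv v ws' ws'' -> walk_equiv v ws ws''.

Lemma walk_equiv_path v ws ws' : walk_equiv v ws ws' ->
  [/\ path (@gadj G) v ws, path (@gadj G) v ws', size ws = size ws' &
      last v ws = last v ws'].
Proof.
elim=> {ws ws'} [ws pws|ws ws' ws'' c l _ [_ pws' s' l']]; first by split.
by have [pws _] := contiguous_path c; rewrite l (contiguous_size c).
Qed.

Lemma walk_equiv_trans v ws ws' ws'' : walk_equiv v ws ws' -> walk_equiv v ws' ws'' ->
  walk_equiv v ws ws''.
Proof. by elim=> // a b c ab lab _ H /H; exact: walk_equiv_step. Qed.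

Lemma walk_equiv_ctx v a ws ws' b : path (@gadj G) v a -> last v a = v ->
  path (@gadj G) (last v ws) b -> walk_equiv v ws ws' ->
  walk_equiv v (a ++ ws ++ b) (a ++ ws' ++ b).
Proof.
move=> pa la + c; elim: c => {ws ws'} [ws pws pb|ws ws' ws'' c l c' IH pb].
  by apply: walk_equiv_refl; rewrite !cat_path pa la pws.
apply: (walk_equiv_step _ _ (IH _)); last by rewrite -l.
  apply: contiguous_cat => //; first exact: contiguous_refl.
  rewrite la; apply: contiguous_cat => //; first exact: contiguous_size c.
  by rewrite -l; exact: contiguous_refl.
by rewrite !last_cat la l.
Qed.

Lemma walk_equiv_homotopic v ws ws' : walk_equiv v ws ws' ->
  homotopic_rel (edge_loop v ws) (edge_loop v ws').
Proof.
elim=> {ws ws'} [ws pws|ws ws' ws'' c l _].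
  by apply: homotopic_rel_refl; exact: edge_loop_continuous.
have [pws pws'] := contiguous_path c; apply: homotopic_rel_trans.
apply: homotopic_rel_joined => [||t _ _||]; try exact: edge_loop_continuous.
- by rewrite /edge_loop -(contiguous_size c); exact: contiguous_joined.
- by rewrite !edge_loop0.
- by rewrite !edge_loop1 l.
Qed.

(** Each vertex of the walk three times: this leaves room to insert a visit of the
    base vertex between two consecutive vertices. *)
Fixpoint stutter v (ws : seq G) :=
  if ws is w :: ws' then [:: v, v, w & stutter w ws'] else [::].
(** An intermediate stage between stutter and detour. Replacing one by the other at
    once would not be contiguous, since v, w and the base vertex may form a
    triangle. *)
Fixpoint stutter' v (ws : seq G) :=
  if ws is w :: ws' then [:: v, w, w & stutter' w ws'] else [::].
Fixpoint detour v (ws : seq G) :=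
  if ws is w :: ws' then [:: v, w, base G & detour w ws'] else [::].

Lemma size_stutter v ws : size (stutter v ws) = (3 * size ws)%N.
Proof. by elim: ws v => //= w ws IH v; rewrite IH mulnS. Qed.

Lemma nth_stutter x0 v ws i : (i < 3 * size ws)%N ->
  nth x0 (stutter v ws) i = nth x0 (v :: ws) (i.+1 %/ 3).
Proof.
elim: ws v i => [|w ws IH] v i; first by rewrite muln0.
rewrite [size _]/= mulnS.
case: i => [|[|[|i]]] //= isz.
by rewrite IH// -(addn3 i.+1) divnDr// addn1.
Qed.

(** The k-th block of three time units stays in one star, for all fine enough
    subdivisions. That every fine subdivision works allows two paths to be
    approximated by walks of the same length. *)
Lemma simplicial_approximation F : continuous F ->
  exists N, forall n, (N <= n)%N -> exists v ws, size ws = n.+1 /\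
   near_walk (fun t => F (t / (3 * n.+1)%:R)) v (stutter v ws).
Proof.
move=> cF; have [e e0 eP] := lebesgue_number cF.
pose N := Num.truncn e^-1; exists N => n Nn.
have en : n.+1%:R^-1 < e.
  rewrite invf_plt ?posrE// (lt_le_trans (truncnS_gt _))// ler_nat.
  exact: leq_trans Nn _.
have n0 : 0 < n.+1%:R :> R by [].
have H k : exists v, (k <= n.+1)%N -> forall t, `|t - k%:R / n.+1%:R| < e ->
    0 < crd (F t) v.
  have [kn|kn] := leqP k n.+1; last by exists (base G).
  have [||v vP] := eP (k%:R / n.+1%:R); first by rewrite divr_ge0.
    by rewrite ler_pdivrMr ?mul1r ?ler_nat.
  by exists v => _ t; rewrite ltr_distl => /andP[? ?]; exact: vP.
have {H} [f fP] := choice H.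
have {}fP k t : (k <= n.+1)%N -> `|t - (3 * k)%:R| <= 3 ->
    0 < crd (F (t / (3 * n.+1)%:R)) (f k).
  move=> kn tk; apply: fP => //; apply: le_lt_trans en.
  have -> : t / (3 * n.+1)%:R - k%:R / n.+1%:R = (t - (3 * k)%:R) / 3 / n.+1%:R.
    by rewrite !natrM; field; rewrite gt_eqF//; lra.
  rewrite normrM (ger0_norm (_ : 0 <= n.+1%:R^-1)) ?invr_ge0//.
  rewrite ler_pdivrMr// mulVf ?gt_eqF// normrM (ger0_norm (_ : 0 <= 3^-1)) ?invr_ge0//.
  by rewrite ler_pdivrMr// mul1r.
exists (f 0%N); exists [seq f k.+1 | k <- iota 0 n.+1]; split.
  by rewrite size_map size_iota.
have nthf x0 k : (k <= n.+1)%N ->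
    nth x0 (f 0%N :: [seq f k.+1 | k <- iota 0 n.+1]) k = f k.
  case: k => // k kn; rewrite -[LHS]/(nth x0 [seq f k.+1 | k <- iota 0 n.+1] k).
  by rewrite (nth_map 0%N) ?size_iota// nth_iota.
move=> i t; rewrite size_stutter size_map size_iota => isz it ti.
have i3 := divn_eq i 3; have im : (i %% 3 < 3)%N by rewrite ltn_mod.
have j3 := divn_eq i.+1 3; have jm : (i.+1 %% 3 < 3)%N by rewrite ltn_mod.
have -> : nth (f 0%N) (f 0%N :: stutter (f 0%N) [seq f k.+1 | k <- iota 0 n.+1]) i
    = f (i %/ 3)%N.
  case: i isz {it ti i3 im j3 jm} => // i isz.
  rewrite -[LHS]/(nth _ (stutter (f 0%N) [seq f k.+1 | k <- iota 0 n.+1]) i).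
  by rewrite nth_stutter ?size_map ?size_iota ?nthf//; lia.
rewrite nth_stutter ?size_map ?size_iota// nthf; last by lia.
split; apply: fP; try lia.
- have h1 : (3 * (i %/ 3))%:R <= i%:R :> R by rewrite ler_nat; lia.
  have h2 : i%:R + 1 <= (3 * (i %/ 3))%:R + 3 :> R.
    by rewrite natr1 -natrD ler_nat; lia.
  by rewrite ler_norml; apply/andP; split; move: ti; rewrite -natr1; lra.
- have h1 : (3 * (i.+1 %/ 3))%:R <= i%:R + 1 :> R by rewrite natr1 ler_nat; lia.
  have h2 : i%:R + 1 <= (3 * (i.+1 %/ 3))%:R + 3 :> R.
    by rewrite natr1 -natrD ler_nat; lia.
  by rewrite ler_norml; apply/andP; split; move: ti; rewrite -natr1; lra.
Qed.

End straight.

(** * Walks in the theta graph and words *)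

(** The complete graph on four vertices without the edge between the two vertices
    with second component true; its realization is the theta graph up to
    subdivision. All vertices are adjacent to (false, false), which makes the edges
    from it a spanning tree, and the two remaining edges are free generators of the
    fundamental group. *)
Definition theta_adj (u v : bool * bool) : bool := (u == v) || ~~ (u.2 && v.2).

Lemma theta_adj_refl : reflexive theta_adj.
Proof. by move=> u; rewrite /theta_adj eqxx. Qed.

Lemma theta_adj_sym : symmetric theta_adj.
Proof. by move=> u v; rewrite /theta_adj eq_sym andbC. Qed.

Definition theta : graph :=
  Graph (false, false) theta_adj_refl theta_adj_sym.

Definition hub : theta := (false, false).
Definition hub' : theta := (true, false).
Definition leaf (g : bool) : theta := (g, true).

(** The generator carried by the oriented edge u - v, if the edge does not belong to
    the spanning tree. *)
Definition edge_letter (u v : theta) : option letter :=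
  if (u == hub') && v.2 then Some (v.1, false)
  else if (v == hub') && u.2 then Some (u.1, true) else None.

Lemma edge_letter_sym u v :
  edge_letter v u = omap letter_inv (edge_letter u v).
Proof. by move: u v => [[] []] [[] []]. Qed.

Definition F2_volt (u v : theta) (s : F2) : F2 :=
  if edge_letter u v is Some x then (s * F2_of [:: x])%g else s.

Lemma F2_volt_id u s : F2_volt u u s = s.
Proof. by move: u => [[] []]. Qed.

Lemma F2_of_cat u v : F2_of (u ++ v) = (F2_of u * F2_of v)%g.
Proof.
apply: val_inj => /=; rewrite !word_reduce_cat.
rewrite (word_reduce_id (word_reduce_reduced v)).
by rewrite foldr_push_reduce//; exact: word_reduce_reduced.
Qed.

Lemma F2_letterK x : (F2_of [:: x] * F2_of [:: letter_inv x] = 1)%g.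
Proof.
rewrite -F2_of_cat; apply: val_inj => /=.
by rewrite /word_reduce /= eqxx.
Qed.

Lemma F2_voltK u v : gadj u v -> cancel (F2_volt u v) (F2_volt v u).
Proof.
move=> _ s; rewrite /F2_volt edge_letter_sym.
by case: edge_letter => [x|] //=; rewrite -mulgA F2_letterK mulg1.
Qed.

Definition F2_voltage : voltage theta F2 := Voltage F2_volt_id F2_voltK.

(** A test that computes, as opposed to in_edge. *)
Definition in_edge_test (l : seq theta) : bool :=
  has (fun uv => gadj uv.1 uv.2 && all (mem [:: uv.1; uv.2]) l)
    [:: (hub, hub'); (hub, leaf false); (hub, leaf true);
        (hub', leaf false); (hub', leaf true)].

Lemma in_edge_testP l : in_edge_test l -> in_edge l.
Proof.
move=> /hasP[[u v] _ uvl]; apply/existsP; exists u; apply/existsP; exists v.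
exact: uvl.
Qed.

Fixpoint contiguous_test (v : theta) ws (v' : theta) ws' : bool :=
  match ws, ws' with
  | w :: ws1, w' :: ws1' =>
      in_edge_test [:: v; v'; w; w'] && contiguous_test w ws1 w' ws1'
  | [::], [::] => gadj v v'
  | _, _ => false
  end.

Lemma contiguous_testP v ws v' ws' :
  contiguous_test v ws v' ws' -> contiguous v ws v' ws'.
Proof.
elim: ws v v' ws' => [|w ws IH] v v' [|w' ws'] //=.
by move=> /andP[/in_edge_testP -> /IH].
Qed.

(** The triangle that represents a letter. A missing letter is a pause of the same
    length. *)
Definition block (o : option letter) : seq theta :=
  match o with
  | Some (g, false) => [:: hub'; leaf g; hub]
  | Some (g, true) => [:: leaf g; hub'; hub]
  | None => [:: hub; hub; hub]
  end.

Definition blocks (w : seq (option letter)) : seq theta := flatten (map block w).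

Lemma last_block o : last hub (block o) = hub.
Proof. by case: o => [[g []]|]. Qed.

Lemma path_block o : path (@gadj theta) hub (block o).
Proof. by case: o => [[[] []]|]. Qed.

Lemma last_blocks w : last hub (blocks w) = hub.
Proof.
by elim: w => //= o w IH; rewrite /blocks /= last_cat last_block.
Qed.

Lemma path_blocks w : path (@gadj theta) hub (blocks w).
Proof.
by elim: w => //= o w IH; rewrite /blocks /= cat_path path_block last_block.
Qed.

Lemma size_blocks w : size (blocks w) = (3 * size w)%N.
Proof.
elim: w => //= o w IH; rewrite /blocks /= size_cat [X in (_ + X)%N]IH mulnS.
by case: o => [[g []]|].
Qed.

Lemma walk_volt_cat (G : graph) S (phi : voltage G S) v a b s :
  walk_volt phi v (a ++ b) s = walk_volt phi (last v a) b (walk_volt phi v a s).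
Proof. by elim: a v s => //= w a IH v s; rewrite IH. Qed.

Lemma walk_volt_blocks w s :
  walk_volt F2_voltage hub (blocks w) s = (s * F2_of (pmap id w))%g.
Proof.
elim: w s => [|o w IH] s; first exact/esym/mulg1.
rewrite [blocks _]/(block o ++ blocks w) walk_volt_cat last_block IH.
case: o => [x|] //; rewrite -[pmap id (Some x :: w)]/([:: x] ++ pmap id w).
rewrite F2_of_cat mulgA; congr (_ * _)%g.
by case: x => [[] []].
Qed.

Definition wequiv w w' := walk_equiv hub (blocks w) (blocks w').

Lemma wequiv_trans w1 w2 w3 : wequiv w1 w2 -> wequiv w2 w3 -> wequiv w1 w3.
Proof. exact: walk_equiv_trans. Qed.

Lemma wequiv_refl w : wequiv w w.
Proof. by apply: walk_equiv_refl; exact: path_blocks. Qed.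

Lemma wequiv_ctx a l l' b : wequiv l l' -> wequiv (a ++ l ++ b) (a ++ l' ++ b).
Proof.
move=> ll'; rewrite /wequiv /blocks !map_cat !flatten_cat.
apply: walk_equiv_ctx => //; [exact: path_blocks|exact: last_blocks|].
by rewrite [last _ _]last_blocks; exact: path_blocks.
Qed.

(** A pause commutes with a letter. The walk hub hub hub u v hub is first slowed down
    on u, then on v, then at the end; the three walks are contiguous, while moving
    the letter in one step would leave the edges of the triangle. *)
Lemma wequiv_shift o : wequiv [:: None; o] [:: o; None].
Proof.
case: o => [x|]; last exact: wequiv_refl.
pose u := nth hub (block (Some x)) 0; pose v := nth hub (block (Some x)) 1.
apply: (@walk_equiv_step _ _ _ [:: u; u; u; u; v; hub]);
  [by apply: contiguous_testP; case: x @u @v => [[] []]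
  |by case: x @u @v => [[] []]|].
apply: (@walk_equiv_step _ _ _ [:: u; v; v; v; v; hub]);
  [by apply: contiguous_testP; case: x @u @v => [[] []]
  |by case: x @u @v => [[] []]|].
apply: (@walk_equiv_step _ _ _ (blocks [:: Some x; None]));
  [by apply: contiguous_testP; case: x @u @v => [[] []]
  |by case: x @u @v => [[] []]|exact: wequiv_refl].
Qed.

(** The walk u v hub v u hub: the visit of the hub is replaced by v, then the visit
    of v by u, then u is retracted to the hub. *)
Lemma wequiv_cancel x : wequiv [:: Some x; Some (letter_inv x)] [:: None; None].
Proof.
pose u := nth hub (block (Some x)) 0; pose v := nth hub (block (Some x)) 1.
apply: (@walk_equiv_step _ _ _ [:: u; v; v; v; u; hub]);
  [by apply: contiguous_testP; case: x @u @v => [[] []]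
  |by case: x @u @v => [[] []]|].
apply: (@walk_equiv_step _ _ _ [:: u; u; u; u; u; hub]);
  [by apply: contiguous_testP; case: x @u @v => [[] []]
  |by case: x @u @v => [[] []]|].
apply: (@walk_equiv_step _ _ _ (blocks [:: None; None]));
  [by apply: contiguous_testP; case: x @u @v => [[] []]
  |by case: x @u @v => [[] []]|exact: wequiv_refl].
Qed.

Lemma wequiv_shifts r w : wequiv (None :: map Some r ++ w) (map Some r ++ None :: w).
Proof.
elim: r w => [|x r IH] w /=; first exact: wequiv_refl.
apply: wequiv_trans.
  exact: (wequiv_ctx [::] (map Some r ++ w) (wequiv_shift (Some x))).
have := wequiv_ctx [:: Some x] [::] (IH w); rewrite !cats0; exact.
Qed.

(** Pauses move to the end, and cancellations leave two pauses behind, so a word is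
    equivalent to its reduced form followed by pauses. The number of pauses is
    determined by the length. *)
Lemma wequiv_normal w : exists k,
  wequiv w (map Some (word_reduce (pmap id w)) ++ nseq k None).
Proof.
elim: w => [|o w [k IH]]; first by exists 0%N; exact: wequiv_refl.
have {}IH : wequiv (o :: w) (o :: (map Some (word_reduce (pmap id w)) ++ nseq k None)).
  by have := wequiv_ctx [:: o] [::] IH; rewrite !cats0.
case: o IH => [x|] IH; last first.
  by exists k.+1; apply: wequiv_trans IH _; exact: wequiv_shifts.
rewrite [word_reduce _]/(word_push x (word_reduce (pmap id w))).
case: (word_reduce _) IH => [|y r] IH /=; first by exists k.
case: eqP IH => [->|_] IH; last by exists k.
exists k.+2; apply: wequiv_trans IH _.
apply: wequiv_trans.
  exact: (wequiv_ctx [::] (map Some r ++ nseq k None) (wequiv_cancel x)).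
apply: (@wequiv_trans _ (None :: (map Some r ++ None :: nseq k None))).
  by have := wequiv_ctx [:: None] [::] (wequiv_shifts r (nseq k None)); rewrite !cats0.
exact: (wequiv_shifts r (None :: nseq k None)).
Qed.

Lemma wequiv_size w w' : wequiv w w' -> size w = size w'.
Proof. by move=> /walk_equiv_path[_ _ + _]; rewrite !size_blocks; lia. Qed.

Lemma last_stutter (G : graph) (v : G) ws : last v (stutter v ws) = last v ws.
Proof. by elim: ws v => //= w ws IH v; rewrite -IH; case: ws {IH}. Qed.

Lemma last_stutter' (G : graph) (v : G) ws : last v (stutter' v ws) = last v ws.
Proof. by elim: ws v => //= w ws IH v; rewrite -IH; case: ws {IH}. Qed.

Lemma stutter_contiguous (G : graph) (v : G) ws : path (@gadj G) v (stutter v ws) ->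
  contiguous v (stutter v ws) v (stutter' v ws).
Proof.
elim: ws v => [|w ws IH] v; first by rewrite /= gadj_refl.
case/and4P=> vv _ vw pw.
have E (l : seq G) : all (mem [:: v; w]) l -> in_edge l.
  by move=> a; apply/existsP; exists v; apply/existsP; exists w; rewrite vw.
by apply/and4P; split; [| | |exact: IH]; apply: E; rewrite /= !inE !eqxx ?orbT.
Qed.

(** If the edge carries no letter then v = w or one of them is the hub, and the
    triangle hub, v, w is degenerate. *)
Lemma theta_edge_letter (v w : theta) : gadj v w ->
  let b := blocks [:: edge_letter v w] in
  contiguous_test hub (detour v [:: w]) hub b.
Proof. by move: v w => [[] []] [[] []]. Qed.

Fixpoint walk_word (v : theta) ws : seq (option letter) :=
  if ws is w :: ws' then edge_letter v w :: walk_word w ws' else [::].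

Lemma detour_contiguous (v : theta) ws : path (@gadj theta) v (stutter' v ws) ->
  contiguous v (stutter' v ws) hub (detour v ws).
Proof.
elim: ws v => [|w ws IH] v; first by move: v => [[] []].
case/and4P=> vv vw ww pw.
have E (l : seq theta) u : all (mem [:: hub; u]) l -> in_edge l.
  move=> a; apply/existsP; exists hub; apply/existsP; exists u; rewrite a andbT.
  by move: u {a} => [[] []].
have E' (l : seq theta) : all (mem [:: v; w]) l -> in_edge l.
  by move=> a; apply/existsP; exists v; apply/existsP; exists w; rewrite vw.
apply/and4P; split; last exact: IH.
- by apply: (E _ v); rewrite /= !inE !eqxx ?orbT.
- by apply: E'; rewrite /= !inE !eqxx ?orbT.
- by apply: (E _ w); rewrite /= !inE !eqxx ?orbT.
Qed.

Lemma detour_blocks (v : theta) ws : path (@gadj theta) v (stutter v ws) ->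
  contiguous hub (detour v ws) hub (blocks (walk_word v ws)).
Proof.
elim: ws v => [//|w ws IH] v; case/and4P=> vv _ vw pw.
rewrite [detour _ _]/(detour v [:: w] ++ detour w ws).
rewrite [blocks _]/(block (edge_letter v w) ++ blocks (walk_word w ws)).
apply: (@contiguous_cat theta hub (detour v [:: w]) _ hub).
- by case: edge_letter => [[g []]|].
- by have := contiguous_testP (theta_edge_letter vw); rewrite /blocks /= cats0.
- by rewrite last_block; exact: IH.
Qed.

Lemma stutter_blocks ws : path (@gadj theta) hub (stutter hub ws) -> last hub ws = hub ->
  walk_equiv hub (stutter hub ws) (blocks (walk_word hub ws)).
Proof.
move=> p l; have c1 := stutter_contiguous p; have [_ p'] := contiguous_path c1.
have c2 := detour_contiguous p'; have c3 := detour_blocks p.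
have lb v ws' : last hub (detour v ws') = hub.
  by elim: ws' v => //= w ws' IH v; exact: (IH w).
apply: (walk_equiv_step c1); first by rewrite last_stutter last_stutter'.
apply: (walk_equiv_step c2); first by rewrite last_stutter' l lb.
apply: (walk_equiv_step c3); first by rewrite lb last_blocks.
by apply: walk_equiv_refl; exact: path_blocks.
Qed.

(** * The fundamental group of the theta graph *)

Section fundamental_group_theta.
Variable R : realType.
Local Notation X := (geom R theta).
Local Notation x0 := (pt R hub).

(** Approximating by a walk, then inserting a return to the hub after each step,
    turns any loop into a product of triangles. *)
Lemma loop_blocks (F : R -> X) : continuous F -> F 0 = x0 -> F 1 = x0 ->
  exists N, forall n, (N <= n)%N -> exists w, size w = n.+1 /\
    homotopic_rel F (edge_loop (R := R) hub (blocks w)).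
Proof.
move=> cF F0 F1; have [N NP] := simplicial_approximation cF; exists N => n Nn.
have [v [ws [sws nw]]] := NP n Nn.
have s3 : size (stutter v ws) = (3 * n.+1)%N by rewrite size_stutter sws.
have n0 : 0 < (3 * n.+1)%:R :> R by rewrite ltr0n.
have vE : v = hub.
  have := nw 0%N 0; rewrite s3 lexx ler01 muln_gt0/= => /(_ isT isT isT) [+ _].
  by rewrite mul0r F0 crd_pt_gt0 => /eqP.
have lE : last v ws = hub.
  have := nw (3 * n.+1).-1 (3 * n.+1)%:R; rewrite s3 prednK ?muln_gt0//.
  rewrite leqnn lexx ler_nat leq_pred => /(_ isT isT isT) [_].
  rewrite divff ?gt_eqF// F1 crd_pt_gt0 -s3 nth_last => /eqP <-.
  by rewrite last_stutter; case: (ws) sws.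
rewrite {}vE in nw s3 lE.
exists (walk_word hub ws); split.
  by rewrite -sws; elim: (ws) hub => //= w ws' IH v'; rewrite IH.
have pw := near_walk_path nw.
apply: homotopic_rel_trans (walk_equiv_homotopic R (stutter_blocks pw lE)).
apply: homotopic_rel_joined => //.
- exact: edge_loop_continuous.
- move=> t t0 t1; rewrite /edge_loop s3.
  rewrite -[t in F t](mulfK (lt0r_neq0 n0)) [t * _]mulrC.
  apply: (near_walk_joined nw); rewrite ?s3//.
    by rewrite mulr_ge0// ltW.
  by rewrite ler_piMr// ltW.
- by rewrite edge_loop0.
- by rewrite edge_loop1 last_stutter lE.
Qed.

(** The words have the same reduced form and the same length, hence the same normal
    form. *)
Lemma homotopic_rel_blocks (F F' : R -> X) w w' :
  homotopic_rel F (edge_loop (R := R) hub (blocks w)) ->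
  homotopic_rel F' (edge_loop (R := R) hub (blocks w')) -> size w = size w' ->
  F2_of (pmap id w) = F2_of (pmap id w') -> homotopic_rel F F'.
Proof.
move=> H H' sw /(congr1 val) /= E; apply: (homotopic_rel_trans H).
apply: homotopic_rel_trans (homotopic_rel_sym H').
have [k e] := wequiv_normal w; have [k' e'] := wequiv_normal w'.
have := wequiv_size e; have := wequiv_size e'; rewrite !size_cat !size_nseq.
rewrite !size_map E -sw => -> /addnI kk'.
apply: (homotopic_rel_trans (walk_equiv_homotopic R e)).
apply: homotopic_rel_trans (homotopic_rel_sym (walk_equiv_homotopic R e')).
rewrite E kk'; apply: homotopic_rel_refl; apply: edge_loop_continuous; exact: path_blocks.
Qed.

Lemma carries_blocks w s :
  carries F2_voltage (edge_loop (R := R) hub (blocks w)) s (s * F2_of (pmap id w))%g.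
Proof.
rewrite -walk_volt_blocks; apply: carries_edge_path; first exact: path_blocks.
by [].
Qed.

(** The voltages multiply on the right, so they commute with left translations. *)
Lemma carries_mul (F : R -> X) (u s s' : F2) :
  carries F2_voltage F s s' -> carries F2_voltage F (u * s)%g (u * s')%g.
Proof.
move=> [h [Ph h0 h1]]; exists (fun t => u * h t)%g; rewrite h0 h1; split=> //.
move=> z; apply: filterS (Ph z) => z' /= ->; rewrite /F2_volt.
by case: edge_letter => // x; rewrite mulgA.
Qed.

(** The extension of a path to the line, constant outside [0, 1]. *)
Definition unclamp (Z : Type) (g : I01 R -> Z) : R -> Z := g \o clamp.

Lemma unclamp_continuous (Z : topologicalType) (g : continuousType (I01 R) Z) :
  continuous (unclamp g).
Proof.
by apply: cont_comp; [exact: clamp_continuous|move=> z; exact: cts_fun].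
Qed.

Lemma clamp_I0 : clamp 0 = I0 :> I01 R.
Proof. exact: clamp0. Qed.

Lemma clamp_I1 : clamp 1 = I1 :> I01 R.
Proof. exact: clamp1. Qed.

Lemma path_homotopicP (Z : topologicalType) (x y : Z)
    (g h : {path I01 R from x to y}) :
  path_homotopic g h <-> homotopic_rel (unclamp g) (unclamp h).
Proof.
split=> [[H [H0 H1 H2 H3]]|[K [cK K0 K1 K2 K3]]].
  exists (fun z => H (clamp z.1, clamp z.2)); split=> /= [|t _|t _|r _|r _].
  - apply: (cont_comp (f := fun z : R * R => (clamp z.1 : I01 R, clamp z.2 : I01 R)) (g := H)).
      by apply: cont_pair; [apply: (cont_comp (@cont_fst R R))|apply: (cont_comp (@cont_snd R R))];
        exact: clamp_continuous.
    by move=> z; exact: cts_fun.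
  - by rewrite clamp_I0 H0.
  - by rewrite clamp_I1 H1.
  - by rewrite /unclamp/= clamp_I0 H2 [RHS](path_zero (s := g)).
  - by rewrite /unclamp/= clamp_I1 H3 [RHS](path_one (s := g)).
pose H (z : I01 R * I01 R) := K (val z.1, val z.2).
have cv : continuous (val : I01 R -> R) by exact: initial_continuous.
have cH : continuous H.
  apply: (cont_comp (f := fun z : I01 R * I01 R => (val z.1, val z.2)) _ cK).
  by apply: cont_pair; [apply: (cont_comp (@cont_fst _ _))|apply: (cont_comp (@cont_snd _ _))].
have v01 (s : I01 R) : 0 <= val s <= 1.
  by have := valP s; rewrite inE /unit_itv /= in_itv.
exists (mkcts cH); split=> s.
- by rewrite [LHS](K0 _ (v01 s)) /unclamp /= clampK.
- by rewrite [LHS](K1 _ (v01 s)) /unclamp /= clampK.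
- by rewrite [LHS](K2 _ (v01 s)) /unclamp /= clamp_I0 [LHS](path_zero (s := g)).
- by rewrite [LHS](K3 _ (v01 s)) /unclamp /= clamp_I1 [LHS](path_one (s := g)).
Qed.

(** The isomorphism sends a loop to the transport of 1 along it. It is invariant
    under homotopy by carries_square, multiplicative by gluing, and its value on a
    triangle loop is the corresponding letter. Conversely, a loop is homotopic to a
    product of triangle loops, and that product is determined up to homotopy by its
    value. *)
Lemma pi1_theta : pi1_isog_F2 R x0.
Proof.
have cg (g : {path I01 R from x0 to x0}) : continuous (unclamp g).
  exact: unclamp_continuous.
have [f fP] := choice (fun g => carries_ex F2_voltage 1%g (cg g)).
have g0 (g : {path I01 R from x0 to x0}) : unclamp g 0 = x0.
  by rewrite /unclamp/= clamp_I0 [LHS](path_zero (s := g)).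
have g1 (g : {path I01 R from x0 to x0}) : unclamp g 1 = x0.
  by rewrite /unclamp/= clamp_I1 [LHS](path_one (s := g)).
have fw (g : {path I01 R from x0 to x0}) w :
  homotopic_rel (unclamp g) (edge_loop (R := R) hub (blocks w)) ->
  f g = F2_of (pmap id w).
  have cw : continuous (edge_loop (R := R) hub (blocks w)).
    by apply: edge_loop_continuous; exact: path_blocks.
  move=> /(carries_homotopic_rel (cg g) cw)/(_ (fP g)) C.
  by apply: (carries_fun cw C); rewrite -[F2_of _]mul1g; exact: carries_blocks.
exists f; split=> [g h|g h|w].
- split=> [fgh|/path_homotopicP gh].
    apply/path_homotopicP.
    have [N NP] := loop_blocks (cg g) (g0 g) (g1 g).
    have [N' N'P] := loop_blocks (cg h) (g0 h) (g1 h).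
    have [w [sw gw]] := NP _ (leq_maxl N N').
    have [w' [sw' hw']] := N'P _ (leq_maxr N N').
    apply: (homotopic_rel_blocks gw hw'); first by rewrite sw sw'.
    by rewrite -(fw g)// -(fw h).
  have := carries_homotopic_rel (cg g) (cg h) gh (fP g).
  by move=> C; exact: (carries_fun (cg h) C (fP h)).
- apply: (carries_fun (cg _) (fP _)).
  apply: (carries_cat (F2 := unclamp h) _ _ (fP g)).
  + move=> t t0 t2; have vt : val (clamp t : I01 R) = t.
      by rewrite /= [LHS]clip_id//; lra.
    by rewrite -[LHS]/(path_cat g h (clamp t)) /path_cat vt t2.
  + move=> t t2 t1; have vt : val (clamp t : I01 R) = t.
      by rewrite /= [LHS]clip_id//; lra.
    rewrite -[LHS]/(path_cat g h (clamp t)) /path_cat vt -[RHS]/(h (clamp _)).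
    case: leP => // t2'; have -> : t = 2^-1 by apply/le_anti/andP.
    rewrite clamp1; last by lra.
    rewrite clamp0; last by lra.
    by rewrite [LHS](path_one (s := g)) [RHS](path_zero (s := h)).
  + by have := carries_mul (f g) (fP h); rewrite mulg1.
- pose e := edge_loop (R := R) hub (blocks (map Some (val w))).
  have ce : continuous (fun s : I01 R => e (val s)).
    apply: (@cont_comp _ _ _ (fun s : I01 R => val s) e).
      exact: initial_continuous.
    by apply: edge_loop_continuous; exact: path_blocks.
  have e0 : e (val (zero : I01 R)) = x0 by rewrite /e edge_loop0.
  have e1 : e (val (one : I01 R)) = x0 by rewrite /e edge_loop1 last_blocks.
  exists (mk_path ce e0 e1).
  rewrite (fw _ (map Some (val w))).
    by rewrite map_pK//; apply: val_inj => /=; rewrite word_reduce_id//; exact: valP.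
  apply: homotopic_rel_joined => //.
  + by apply: edge_loop_continuous; exact: path_blocks.
  + move=> t t0 t1; have vt : val (clamp t : I01 R) = t by rewrite /= [LHS]clip_id.
    rewrite -[unclamp _ _]/(e (val (clamp t))) vt; exact: joined_refl.
  + by rewrite -[LHS]/(e (val (clamp 0))) clamp_I0.
  + by rewrite -[LHS]/(e (val (clamp 1))) clamp_I1.
Qed.

End fundamental_group_theta.

(** * Rational singular 1-chains modulo boundaries *)

Section chains.
Variable R : realType.

Section formal.
Variables (n : nat) (Y : topologicalType).
Implicit Types (L : seq (rat * singular R n Y)) (c : chain R n Y).

(** The chain with the given list of coefficients and simplices. Every finitely
    supported chain is of this form, and on lists the boundary and the induced
    maps are operations on the entries. *)
Definition chain_of L : chain R n Y := fun t => \sum_(p <- L) p.1 * (p.2 == t)%:R.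

Lemma chain_of_cat L L' t : chain_of (L ++ L') t = chain_of L t + chain_of L' t.
Proof. by rewrite /chain_of big_cat. Qed.

Lemma chain_of_scale a L t :
  chain_of [seq (a * p.1, p.2) | p <- L] t = a * chain_of L t.
Proof.
rewrite /chain_of big_map mulr_sumr; apply: eq_bigr => p _ /=.
by rewrite mulrA.
Qed.

Lemma chain_of_out L t : t \notin map snd L -> chain_of L t = 0.
Proof.
move=> tL; rewrite /chain_of big_seq big1// => p pL.
case: eqP => [E|_]; last by rewrite mulr0.
by case/negP: tL; rewrite -E; exact: map_f.
Qed.

Lemma chain_of_finite L : finitely_supported (chain_of L).
Proof.
apply: (@sub_finite_set _ _ [set` map snd L]); last exact: finite_seq.
by move=> s /=; apply: contraNT => /chain_of_out ->.
Qed.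

Lemma fsum_chain_of L (A : set (singular R n Y)) :
  \sum_(s \in A) chain_of L s = \sum_(p <- L) p.1 * (p.2 \in A)%:R.
Proof.
have <- : [set` [pred s | s \in A]] = A.
  by apply/seteqP; split=> s; rewrite /= inE.
rewrite -(bigfs _ (r := undup (map snd L))) ?undup_uniq//; last first.
  by move=> s _; rewrite mem_undup => /chain_of_out.
rewrite /chain_of exchange_big /=; rewrite big_seq [RHS]big_seq.
apply: eq_bigr => p pL; rewrite -mulr_sumr; congr (_ * _).
have pu : p.2 \in undup (map snd L) by rewrite mem_undup map_f.
have -> : (p.2 \in [set` [pred s | s \in A]]) = (p.2 \in A).
  by apply/idP/idP => [/set_mem|pA] //; apply: mem_set.
rewrite big_mkcond (bigD1_seq p.2) ?undup_uniq//= eqxx big1 ?addr0//.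
  by rewrite (_ : (p.2 \in _) = (p.2 \in A)); case: (p.2 \in A).
by move=> s; rewrite eq_sym => /negbTE ->; case: ifP.
Qed.

Lemma chain_of_ex c : finitely_supported c -> exists L, c = chain_of L.
Proof.
move=> /finite_seqP[r rE]; exists [seq (c s, s) | s <- undup r].
apply/funext => t; rewrite /chain_of big_map /=.
have [tr|tr] := boolP (t \in undup r).
  rewrite (bigD1_seq t) ?undup_uniq//= eqxx mulr1 big1 ?addr0// => s /negbTE ->.
  by rewrite mulr0.
rewrite big_seq big1.
  apply/eqP; apply: contraNT tr => ct; rewrite mem_undup.
  by have : [set` r] t by rewrite -rE.
move=> s sr; case: eqP => [E|_]; last by rewrite mulr0.
by rewrite E (negbTE tr) in sr.
Qed.

(** A weighted sum of coefficients depends on the chain only, not on the list: it is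
    the sum over all simplices that occur, with repetitions and cancellations
    accounted for. *)
Lemma sum_chain_of L L' (w : singular R n Y -> rat) : chain_of L =1 chain_of L' ->
  \sum_(p <- L) p.1 * w p.2 = \sum_(p <- L') p.1 * w p.2.
Proof.
pose r := undup (map snd (L ++ L')).
have E (K : seq (rat * singular R n Y)) : {subset map snd K <= r} ->
    \sum_(p <- K) p.1 * w p.2 = \sum_(s <- r) chain_of K s * w s.
  move=> Kr; rewrite /chain_of.
  under [RHS]eq_bigr do rewrite mulr_suml.
  rewrite exchange_big big_seq [RHS]big_seq; apply: eq_bigr => p pK /=.
  have pr : p.2 \in r by apply: Kr; exact: map_f.
  rewrite (bigD1_seq p.2) ?undup_uniq//= eqxx mulr1 big1 ?addr0// => s.
  by rewrite eq_sym => /negbTE ->; rewrite mulr0 mul0r.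
move=> LL'; rewrite !E; first by apply: eq_bigr => s _; rewrite LL'.
- by move=> s sL; rewrite mem_undup map_cat mem_cat sL orbT.
- by move=> s sL; rewrite mem_undup map_cat mem_cat sL.
Qed.

End formal.

Definition bdry_seq n (Y : topologicalType) (L : seq (rat * singular R n.+1 Y)) :
    seq (rat * singular R n Y) :=
  flatten [seq [seq ((-1) ^+ i * p.1, singular_face i p.2) | i : 'I_n.+2 <- enum 'I_n.+2]
          | p <- L].

Lemma boundary_chain_of n (Y : topologicalType)
    (L : seq (rat * singular R n.+1 Y)) t :
  boundary (chain_of L) t = chain_of (bdry_seq L) t.
Proof.
rewrite /boundary /chain_of /bdry_seq big_flatten big_map /=.
under [RHS]eq_bigr => p _ do rewrite big_map big_enum /=.
rewrite exchange_big /=; apply: eq_bigr => i _.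
rewrite -/(chain_of L) fsum_chain_of mulr_sumr; apply: eq_bigr => p _.
by rewrite mulrA; congr (_ * _%:R).
Qed.

Lemma chain_map_of n (Y Z : topologicalType) (f : continuousType Y Z)
    (L : seq (rat * singular R n Y)) t :
  chain_map f (chain_of L) t = chain_of [seq (p.1, singular_comp f p.2) | p <- L] t.
Proof.
rewrite /chain_map fsum_chain_of /chain_of big_map /=; apply: eq_bigr => p _.
by congr (_ * _%:R).
Qed.

Lemma singular_face_comp n (Y Z : topologicalType) (f : continuousType Y Z)
    (s : singular R n.+1 Y) i :
  singular_face i (singular_comp f s) = singular_comp f (singular_face i s).
Proof. exact/continuousEP. Qed.

Section bounding.
Variable Y : topologicalType.
Implicit Types c : singular R 1 Y -> rat.

(** The chains that are boundaries. All homological computations below are linear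
    combinations of a few geometric relations of this kind. *)
Definition bounds c : Prop := exists L : seq (rat * singular R 2 Y),
  c =1 chain_of (bdry_seq L).

Lemma bounds_ext c c' : c =1 c' -> bounds c -> bounds c'.
Proof. by move=> cc' [L LE]; exists L => s; rewrite -cc'. Qed.

Lemma bounds0 : bounds (fun=> 0).
Proof. by exists [::] => s; rewrite /chain_of big_nil. Qed.

Lemma bounds_add c c' : bounds c -> bounds c' -> bounds (fun s => c s + c' s).
Proof.
move=> [L LE] [L' LE']; exists (L ++ L') => s; rewrite LE LE'.
by rewrite /bdry_seq map_cat flatten_cat chain_of_cat.
Qed.

Lemma bounds_scale a c : bounds c -> bounds (fun s => a * c s).
Proof.
move=> [L LE]; exists [seq (a * p.1, p.2) | p <- L] => s; rewrite LE.
rewrite -chain_of_scale; congr chain_of; rewrite /bdry_seq -map_comp.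
rewrite map_flatten -map_comp; congr flatten; apply: eq_map => p /=.
by rewrite -map_comp; apply: eq_map => i /=; rewrite mulrCA.
Qed.

Lemma bounds_sub c c' : bounds c -> bounds c' -> bounds (fun s => c s - c' s).
Proof.
move=> b /(bounds_scale (-1)) b'; apply: bounds_ext (bounds_add b b') => s.
by rewrite mulN1r.
Qed.

Lemma homologousP c c' : homologous c c' <-> bounds (fun s => c s - c' s).
Proof.
split=> [[w [/chain_of_ex[L ->] H]]|[L LE]].
  by exists L => s; rewrite H boundary_chain_of.
exists (chain_of L); split; first exact: chain_of_finite.
by move=> s; rewrite LE boundary_chain_of.
Qed.

End bounding.

Lemma bounds_chain_map (Y Z : topologicalType) (f : continuousType Y Z)
    (c : singular R 1 Y -> rat) : bounds c -> bounds (chain_map f c).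
Proof.
move=> [L /funext ->]; exists [seq (p.1, singular_comp f p.2) | p <- L] => s.
rewrite chain_map_of; congr chain_of; rewrite /bdry_seq map_flatten -!map_comp.
congr flatten; apply: eq_map => p /=; rewrite -map_comp; apply: eq_map => i /=.
by rewrite singular_face_comp.
Qed.

Lemma finitely_supported_lin n (Y : topologicalType) a (c c' : chain R n Y) :
  finitely_supported c -> finitely_supported c' ->
  finitely_supported (fun t => c t - a * c' t).
Proof.
move=> /chain_of_ex[L ->] /chain_of_ex[L' ->].
have -> : (fun t => chain_of L t - a * chain_of L' t) =
    chain_of (L ++ [seq (- a * p.1, p.2) | p <- L']).
  by apply/funext => t; rewrite chain_of_cat chain_of_scale mulNr.
exact: chain_of_finite.
Qed.

Lemma chain_map_lin (Y Z : topologicalType) n (f : continuousType Y Z) a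
    (c c' : chain R n Y) s : finitely_supported c -> finitely_supported c' ->
  chain_map f (fun t => c t - a * c' t) s = chain_map f c s - a * chain_map f c' s.
Proof.
move=> /chain_of_ex[L ->] /chain_of_ex[L' ->].
have -> : (fun t => chain_of L t - a * chain_of L' t) =
    chain_of (L ++ [seq (- a * p.1, p.2) | p <- L']).
  by apply/funext => t; rewrite chain_of_cat chain_of_scale mulNr.
rewrite !chain_map_of map_cat chain_of_cat -[in RHS]mulNr; congr (_ + _).
by rewrite -chain_of_scale -!map_comp.
Qed.

Lemma boundary_lin (Y : topologicalType) n a (c c' : chain R n.+1 Y) s :
  finitely_supported c -> finitely_supported c' ->
  boundary (fun t => c t - a * c' t) s = boundary c s - a * boundary c' s.
Proof.
move=> /chain_of_ex[L ->] /chain_of_ex[L' ->].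
have -> : (fun t => chain_of L t - a * chain_of L' t) =
    chain_of (L ++ [seq (- a * p.1, p.2) | p <- L']).
  by apply/funext => t; rewrite chain_of_cat chain_of_scale mulNr.
rewrite !boundary_chain_of /bdry_seq map_cat flatten_cat chain_of_cat.
rewrite -[in RHS]mulNr; congr (_ + _).
rewrite -chain_of_scale map_flatten -!map_comp; congr (chain_of (flatten _) _).
by apply: eq_map => p /=; rewrite -map_comp; apply: eq_map => i /=; rewrite mulrCA.
Qed.

Definition bary n (i : 'I_n.+1) (t : Delta R n) : R := val t ord0 i.

Lemma bary_continuous n (i : 'I_n.+1) : continuous (bary i).
Proof.
apply: (cont_comp (f := val : Delta R n -> 'rV[R]_n.+1) (g := fun y => y ord0 i)).
  exact: initial_continuous.
exact: coord_continuous.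
Qed.

Lemma bary_ge0 n (i : 'I_n.+1) (t : Delta R n) : 0 <= bary i t.
Proof. by have := valP t; rewrite inE => -[H _]; exact: H. Qed.

Lemma bary_sum n (t : Delta R n) : \sum_i bary i t = 1.
Proof. by have := valP t; rewrite inE => -[]. Qed.

Lemma bary_face n (i : 'I_n.+2) (j : 'I_n.+1) (t : Delta R n) :
  bary (lift i j) (face i t) = bary j t.
Proof. by rewrite /bary /= mxE liftK. Qed.

Lemma bary_face0 n (i : 'I_n.+2) (t : Delta R n) : bary i (face i t) = 0.
Proof. by rewrite /bary /= mxE unlift_none. Qed.

Lemma bary1_le1 (t : Delta R 1) : bary ord_max t <= 1.
Proof.
by rewrite -(bary_sum t) big_ord_recr /= lerDr sumr_ge0// => i _; exact: bary_ge0.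
Qed.

Lemma bary1_0 (t : Delta R 1) : bary ord0 t = 1 - bary ord_max t.
Proof.
rewrite -(bary_sum t) big_ord_recr big_ord1 /= addrK.
by congr bary; apply: val_inj.
Qed.

Section path_chains.
Variable Y : topologicalType.
Implicit Types g : R -> Y.

(** The singular simplex of a path, as a chain; the path is given on the line and no
    proof of continuity occurs in the definition. *)
Definition path_chain g (s : singular R 1 Y) : rat :=
  `[< forall t, s t = g (bary ord_max t) >]%:R.

Lemma singular_path_continuous g :
  continuous g -> continuous (g \o bary (ord_max : 'I_2)).
Proof. by move=> cg; apply: cont_comp => //; exact: bary_continuous. Qed.

Definition singular_path g (cg : continuous g) : singular R 1 Y :=
  mkcts (singular_path_continuous cg).

Lemma path_chainE g (cg : continuous g) s :
  path_chain g s = (singular_path cg == s)%:R.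
Proof.
rewrite /path_chain; congr (nat_of_bool _)%:R; apply/asboolP/eqP => [H|<-//].
by apply/continuousEP => t; rewrite H.
Qed.

Lemma path_chain_eq g g' : (forall t, 0 <= t -> t <= 1 -> g t = g' t) ->
  path_chain g = path_chain g'.
Proof.
move=> gg'; apply/funext => s; rewrite /path_chain.
congr (nat_of_bool _)%:R; apply/asboolP/asboolP => H t; rewrite H.
  by rewrite gg' ?bary_ge0 ?bary1_le1.
by rewrite gg' ?bary_ge0 ?bary1_le1.
Qed.

Lemma path_chain_of g (cg : continuous g) :
  path_chain g = chain_of [:: (1, singular_path cg)].
Proof. by apply/funext => s; rewrite /chain_of big_seq1 mul1r path_chainE. Qed.

Lemma path_chain_finite g : continuous g -> finitely_supported (path_chain g).
Proof. by move=> cg; rewrite path_chain_of; exact: chain_of_finite. Qed.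

(** The boundary of the 2-simplex obtained from K on the triangle with vertices
    (0, 0), (1, 0) and (0, 1). *)
Lemma bounds_triangle (K : R * R -> Y) : continuous K ->
  bounds (fun s => path_chain (fun t => K (1 - t, t)) s
    - path_chain (fun t => K (0, t)) s + path_chain (fun t => K (t, 0)) s).
Proof.
move=> cK; pose i1 : 'I_3 := lift ord0 ord0; pose i2 : 'I_3 := ord_max.
pose T (t : Delta R 2) := K (bary i1 t, bary i2 t).
have cT : continuous T.
  apply: (cont_comp (f := fun t => (bary i1 t, bary i2 t)) _ cK).
  by apply: cont_pair; exact: bary_continuous.
pose s2 : singular R 2 Y := mkcts cT.
exists [:: (1, s2)] => s; rewrite /bdry_seq /= cats0 /chain_of big_map big_enum /=.
rewrite big_ord_recl big_ord_recl big_ord1 /= !mulr1.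
have E (i : 'I_3) g : (forall t, T (face i t) = g (bary ord_max t)) ->
    (singular_face i s2 == s)%:R = path_chain g s.
  move=> H; rewrite /path_chain; congr (nat_of_bool _)%:R.
  apply/eqP/asboolP => [<-//|H']; apply/continuousEP => t.
  by rewrite H' -H.
rewrite (E _ (fun t => K (1 - t, t))); last first.
  move=> t; rewrite /T -bary1_0 /i1 bary_face.
  by rewrite (_ : i2 = lift ord0 ord_max) ?bary_face//; exact: val_inj.
rewrite (E _ (fun t => K (0, t))); last first.
  move=> t; rewrite /T bary_face0.
  by rewrite (_ : i2 = lift i1 ord_max) ?bary_face//; exact: val_inj.
rewrite (E _ (fun t => K (t, 0))); last first.
  move=> t; rewrite /T (_ : lift _ _ = i2) ?bary_face0; last exact: val_inj.
  by rewrite (_ : i1 = lift i2 ord_max) ?bary_face//; exact: val_inj.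
rewrite /bump /=; ring.
Qed.

Definition segment_path (K : R * R -> Y) (p q : R * R) (t : R) : Y :=
  K (p.1 + t * (q.1 - p.1), p.2 + t * (q.2 - p.2)).

Lemma bounds_segments (K : R * R -> Y) p q r : continuous K ->
  bounds (fun s => path_chain (segment_path K p q) s
    + path_chain (segment_path K q r) s - path_chain (segment_path K p r) s).
Proof.
move=> cK.
pose A (z : R * R) : R * R :=
  (p.1 + z.1 * (q.1 - p.1) + z.2 * (r.1 - p.1),
   p.2 + z.1 * (q.2 - p.2) + z.2 * (r.2 - p.2)).
have cA : continuous A.
  by apply: cont_pair; repeat apply: cont_add; try apply: cont_mul;
    (exact: cont_cst || exact: cont_fst || exact: cont_snd).
have := bounds_triangle (cont_comp cA cK); apply: bounds_ext => s.
have -> : (fun t => (K \o A) (1 - t, t)) = segment_path K q r.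
  by apply/funext => t; congr (K (_, _)) => /=; ring.
have -> : (fun t => (K \o A) (0, t)) = segment_path K p r.
  by apply/funext => t; congr (K (_, _)) => /=; ring.
have -> : (fun t => (K \o A) (t, 0)) = segment_path K p q.
  by apply/funext => t; congr (K (_, _)) => /=; ring.
ring.
Qed.

Lemma bounds_cst y : bounds (path_chain (cst y)).
Proof.
have := bounds_triangle (@cont_cst (R * R)%type _ y).
by apply: bounds_ext => s; rewrite subrr add0r.
Qed.

Definition subpath g (a b t : R) : Y := g (a + t * (b - a)).

Lemma bounds_subpath g a b c : continuous g ->
  bounds (fun s => path_chain (subpath g a b) s + path_chain (subpath g b c) s
    - path_chain (subpath g a c) s).
Proof.
move=> cg; exact: (bounds_segments (a, 0) (b, 0) (c, 0) (cont_comp (@cont_fst R R) cg)).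
Qed.

(** The square is cut along its diagonal, which cancels. *)
Lemma bounds_square (K : R * R -> Y) : continuous K ->
  bounds (fun s => path_chain (fun t => K (t, 0)) s
    + path_chain (fun t => K (1, t)) s
    - path_chain (fun t => K (0, t)) s - path_chain (fun t => K (t, 1)) s).
Proof.
move=> cK; have H1 := bounds_segments (0, 0) (1, 0) (1, 1) cK.
have H2 := bounds_segments (0, 0) (0, 1) (1, 1) cK.
have S p q g : (forall t, segment_path K p q t = g t) ->
    path_chain (segment_path K p q) = path_chain g by move=> /funext ->.
rewrite (S _ _ (fun t => K (t, 0))) in H1; last first.
  by move=> t; congr (K (_, _)) => /=; ring.
rewrite (S _ _ (fun t => K (1, t))) in H1; last first.
  by move=> t; congr (K (_, _)) => /=; ring.
rewrite (S _ _ (fun t => K (0, t))) in H2; last first.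
  by move=> t; congr (K (_, _)) => /=; ring.
rewrite (S _ _ (fun t => K (t, 1))) in H2; last first.
  by move=> t; congr (K (_, _)) => /=; ring.
by apply: bounds_ext (bounds_sub H1 H2) => s; ring.
Qed.

End path_chains.

Lemma chain_map_path (Y Z : topologicalType) (f : continuousType Y Z) (g : R -> Y) :
  continuous g -> chain_map f (path_chain g) = path_chain (f \o g).
Proof.
move=> cg; have cfg : continuous (f \o g) by apply: cont_comp cg _; exact: cts_fun.
apply/funext => s; rewrite (path_chain_of cg) (path_chain_of cfg) chain_map_of /=.
by congr (chain_of [:: (1, _)] s); apply/continuousEP.
Qed.

Lemma cycle1_loop (Y : topologicalType) (g : R -> Y) : continuous g ->
  g 0 = g 1 -> forall t, boundary (path_chain g) t = 0.
Proof.
move=> cg g01 t; rewrite (path_chain_of cg) boundary_chain_of /bdry_seq /= cats0.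
rewrite /chain_of big_map big_enum /= big_ord_recl big_ord1 /= !mulr1 expr1.
have E (u : Delta R 0) : bary ord0 u = 1 by rewrite -(bary_sum u) big_ord1.
rewrite (_ : singular_face (lift ord0 ord0) _ = singular_face ord0 (singular_path cg)).
  by rewrite expr0 mul1r mulN1r subrr.
apply/continuousEP => u; rewrite -[LHS]/(g (bary _ (face _ u))).
rewrite -[RHS]/(g (bary _ (face _ u))).
rewrite [in RHS](_ : ord_max = lift ord0 ord0) ?bary_face; last exact: val_inj.
rewrite (_ : ord_max = lift ord0 ord0) ?bary_face0; last exact: val_inj.
by rewrite E.
Qed.

End chains.

(** * Double covers of graphs *)

(** Signs on the edges, which describe a double cover: an edge with sign true changes
    the sheet. *)
Record sign_graph := SignGraph {
  sgraph :> graph;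
  sgn : sgraph -> sgraph -> bool;
  sgn_id : forall u, sgn u u = false;
  sgn_sym : forall u v, gadj u v -> sgn u v = sgn v u }.

Section double_cover.
Variable G : sign_graph.
Implicit Types (u v w : G) (s t : bool).
Local Notation sgn := (@sgn G).

Definition cover_adj (a b : G * bool) : bool :=
  gadj a.1 b.1 && (b.2 == a.2 (+) sgn a.1 b.1).

Lemma cover_adj_refl : reflexive cover_adj.
Proof. by move=> [u s]; rewrite /cover_adj gadj_refl sgn_id addbF eqxx. Qed.

Lemma cover_adj_sym : symmetric cover_adj.
Proof.
move=> [u s] [v t]; rewrite /cover_adj /= gadj_sym; case: (boolP (gadj v u)) => //= vu.
by rewrite (sgn_sym vu); case: s t (sgn u v) => [] [] [].
Qed.

Definition cover : graph := Graph (base G, false) cover_adj_refl cover_adj_sym.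

Lemma sgn_voltK u v : gadj u v -> cancel (addb^~ (sgn u v)) (addb^~ (sgn v u)).
Proof. by move=> uv s; rewrite -(sgn_sym uv) addbK. Qed.

Definition sgn_voltage : voltage G bool :=
  Voltage (volt := fun u v => addb^~ (sgn u v))
    (fun u s => etrans (congr1 (addb s) (sgn_id u)) (addbF s)) sgn_voltK.

Variable R : realType.
Local Notation X := (geom R G).
Local Notation Y := (geom R cover).
Implicit Types (x : X) (y : Y).

Lemma sgn_cocycle x u v w : 0 < crd x u -> 0 < crd x v -> 0 < crd x w ->
  sgn u v (+) sgn v w = sgn u w.
Proof. by move=> xu xv xw; have := volt_cocycle sgn_voltage false xu xv xw. Qed.

Lemma sum_pair (f : cover -> R) :
  \sum_a f a = \sum_v (f (v, false) + f (v, true)).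
Proof.
have -> : \sum_a f a = \sum_v \sum_s f (v, s).
  by rewrite pair_bigA /=; apply: eq_bigr => -[].
by apply: eq_bigr => v _; rewrite big_bool /= addrC.
Qed.

Definition proj y : X := to_graph (fun v => crd y (v, false) + crd y (v, true)).

Lemma crd_proj y v : crd (proj y) v = crd y (v, false) + crd y (v, true).
Proof.
rewrite /proj to_graphE//; split=> [u||].
- by rewrite addr_ge0// crd_ge0.
- by rewrite -(crd_sum y) sum_pair.
- have [[a s] [[b t] [/andP[ab _] abP]]] := crd_simplex y.
  exists a, b; split=> // w wP.
  have [r wr] : exists r, 0 < crd y (w, r).
    have [w0|w0] := ltP 0 (crd y (w, false)); first by exists false.
    exists true; rewrite crd_gt0; apply: contraNneq wP => ->.
    by rewrite addr0; apply/eqP/le_anti; rewrite w0 crd_ge0.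
  by have [[-> _]|[-> _]] := abP _ wr; [left|right].
Qed.

Definition flip y : Y := @to_graph R cover (fun a : G * bool => crd y (a.1, ~~ a.2)).

Lemma crd_flip y (a : cover) : crd (flip y) a = crd y (a.1, ~~ a.2).
Proof.
rewrite /flip to_graphE//; split=> [u||]; first exact: crd_ge0.
- rewrite -(crd_sum y) !sum_pair; apply: eq_bigr => v _ /=; exact: addrC.
- have [[u s] [[v t] [uv uvP]]] := crd_simplex y.
  exists (u, ~~ s), (v, ~~ t); split.
    move: uv; rewrite /= /cover_adj /= => /andP[-> /eqP ->] /=.
    by rewrite addNb.
  move=> [w r] /=; rewrite -crd_gt0 => /uvP[] [<- <-]; rewrite negbK; [by left|by right].
Qed.

Lemma crd_sheet y v w s t : 0 < crd y (v, s) -> 0 < crd y (w, t) ->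
  t = s (+) sgn v w.
Proof. by move=> a b; have /andP[_ /eqP] := crd_adj a b. Qed.

(** The section of the double cover over the star of v with values in the star of
    (v, s). *)
Definition sect v s x : Y :=
  @to_graph R cover (fun a : G * bool => if a.2 == s (+) sgn v a.1 then crd x a.1 else 0).

Lemma crd_sect v s x (a : cover) : 0 < crd x v ->
  crd (sect v s x) a = if a.2 == s (+) sgn v a.1 then crd x a.1 else 0.
Proof.
move=> xv; rewrite /sect to_graphE//; split=> [u||].
- by case: ifP => // _; exact: crd_ge0.
- rewrite sum_pair -(crd_sum x); apply: eq_bigr => w _ /=.
  by case: (s (+) sgn v w); rewrite ?addr0 ?add0r.
- have [a' [b [ab abP]]] := crd_simplex x.
  pose l u : G * bool := (u, s (+) sgn v u).
  have H (w : G * bool) : (if w.2 == s (+) sgn v w.1 then crd x w.1 else 0) != 0 ->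
      0 < crd x w.1 /\ w = l w.1.
    case: w => w r /=; case: (r =P _) => [->|_]; last by rewrite eqxx.
    by rewrite -crd_gt0.
  have [va|vb] := abP _ xv.
    exists (l a'), (l b); split; last first.
      by move=> w /H[/abP[] + ->] => ->; [left|right].
    by rewrite /= /cover_adj /= ab va sgn_id addbF eqxx.
  exists (l a'), (l b); split; last first.
    by move=> w /H[/abP[] + ->] => ->; [left|right].
  rewrite /= /cover_adj /= ab vb sgn_id addbF -(sgn_sym ab) -addbA addbb addbF.
  exact: eqxx.
Qed.

Lemma proj_sect v s x : 0 < crd x v -> proj (sect v s x) = x.
Proof.
move=> xv; apply: crd_ext => w; rewrite crd_proj !crd_sect//=.
by case: (s (+) sgn v w); rewrite ?addr0 ?add0r.
Qed.

Lemma sect_gt0 v s x : 0 < crd x v -> 0 < crd (sect v s x) (v, s).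
Proof. by move=> xv; rewrite crd_sect//= sgn_id addbF eqxx. Qed.

Lemma crd_proj_gt0 y v : 0 < crd (proj y) v -> exists s, 0 < crd y (v, s).
Proof.
rewrite crd_proj => h; have [y0|y0] := ltP 0 (crd y (v, false)).
  by exists false.
exists true; rewrite (lt_le_trans h)// gerDr//.
Qed.

Lemma proj_gt0 y v s : 0 < crd y (v, s) -> 0 < crd (proj y) v.
Proof.
rewrite crd_proj => h; have := crd_ge0 y (v, true); have := crd_ge0 y (v, false).
by case: s h; lra.
Qed.

Lemma sectK y v s : 0 < crd y (v, s) -> sect v s (proj y) = y.
Proof.
move=> yv; apply: crd_ext => -[w t]; rewrite crd_sect ?(proj_gt0 yv)//=.
have Z r : r != s (+) sgn v w -> crd y (w, r) = 0.
  move=> rs; apply/eqP; apply: contraNT rs; rewrite -crd_gt0 => yw.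
  by apply/eqP; exact: crd_sheet yv yw.
rewrite crd_proj; case: eqP => [->|/eqP ts]; last by rewrite (Z t).
case E : (s (+) sgn v w) Z => Z; first by rewrite (Z false) ?add0r.
by rewrite (Z true) ?addr0.
Qed.

(** Over the intersection of two stars the sections of the same sheet agree. *)
Lemma sect_change v w s x : 0 < crd x v -> 0 < crd x w ->
  sect w (s (+) sgn v w) x = sect v s x.
Proof.
move=> xv xw; apply: crd_ext => -[u t]; rewrite !crd_sect//=.
have [xu|] := ltP 0 (crd x u); last first.
  move=> xu; have -> : crd x u = 0 by apply/le_anti; rewrite xu crd_ge0.
  by rewrite !if_same.
by rewrite -addbA (sgn_cocycle xv xw xu).
Qed.

Lemma flipK y : flip (flip y) = y.
Proof. by apply: crd_ext => -[v s]; rewrite !crd_flip/= negbK. Qed.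

Lemma proj_flip y : proj (flip y) = proj y.
Proof. by apply: crd_ext => v; rewrite !crd_proj !crd_flip /= addrC. Qed.

(** The two points of a fibre are exchanged by the deck transformation: a point of Y
    is determined by its projection and by one vertex with positive coordinate. *)
Lemma proj_eq y y' : proj y = proj y' -> y = y' \/ y = flip y'.
Proof.
move=> e; case E : (vtx y) => [v s]; have ys := vtx_gt0 y; rewrite E in ys.
have := proj_gt0 ys; rewrite e => /crd_proj_gt0[t yt].
have [ts|ts] := eqVneq t s.
  by left; rewrite -(sectK ys) e sectK// -ts.
right; rewrite -(sectK ys) e -(proj_flip y') sectK// crd_flip /=.
by rewrite (_ : ~~ s = t)//; move: s t ts {E ys yt} => [] [].
Qed.

Lemma proj_eq_star y y' v s : proj y = proj y' ->
  0 < crd y (v, s) -> 0 < crd y' (v, s) -> y = y'.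
Proof. by move=> e ys ys'; rewrite -(sectK ys) e sectK. Qed.

Lemma crd_other_sheet y v s : 0 < crd y (v, s) -> crd y (v, ~~ s) = 0.
Proof.
move=> yv; apply/eqP; apply: contraT; rewrite -crd_gt0 => /(crd_sheet yv).
by rewrite sgn_id addbF; case: (s).
Qed.

Lemma flip_neq y : flip y <> y.
Proof.
move=> e; case E : (vtx y) => [v s]; have ys := vtx_gt0 y; rewrite E in ys.
by have := ys; rewrite -e crd_flip /= (crd_other_sheet ys) ltxx.
Qed.

Lemma flip_continuous : continuous flip.
Proof.
apply: geom_continuous => a; under eq_fun do rewrite crd_flip.
exact: crd_continuous.
Qed.

Lemma proj_continuous : continuous proj.
Proof.
apply: geom_continuous => a; under eq_fun do rewrite crd_proj.
by apply: cont_add; exact: crd_continuous.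
Qed.

Lemma sect_continuous_at (Z : topologicalType) (F : Z -> X) v s z :
  {for z, continuous F} -> 0 < crd (F z) v ->
  {for z, continuous (fun z => sect v s (F z))}.
Proof.
move=> cF Fv; apply: geom_continuous_at => a.
have cFa : {for z, continuous (fun z => crd (F z) a.1)}.
  exact: (cvg_comp _ _ cF (@crd_continuous _ _ _ _)).
have E : \forall z' \near z, crd (sect v s (F z')) a =
    if a.2 == s (+) sgn v a.1 then crd (F z') a.1 else 0.
  by apply: filterS (star_near cF Fv) => z' Fz'; exact: crd_sect.
have C : {for z, continuous (fun z => if a.2 == s (+) sgn v a.1 then crd (F z) a.1 else 0)}.
  by case: (a.2 == _); [exact: cFa|exact: cvg_cst].
move=> A; rewrite crd_sect// => /C CA.
have CA' : \forall z' \near z, A (if a.2 == s (+) sgn v a.1 then crd (F z') a.1 else 0) := CA.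
by apply: filterS2 E CA' => z' /= ->.
Qed.

Section lifting.
Variables (Z : topologicalType).

Lemma lift_continuous (F : Z -> X) h : continuous F ->
  parallel sgn_voltage F h -> continuous (fun z => sect (vtx (F z)) (h z) (F z)).
Proof.
move=> cF Ph z A A1; have C := @sect_continuous_at Z F _ (h z) z (cF z) (vtx_gt0 (F z)) A A1.
have C' : \forall z' \near z, A (sect (vtx (F z)) (h z) (F z')) := C.
apply: filterS3 C' (Ph z) (star_near (cF z) (vtx_gt0 (F z))) => z' Az' hz' Fz' /=.
by rewrite hz' /= sect_change ?vtx_gt0.
Qed.

(** Two lifts of one map either agree or differ by the deck transformation, at each
    point, and both alternatives are open. *)
Lemma lift_dichotomy (F F' : Z -> Y) : connected [set: Z] ->
  continuous F -> continuous F' -> (forall z, proj (F z) = proj (F' z)) ->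
  (forall z, F z = F' z) \/ (forall z, F z = flip (F' z)).
Proof.
move=> cZ cF cF' FF'.
have [[z0 e0]|ne] := pselect (exists z, F z = F' z); last first.
  right=> z; have [e|//] := proj_eq (FF' z).
  by case: ne; exists z.
have near_eq (F1 F2 : Z -> Y) z : continuous F1 -> continuous F2 ->
    (forall z, proj (F1 z) = proj (F2 z)) -> F1 z = F2 z ->
    \forall z' \near z, F1 z' = F2 z'.
  move=> c1 c2 e12 e; case E : (vtx (F1 z)) => [v s].
  have ys := vtx_gt0 (F1 z); rewrite E in ys.
  have ys' := ys; rewrite e in ys'.
  apply: filterS2 (star_near (c1 z) ys) (star_near (c2 z) ys') => z' a b.
  exact: proj_eq_star a b.
left; apply: (connected_clopen cZ e0) => z e; first exact: near_eq.
have {}e : F z = flip (F' z) by have [//|] := proj_eq (FF' z).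
have : \forall z' \near z, F z' = flip (F' z').
  apply: near_eq => //; last by move=> z'; rewrite proj_flip.
  exact: (cont_comp cF' flip_continuous).
by apply: filterS => z' -> ; exact: flip_neq.
Qed.

End lifting.

(** A lift exists because the parallel bool-valued functions tell the sheet. *)
Lemma lift_square (F : R * R -> X) y : continuous F -> proj y = F (0, 0) ->
  exists Fl : R * R -> Y, [/\ continuous Fl,
    forall z, proj (Fl z) = F (rect 0 1 0 1 z) & Fl (0, 0) = y].
Proof.
move=> cF yF; have yv := vtx_gt0 (F (0, 0)); rewrite -yF in yv.
have [s ys] := crd_proj_gt0 yv.
have [h Ph h0] := parallel_ex sgn_voltage s cF.
have cF' : continuous (F \o rect 0 1 0 1) by apply: cont_comp cF; exact: rect_continuous.
exists (fun z => sect (vtx ((F \o rect 0 1 0 1) z)) (h z) ((F \o rect 0 1 0 1) z)).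
split; first exact: lift_continuous.
- by move=> z; rewrite proj_sect//; exact: vtx_gt0.
- by rewrite h0 /= /rect /= !clip_id// -yF sectK.
Qed.

Lemma lift_path (F : R -> X) y : continuous F -> proj y = F 0 ->
  exists Fl : R -> Y, [/\ continuous Fl,
    forall r, proj (Fl r) = F (clip 0 1 r) & Fl 0 = y].
Proof.
move=> cF yF; have cF1 : continuous (fun z : R * R => F z.1) := cont_comp (@cont_fst R R) cF.
have [Fl [cFl FlE Fl0]] := lift_square cF1 yF.
exists (fun r => Fl (r, 0)); split; [|by move=> r; rewrite FlE|exact: Fl0].
apply: (cont_comp (f := fun r : R => (r, 0 : R)) _ cFl).
by apply: cont_pair; [exact: cont_id|exact: cont_cst].
Qed.

End double_cover.

(** * Realizations as graphs, double covers as coverings *)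

Section is_graph.
Variables (R : realType) (G : graph).
Local Notation X := (geom R G).

Lemma geom_hausdorff : hausdorff_space X.
Proof.
move=> x y xy; apply: crd_ext => v; apply: (@Rhausdorff R) => A B Ax By.
have [z [Az Bz]] := xy _ _ (@crd_continuous R G v x A Ax) (@crd_continuous R G v y B By).
by exists (crd z v).
Qed.

Lemma edge_point (x : X) a b : gadj a b ->
  (forall w, 0 < crd x w -> w = a \/ w = b) ->
  exists r, [/\ 0 <= r, r <= 1 & x = comb r (pt R a) (pt R b)].
Proof.
move=> ab xab; exists (crd x b).
have x1 : crd x b <= 1.
  rewrite -(crd_sum x) (bigD1 b) //= lerDl sumr_ge0// => v _; exact: crd_ge0.
split=> //; first exact: crd_ge0.
apply: crd_ext => w; rewrite crd_comb ?crd_ge0//; last exact: joined_pt.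
rewrite !crd_pt.
have out v : v <> a -> v <> b -> crd x v = 0.
  move=> va vb; apply/eqP; apply: contraT; rewrite -crd_gt0 => /xab.
  by case.
have [E|nab] := eqVneq a b.
  have b1 : crd x b = 1.
    rewrite -(crd_sum x) (bigD1 b) //= big1 ?addr0// => v /eqP vb.
    by apply: out; rewrite ?E.
  rewrite E b1; have [->|/eqP wb] := eqVneq w b; first by rewrite b1 /=; ring.
  by rewrite out ?E//= ; ring.
have ab1 : crd x a + crd x b = 1.
  rewrite -(crd_sum x) (bigD1 a) //= (bigD1 b) ?(eq_sym b)//= big1 ?addr0//.
  by move=> v /andP[/eqP va /eqP vb]; exact: out.
have [->|/eqP wa] := eqVneq w a; first by rewrite (negbTE nab) /=; lra.
have [->|/eqP wb] := eqVneq w b; first by rewrite /=; ring.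
by rewrite out//=; ring.
Qed.

(** Edges are oriented by the enumeration of the vertices, so that each one occurs
    exactly once. *)
Definition edge_type := {p : G * G | gadj p.1 p.2 && (enum_rank p.1 < enum_rank p.2)%N}.

Lemma edge_adj (e : edge_type) : gadj (val e).1 (val e).2.
Proof. by have /andP[] := valP e. Qed.

Lemma edge_lt (e : edge_type) : (enum_rank (val e).1 < enum_rank (val e).2)%N.
Proof. by have /andP[] := valP e. Qed.

Lemma edge_neq (e : edge_type) : (val e).1 <> (val e).2.
Proof. by move=> E; have := edge_lt e; rewrite E ltnn. Qed.

Definition char_map (e : edge_type) (t : I01 R) : X :=
  comb (val t) (pt R (val e).1) (pt R (val e).2).

Lemma I01_bounds (t : I01 R) : 0 <= val t <= 1.
Proof. by have := valP t; rewrite inE /unit_itv /= in_itv. Qed.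

Lemma char_map_continuous e : continuous (char_map e).
Proof.
apply: comb_continuous => [t|t| | |]; try exact: cont_cst.
- exact: joined_pt (edge_adj e).
- by have /andP[] := I01_bounds t.
- exact: initial_continuous.
Qed.

Lemma crd_char_map e t w : crd (char_map e t) w =
  (1 - val t) * (w == (val e).1)%:R + val t * (w == (val e).2)%:R.
Proof.
have /andP[t0 t1] := I01_bounds t.
by rewrite crd_comb// ?crd_pt//; exact: joined_pt (edge_adj e).
Qed.

Lemma crd_char_map1 e t : crd (char_map e t) (val e).1 = 1 - val t.
Proof.
have ne : ((val e).1 == (val e).2) = false by apply/eqP/edge_neq.
by rewrite crd_char_map eqxx ne mulr1 mulr0 addr0.
Qed.

Lemma crd_char_map2 e t : crd (char_map e t) (val e).2 = val t.
Proof.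
have ne : ((val e).2 == (val e).1) = false by rewrite eq_sym; apply/eqP/edge_neq.
by rewrite crd_char_map eqxx ne mulr1 mulr0 add0r.
Qed.

Lemma char_map_supp e t w : 0 < crd (char_map e t) w ->
  w = (val e).1 \/ w = (val e).2.
Proof.
have [w1|/eqP/negbTE w1] := pselect (w = (val e).1); first by left.
have [w2|/eqP/negbTE w2] := pselect (w = (val e).2); first by right.
by rewrite crd_char_map w1 w2 !mulr0 addr0 ltxx.
Qed.

Lemma geom_cases (x : X) : (exists v, x = pt R v) \/
  exists (e : edge_type) (t : I01 R), 0 < val t < 1 /\ x = char_map e t.
Proof.
have [a [b [ab abP]]] := crd_simplex x.
have [r [r0 r1 xE]] := edge_point ab abP.
have [ra|/eqP ra] := eqVneq r 0.
  by left; exists a; rewrite xE ra comb0//; exact: joined_pt.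
have [rb|/eqP rb] := eqVneq r 1.
  by left; exists b; rewrite xE rb comb1//; exact: joined_pt.
have [E|nab] := eqVneq a b.
  by left; exists b; rewrite xE E combxx.
have main (c d : G) (q : R) : gadj c d -> (enum_rank c < enum_rank d)%N ->
    0 < q -> q < 1 -> x = comb q (pt R c) (pt R d) ->
    exists (e : edge_type) (t : I01 R), 0 < val t < 1 /\ x = char_map e t.
  move=> cd lt_cd q0 q1 E.
  have P : gadj c d && (enum_rank c < enum_rank d)%N by rewrite cd.
  exists (exist (fun p : G * G => gadj p.1 p.2 && (enum_rank p.1 < enum_rank p.2)%N) (c, d) P).
  exists (clamp q); rewrite /char_map /=.
  have -> : Num.max 0 (Num.min 1 q) = q by apply: clip_id; apply: ltW.
  by rewrite q0 q1.
have r0' : 0 < r by rewrite lt_neqAle r0 andbT eq_sym; exact/eqP.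
have r1' : r < 1 by rewrite lt_neqAle r1 andbT; exact/eqP.
right; have [lt_ab|lt_ba|] := ltngtP (enum_rank a) (enum_rank b).
- exact: (main a b r).
- apply: (main b a (1 - r)); rewrite 1?gadj_sym//; [lra|lra|].
  have j := joined_pt R ab; have j' : joined (pt R b) (pt R a).
    by apply: joined_pt; rewrite gadj_sym.
  by rewrite xE; apply: crd_ext => w; rewrite !crd_comb//; [ring|lra|lra].
- by move=> /val_inj/enum_rank_inj E; rewrite E eqxx in nab.
Qed.

(** For the weak topology: a set is the union of finitely many points and of the images
    of its traces on the closed edges, which are compact. *)
Lemma geom_is_graph : is_graph R X.
Proof.
exists [set x | exists v, x = pt R v]; exists edge_type.
exists (fun e => mkcts (@char_map_continuous e)); split => /=.
- move=> e; split; [exists (val e).1|exists (val e).2]; rewrite /mkcts /char_map.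
    by rewrite comb0//; exact: joined_pt (edge_adj e).
  by rewrite comb1//; exact: joined_pt (edge_adj e).
- move=> e t /andP[t0 t1] [v E].
  have h1 : (val e).1 = v.
    by apply/eqP; rewrite -(crd_pt_gt0 R) -E crd_char_map1 subr_gt0.
  have h2 : (val e).2 = v.
    by apply/eqP; rewrite -(crd_pt_gt0 R) -E crd_char_map2.
  by apply: (@edge_neq e); rewrite h1 h2.
- move=> e e' t t' /andP[t0 t1] /andP[t'0 t'1] E.
  have ee' : e = e'.
    apply: val_inj.
    have := @char_map_supp e' t' (val e).1; rewrite -[char_map e' t']E.
    rewrite crd_char_map1 subr_gt0 => /(_ t1) h1.
    have := @char_map_supp e' t' (val e).2; rewrite -[char_map e' t']E.
    rewrite crd_char_map2 => /(_ t0) h2.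
    have := edge_lt e; have := edge_lt e'.
    case: h1 h2 => h1 [] h2; rewrite ?h1 ?h2 ?ltnn//.
      by move=> _ _; move: h1 h2; case: (val e) (val e') => ? ? [? ?] /= -> ->.
    by move=> a b; have := ltn_trans a b; rewrite ltnn.
  split=> //; apply: val_inj.
  by rewrite -(crd_char_map2 e) -(crd_char_map2 e') -ee'; congr crd; rewrite [LHS]E ee'.
- exact: geom_cases.
- move=> A Acl.
  have -> : A = (\bigcup_(v in [set v : G | A (pt R v)]) [set pt R v]) `|`
      \bigcup_(e in [set: edge_type]) (fun r => char_map e (clamp r)) @`
        (`[0, 1] `&` [set r | A (char_map e (clamp r))]).
    apply/seteqP; split=> [x Ax|x [[v /= Av ->//]|[e _ [r [_ /= Ar] <-//]]]].
    have [[v E]|[e [t [t01 E]]]] := geom_cases x.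
      by left; exists v => //=; rewrite -E.
    right; exists e => //; exists (val t); last by rewrite clampK.
    split; first by rewrite /= in_itv; exact: I01_bounds.
    by rewrite /= clampK -E.
  apply: closedU.
    apply: closed_bigcup => [|v _]; first exact: finite_finset.
    apply: accessible_closed_set1; apply: hausdorff_accessible; exact: geom_hausdorff.
  apply: closed_bigcup => [|e _]; first exact: finite_finset.
  apply: compact_closed; first exact: geom_hausdorff.
  have cc : continuous (fun r => char_map e (clamp r)).
    exact: (cont_comp (@clamp_continuous R) (@char_map_continuous e)).
  apply: continuous_compact; first exact: continuous_subspaceT.
  apply: compact_closedI; first exact: segment_compact.
  apply: (preimage_closed (f := clamp) (D := char_map e @^-1` A)).
    by move=> r _; exact: clamp_continuous.
  exact: Acl.
Qed.

Fixpoint steps (v : G) (ws : seq G) : seq (G * G) :=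
  if ws is w :: ws' then (v, w) :: steps w ws' else [::].

Lemma edge_path_step v ws a b r : (a, b) \in steps v ws -> 0 <= r -> r <= 1 ->
  exists2 t, 0 <= t & edge_path v ws t = comb r (pt R a) (pt R b).
Proof.
move=> + r0 r1; elim: ws v => //= w ws IH v; rewrite inE => /orP[/eqP[-> ->]|/IH].
  by exists r => //; rewrite edge_path_head// clip_id.
move=> [t t0 E]; exists (t + 1); first by rewrite addr_ge0.
by rewrite edge_path_tail ?lerDr// addrK.
Qed.

(** A walk through all edges exhibits the realization as a continuous image of the
    line. *)
Lemma geom_connected v ws : path (@gadj G) v ws ->
  (forall a b, gadj a b -> ((a, b) \in steps v ws) || ((b, a) \in steps v ws)) ->
  connected [set: X].
Proof.
move=> pws cov.
have -> : [set: X] = edge_path v ws @` [set: R].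
  apply/seteqP; split=> // x _; have [a [b [ab abP]]] := crd_simplex x.
  have ba : gadj b a by rewrite gadj_sym.
  have baP w : 0 < crd x w -> w = b \/ w = a by move=> /abP[]; [right|left].
  have /orP[c|c] := cov _ _ ab.
    have [r [r0 r1 ->]] := edge_point ab abP.
    by have [t _ E] := edge_path_step c r0 r1; exists t.
  have [r [r0 r1 ->]] := edge_point ba baP.
  by have [t _ E] := edge_path_step c r0 r1; exists t.
apply: connected_continuous_connected; first exact: connected_line.
by apply: continuous_subspaceT; exact: edge_path_continuous.
Qed.

End is_graph.

Section covering_facts.
Variables (R : realType) (G : sign_graph).
Local Notation X := (geom R G).
Local Notation Y := (geom R (cover G)).

Definition projc : continuousType Y X := mkcts (@proj_continuous G R).
Definition flipc : continuousType Y Y := mkcts (@flip_continuous G R).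

Lemma projE y : projc y = proj y. Proof. by []. Qed.
Lemma flipE y : flipc y = flip y. Proof. by []. Qed.

Lemma projc_covering : covering projc.
Proof.
split=> [x|x].
  by exists (sect (vtx x) false x); rewrite projE proj_sect// vtx_gt0.
pose v := vtx x; exists [set x | 0 < crd x v].
have open_star (H : graph) (u : H) : open [set x : geom R H | 0 < crd x u].
  by rewrite openE => z zu; exact: (@star_near R H u _ id z (fun A => id)).
split; [exact: open_star|exact: vtx_gt0|].
exists bool; exists (fun s => [set y : Y | 0 < crd y ((v, s) : cover G)]); split.
- by move=> s; exact: open_star.
- move=> s t _ _ [y [ys yt]]; have := crd_sheet ys yt.
  by rewrite sgn_id addbF.
- apply/seteqP; split=> y /=.
    by rewrite projE => /crd_proj_gt0[s ys]; exists s.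
  by move=> [s _ ys]; rewrite projE; exact: proj_gt0 ys.
- move=> s; exists (sect v s); split.
  + apply: continuous_in_subspaceT => z; rewrite inE => zv.
    exact: (@sect_continuous_at G R _ id v s z (fun A => id) zv).
  + by move=> y ys; split; [exact: proj_gt0 ys|exact: sectK].
  + by move=> z zv; split; [exact: sect_gt0|exact: proj_sect].
Qed.

Lemma projc_regular : regular_covering projc.
Proof.
split=> [|y y' yy']; first exact: projc_covering.
have [->|->] := proj_eq yy'.
  by exists idfun => //; split=> //; exists idfun.
exists flipc; last by rewrite flipE flipK.
split=> [z|]; first by rewrite /= flipE !projE proj_flip.
by exists flipc; split=> z; rewrite !flipE flipK.
Qed.

Lemma projc_finite : finite_fibres projc.
Proof.
move=> x; have [[y yx]|ne] := pselect (exists y, projc y = x); last first.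
  rewrite (_ : _ @^-1` _ = set0); first exact: finite_set0.
  by apply/seteqP; split=> // y yx; case: ne; exists y.
apply: (@sub_finite_set _ _ [set` [:: y; flip y]]); last exact: finite_seq.
move=> z zx; have : projc z = projc y by rewrite yx.
by move=> /proj_eq[->|->]; rewrite /= !inE eqxx ?orbT.
Qed.

End covering_facts.

(** * Winding numbers *)

Section simplex_points.
Variable R : realType.

Lemma delta_continuous n (Z : topologicalType) (F : Z -> Delta R n) :
  (forall i, continuous (fun z => bary i (F z))) -> continuous F.
Proof.
move=> cF; apply: (@continuous_to_subtype _ _ (std_simplex R n)) => z A [P zP PA].
have Pz j : \forall z' \near z, P ord0 j ((val \o F) z' ord0 j) := cF j z _ (zP ord0 j).
apply: filterS (filter_forall _ Pz) => z' Pz'.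
by apply: PA => a b; rewrite ord1; exact: Pz'.
Qed.

(** Barycentric coordinates of a map from the square onto the triangle that collapses
    the side p = 0 to the vertex 0. *)
Definition row2 (p q : R) : 'rV[R]_3 :=
  \row_i (if i == ord0 then 1 - clip 0 1 p
          else if i == ord_max then clip 0 1 p * clip 0 1 q
          else clip 0 1 p * (1 - clip 0 1 q)).

Lemma row2_simplex p q : row2 p q \in std_simplex R 2.
Proof.
have := clip_ge 0 1 p; have := clip_ge 0 1 q.
have := clip_le p (@ler01 R); have := clip_le q (@ler01 R).
rewrite inE => q1 p1 q0 p0; split=> [i|].
  rewrite mxE; case: ifP => _; first by lra.
  by case: ifP => _; rewrite mulr_ge0//; lra.
by rewrite 2!big_ord_recl big_ord1 !mxE /=; lra.
Qed.

Definition point2 (z : R * R) : Delta R 2 :=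
  exist (fun x => x \in std_simplex R 2) _ (row2_simplex z.1 z.2).

Lemma point2_continuous : continuous point2.
Proof.
apply: delta_continuous => i; under eq_fun do rewrite /bary /= mxE.
have c1 : continuous (fun z : R * R => clip 0 1 z.1).
  exact: (cont_comp (@cont_fst _ _) (@clip_continuous R 0 1)).
have c2 : continuous (fun z : R * R => clip 0 1 z.2).
  exact: (cont_comp (@cont_snd _ _) (@clip_continuous R 0 1)).
case: (i == ord0); first by apply: cont_sub => //; exact: cont_cst.
case: (i == ord_max); apply: cont_mul => //; apply: cont_sub => //; exact: cont_cst.
Qed.

Definition row1 (p : R) : 'rV[R]_2 :=
  \row_i (if i == ord0 then 1 - clip 0 1 p else clip 0 1 p).

Lemma row1_simplex p : row1 p \in std_simplex R 1.
Proof.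
have := clip_ge 0 1 p; have := clip_le p (@ler01 R).
rewrite inE => p1 p0; split=> [i|].
  by rewrite mxE; case: ifP => _ //; lra.
by rewrite big_ord_recl big_ord1 !mxE /=; lra.
Qed.

Definition point1 (p : R) : Delta R 1 :=
  exist (fun x => x \in std_simplex R 1) _ (row1_simplex p).

Lemma point1_continuous : continuous point1.
Proof.
apply: delta_continuous => i; under eq_fun do rewrite /bary /= mxE.
case: (i == ord0); last exact: clip_continuous.
by apply: cont_sub; [exact: cont_cst|exact: clip_continuous].
Qed.

Lemma delta_eq n (x y : Delta R n) : (forall i, bary i x = bary i y) -> x = y.
Proof. by move=> xy; apply: val_inj; apply/rowP => i; exact: xy. Qed.

Lemma bary_point1 p : bary ord_max (point1 p) = clip 0 1 p.
Proof. by rewrite /bary /= mxE. Qed.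

Lemma face2_point1 t : 0 <= t -> t <= 1 -> face ord_max (point1 t) = point2 (t, 0).
Proof.
move=> t0 t1; apply: delta_eq => i; case: (unliftP ord_max i) => [j|] ->.
  rewrite bary_face /bary /= !mxE /= (@clip_id _ 0 1 0)// subr0 mulr1.
  by move: j; case=> -[|[|//]] ? /=.
by rewrite bary_face0 /bary /= mxE /= (@clip_id _ 0 1 0)// mulr0.
Qed.

Lemma face0_point1 t : 0 <= t -> t <= 1 -> face ord0 (point1 t) = point2 (1, t).
Proof.
move=> t0 t1; apply: delta_eq => i; case: (unliftP ord0 i) => [j|] ->.
  rewrite bary_face /bary /= !mxE /= (@clip_id _ 0 1 1)// !mul1r.
  by move: j; case=> -[|[|//]] ? /=.
by rewrite bary_face0 /bary /= mxE /= (@clip_id _ 0 1 1)// subrr.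
Qed.

Lemma face1_point1 t : 0 <= t -> t <= 1 ->
  face (lift ord0 ord0) (point1 t) = point2 (t, 1).
Proof.
move=> t0 t1; apply: delta_eq => i; case: (unliftP (lift ord0 ord0) i) => [j|] ->.
  rewrite bary_face /bary /= !mxE /= (@clip_id _ 0 1 1)// subrr mulr1.
  by move: j; case=> -[|[|//]] ? /=.
by rewrite bary_face0 /bary /= mxE /= (@clip_id _ 0 1 1)// subrr mulr0.
Qed.

Lemma point2_left t : point2 (0, t) = point2 (0, 0).
Proof.
by apply: delta_eq => i; rewrite /bary /= !mxE (@clip_id _ 0 1 0)// !mul0r.
Qed.

End simplex_points.

Section winding.
Variables (R : realType) (G : graph) (wt : G -> G -> int).
Hypothesis wt_id : forall u, wt u u = 0.
Hypothesis wt_anti : forall u v, gadj u v -> wt v u = - wt u v.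
Local Notation Y := (geom R G).

Lemma shift_id u (k : int) : k + wt u u = k.
Proof. by rewrite wt_id addr0. Qed.

Lemma shiftK u v : gadj u v -> cancel (+%R^~ (wt u v)) (+%R^~ (wt v u)).
Proof. by move=> uv k /=; rewrite (wt_anti uv) addrK. Qed.

Definition shift_voltage : voltage G int :=
  @Voltage _ _ (fun u v k => k + wt u v) shift_id shiftK.

Lemma carries_shift (F : R -> Y) (a b k : int) :
  carries shift_voltage F a b -> carries shift_voltage F (k + a) (k + b).
Proof.
move=> [h [Ph h0 h1]]; exists (fun t => k + h t); rewrite h0 h1; split=> //.
by move=> z; apply: filterS (Ph z) => z' /= ->; rewrite addrA.
Qed.

Definition simplex_path (s : singular R 1 Y) (t : R) : Y := s (point1 t).

Lemma simplex_path_continuous s : continuous (simplex_path s).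
Proof.
apply: (cont_comp (@point1_continuous R) (g := s)); exact: cts_fun.
Qed.

(** Transport of 0 along the 1-simplex, for the voltages that translate by wt. *)
Definition winding (s : singular R 1 Y) : int :=
  projT1 (boolp.cid (carries_ex shift_voltage 0 (@simplex_path_continuous s))).

Lemma windingP s : carries shift_voltage (simplex_path s) 0 (winding s).
Proof. by rewrite /winding; case: boolp.cid. Qed.

Lemma winding_path (g : R -> Y) (cg : continuous g) k :
  carries shift_voltage g 0 k -> winding (singular_path cg) = k.
Proof.
move=> C; apply: (carries_fun (@simplex_path_continuous _) (windingP _)).
apply: carries_eq C => t t0 t1; rewrite /simplex_path.
by rewrite -[RHS]/(g (bary ord_max (point1 t))) bary_point1 clip_id.
Qed.

(** The 2-simplex is parametrized by a square one side of which is collapsed, so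
    transport around the square is transport along the three faces. *)
Lemma winding_cocycle (s : singular R 2 Y) :
  winding (singular_face ord_max s) + winding (singular_face ord0 s)
  = winding (singular_face (lift ord0 ord0) s).
Proof.
have cs : continuous (s \o @point2 R).
  by apply: cont_comp; [exact: point2_continuous|exact: cts_fun].
apply: (@carries_square _ _ _ shift_voltage (s \o @point2 R) 0
  (winding (singular_face ord_max s)) _ 0 _ cs).
- apply: carries_eq (windingP _) => t t0 t1.
  by rewrite /simplex_path -[LHS]/(s (face _ _)) face2_point1.
- have := carries_shift (winding (singular_face ord_max s))
    (windingP (singular_face ord0 s)); rewrite addr0; apply: carries_eq => t t0 t1.
  by rewrite /simplex_path -[LHS]/(s (face _ _)) face0_point1.
- apply: (@carries_eq _ _ _ _ (cst (s (point2 (0, 0))))); last exact: carries_cst.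
  by move=> t _ _; rewrite /= (point2_left t).
- apply: carries_eq (windingP _) => t t0 t1.
  by rewrite /simplex_path -[LHS]/(s (face _ _)) face1_point1.
Qed.

Lemma winding_bounds L : bounds (chain_of L) ->
  \sum_(p <- L) p.1 * (winding p.2)%:~R = 0 :> rat.
Proof.
move=> [K /(sum_chain_of (fun s => (winding s)%:~R)) ->].
rewrite /bdry_seq big_flatten big_map big1// => p _ /=.
rewrite big_map big_enum /= big_ord_recl big_ord_recl big_ord1 /=.
have -> : lift ord0 (lift ord0 ord0) = ord_max :> 'I_3 by exact: val_inj.
rewrite -(winding_cocycle p.2) intrD /bump /=; ring.
Qed.

End winding.

(** * Chains of paths inside a star *)

Section lines.
Variables (R : realType) (G : graph).
Local Notation Y := (geom R G).
Implicit Types (x y : Y) (u v w : G).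

Definition line x y (t : R) : Y := comb (clip 0 1 t) x y.

Lemma line_continuous x y : joined x y -> continuous (line x y).
Proof.
move=> j; apply: comb_continuous => [z|z| | |]; rewrite ?clip_ge ?clip_le//.
- exact: clip_continuous.
- exact: cont_cst.
- exact: cont_cst.
Qed.

Definition common_edge (l : seq Y) : Prop :=
  exists a b, gadj a b /\ forall x w, x \in l -> 0 < crd x w -> w = a \/ w = b.

Lemma common_edge_joined l x y : common_edge l -> x \in l -> y \in l -> joined x y.
Proof.
move=> [a [b [ab abP]]] xl yl; exists a, b; split=> // w [] /abP; exact.
Qed.

Lemma bounds_line3 x y z : common_edge [:: x; y; z] ->
  bounds (fun s => path_chain (line x y) s + path_chain (line y z) s
    - path_chain (line x z) s).
Proof.
move=> c.
have xy : joined x y by apply: common_edge_joined c _ _; rewrite !inE eqxx ?orbT.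
have xz : joined x z by apply: common_edge_joined c _ _; rewrite !inE eqxx ?orbT.
have yz : joined y z by apply: common_edge_joined c _ _; rewrite !inE eqxx ?orbT.
pose K (p : R * R) := comb (clip 0 1 p.2) (line x y p.1) z.
have c1 : continuous (fun z : R * R => line x y z.1).
  exact: (cont_comp (@cont_fst _ _) (line_continuous xy)).
have j p : joined (line x y p) z.
  move: c => [a [b [ab abP]]]; exists a, b; split=> // w [|].
    move=> /comb_supp[]; rewrite ?clip_ge ?clip_le//; apply: abP;
      by rewrite !inE eqxx ?orbT.
  by apply: abP; rewrite !inE eqxx ?orbT.
have cK : continuous K.
  apply: comb_continuous => [p|p| | |]; rewrite ?clip_ge ?clip_le//.
  - exact: (cont_comp (@cont_snd _ _) (@clip_continuous R 0 1)).
  - exact: cont_cst.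
have E0 : clip 0 1 0 = 0 :> R by rewrite clip_id.
have E1 : clip 0 1 1 = 1 :> R by rewrite clip_id.
have := bounds_square cK.
have -> : (fun t => K (t, 0)) = line x y.
  by apply/funext => t; rewrite /K /= E0 comb0.
have -> : (fun t => K (1, t)) = line y z.
  by apply/funext => t; rewrite /K /= /line E1 comb1.
have -> : (fun t => K (0, t)) = line x z.
  by apply/funext => t; rewrite /K /= /line E0 comb0.
have -> : (fun t => K (t, 1)) = cst z.
  by apply/funext => t; rewrite /K /= E1 comb1.
by move=> H; apply: bounds_ext (bounds_add H (bounds_cst R z)) => s; ring.
Qed.

Lemma linexx x : line x x = cst x.
Proof.
by apply/funext => t; rewrite /line combxx ?clip_ge ?clip_le.
Qed.

Lemma bounds_line_rev x y : joined x y ->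
  bounds (fun s => path_chain (line x y) s + path_chain (line y x) s).
Proof.
move=> [a [b [ab abP]]].
have c : common_edge [:: x; y; x].
  exists a, b; split=> // z w; rewrite !inE => /or3P[] /eqP -> h; apply: abP;
    by [left|right].
have := bounds_line3 c; rewrite linexx => H.
by apply: bounds_ext (bounds_add H (bounds_cst R x)) => s; ring.
Qed.

(** The cone from v over the path is a square with one side collapsed to v. *)
Lemma bounds_star (g : R -> Y) a b v : continuous g -> a <= b ->
  (forall t, a <= t -> t <= b -> 0 < crd (g t) v) ->
  bounds (fun s => path_chain (subpath g a b) s
    - (path_chain (line (pt R v) (g b)) s - path_chain (line (pt R v) (g a)) s)).
Proof.
move=> cg ab gv.
pose g' t := g (clip a b t).
have cg' : continuous g' by apply: cont_comp cg; exact: clip_continuous.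
have jg t : joined (pt R v) (g' t).
  have gt : 0 < crd (g' t) v by apply: gv; rewrite ?clip_ge ?clip_le.
  have [c [d [cd cdP]]] := crd_simplex (g' t); exists c, d; split=> // w [].
    by rewrite crd_pt_gt0 => /eqP ->; exact: cdP.
  exact: cdP.
pose K (p : R * R) := comb (clip 0 1 p.2) (pt R v) (g' (a + p.1 * (b - a))).
have cl : continuous (fun p : R * R => a + p.1 * (b - a)).
  by apply: cont_add; [exact: cont_cst|apply: cont_mul; [exact: cont_fst|exact: cont_cst]].
have cK : continuous K.
  apply: comb_continuous => [p|p| | |]; rewrite ?clip_ge ?clip_le//.
  - exact: (cont_comp (@cont_snd _ _) (@clip_continuous R 0 1)).
  - exact: cont_cst.
  - exact: (cont_comp cl cg').
have E0 : clip 0 1 0 = 0 :> R by rewrite clip_id.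
have E1 : clip 0 1 1 = 1 :> R by rewrite clip_id.
have := bounds_square cK.
have -> : (fun t => K (t, 0)) = cst (pt R v).
  by apply/funext => t; rewrite /K /= E0 comb0.
have -> : (fun t => K (1, t)) = line (pt R v) (g b).
  by apply/funext => t; rewrite /K /= mul1r subrKC /g' (@clip_id _ a b b).
have -> : (fun t => K (0, t)) = line (pt R v) (g a).
  by apply/funext => t; rewrite /K /= mul0r addr0 /g' (@clip_id _ a b a).
rewrite (@path_chain_eq R _ (fun t => K (t, 1)) (subpath g a b)); last first.
  move=> t t0 t1; rewrite /K /= E1 comb1// /subpath /g' clip_id//.
    by rewrite lerDl mulr_ge0// subr_ge0.
  by rewrite -lerBrDl ler_piMl// subr_ge0.
move=> H.
have := bounds_sub (bounds_cst R (pt R v)) H.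
by apply: bounds_ext => s; ring.
Qed.

Lemma bounds_star_vertex v n y : 0 < crd y v -> 0 < crd y n ->
  bounds (fun s => path_chain (line (pt R v) y) s
    - (path_chain (line (pt R v) (pt R n)) s + path_chain (line (pt R n) y) s)).
Proof.
move=> yv yn.
have c : common_edge [:: pt R v; pt R n; y].
  have [a [b [ab abP]]] := crd_simplex y; exists a, b; split=> // z w.
  rewrite !inE => /or3P[] /eqP ->.
  - by rewrite crd_pt_gt0 => /eqP ->; exact: abP.
  - by rewrite crd_pt_gt0 => /eqP ->; exact: abP.
  - exact: abP.
have := bounds_scale (-1) (bounds_line3 c); apply: bounds_ext => s; ring.
Qed.

(** Each segment from v is replaced by the edge from v to a vertex near the end point,
    followed by a short segment; the tails then do not depend on v, and cancel when
    pieces of a path in different stars are put together. *)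
Lemma bounds_star_ends (g : R -> Y) a b v na nb : continuous g -> a <= b ->
  (forall t, a <= t -> t <= b -> 0 < crd (g t) v) ->
  0 < crd (g a) na -> 0 < crd (g b) nb ->
  bounds (fun s => path_chain (subpath g a b) s
    - (path_chain (line (pt R v) (pt R nb)) s + path_chain (line (pt R nb) (g b)) s
     - path_chain (line (pt R v) (pt R na)) s - path_chain (line (pt R na) (g a)) s)).
Proof.
move=> cg ab gv ga gb; have H := bounds_star cg ab gv.
have Hb := bounds_star_vertex (gv b ab (lexx b)) gb.
have Ha := bounds_star_vertex (gv a (lexx a) ab) ga.
by apply: bounds_ext (bounds_sub (bounds_add H Hb) Ha) => s; ring.
Qed.

End lines.

(** * Anti-invariant chains on a double cover *)

Section anti_invariant.
Variables (R : realType) (G : sign_graph).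
Local Notation Y := (geom R (cover G)).
Local Notation chain1 := (singular R 1 Y -> rat).
Implicit Types (a b v n : cover G) (g : R -> Y).

Definition flip_vert v : cover G := (v.1, ~~ v.2).

Lemma flip_vertK v : flip_vert (flip_vert v) = v.
Proof. by case: v => v s; rewrite /flip_vert /= negbK. Qed.

Lemma flip_vert_adj a b : gadj a b -> gadj (flip_vert a) (flip_vert b).
Proof.
case: a b => [a s] [b t]; rewrite /= /cover_adj /= => /andP[-> /eqP ->].
by rewrite addNb eqxx.
Qed.

Lemma crd_flip_gt0 (y : Y) v : 0 < crd y v -> 0 < crd (flip y) (flip_vert v).
Proof. by rewrite crd_flip /= negbK; case: v. Qed.

(** The antisymmetrization T g - g of a path g, T being the deck transformation. *)
Definition anti g : chain1 := fun s => path_chain (@flip G R \o g) s - path_chain g s.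

Definition anti_edge a b : chain1 := fun s =>
  path_chain (line (pt R (flip_vert a)) (pt R (flip_vert b))) s
  - path_chain (line (pt R a) (pt R b)) s.

Definition anti_tail n (y : Y) : chain1 := fun s =>
  path_chain (line (pt R (flip_vert n)) (flip y)) s
  - path_chain (line (pt R n) y) s.

Lemma anti_star g r t v nr nt : continuous g -> r <= t ->
  (forall x, r <= x -> x <= t -> 0 < crd (g x) v) ->
  0 < crd (g r) nr -> 0 < crd (g t) nt ->
  bounds (fun s => anti (subpath g r t) s -
    (anti_edge v nt s + anti_tail nt (g t) s
     - anti_edge v nr s - anti_tail nr (g r) s)).
Proof.
move=> cg rt gv gr gt.
have cfg : continuous (@flip G R \o g) by apply: cont_comp cg (@flip_continuous G R).
have H1 := bounds_star_ends cg rt gv gr gt.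
have H2 := bounds_star_ends (v := flip_vert v) cfg rt
  (fun x rx xt => crd_flip_gt0 (gv x rx xt)) (crd_flip_gt0 gr) (crd_flip_gt0 gt).
apply: bounds_ext (bounds_sub H2 H1) => s.
rewrite /anti /anti_edge /anti_tail /=; ring.
Qed.

Lemma bounds_anti_subpath g r t u : continuous g ->
  bounds (fun s => anti (subpath g r t) s + anti (subpath g t u) s
    - anti (subpath g r u) s).
Proof.
move=> cg.
have cfg : continuous (@flip G R \o g) by apply: cont_comp cg (@flip_continuous G R).
have H1 := bounds_subpath r t u cg; have H2 := bounds_subpath r t u cfg.
apply: bounds_ext (bounds_sub H2 H1) => s; rewrite /anti; ring.
Qed.

Section potential.
Variables (pot : cover G -> chain1) (z : chain1).
Hypothesis potP : forall a b, gadj a b -> exists m : int,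
  bounds (fun s => anti_edge a b s - (pot b s - pot a s + m%:~R * z s)).

Definition end_term (y : Y) : chain1 := fun s =>
  pot (vtx y) s + anti_tail (vtx y) y s.

(** On a piece inside the star of v the contribution of v cancels, so that the
    antisymmetrized path is a difference of terms at its ends up to integral
    multiples of z; these terms are additive, which is what bisection requires. *)
Lemma anti_path g : continuous g -> exists m : int,
  bounds (fun s => anti (subpath g 0 1) s
    - (end_term (g 1) s - end_term (g 0) s + m%:~R * z s)).
Proof.
move=> cg; apply: (@bisect R (fun r t => exists m : int,
  bounds (fun s => anti (subpath g r t) s
    - (end_term (g t) s - end_term (g r) s + m%:~R * z s)))).
  move=> r t u _ _ _ _ [m H] [m' H']; exists (m + m').
  have K := bounds_anti_subpath r t u cg.
  apply: bounds_ext (bounds_sub (bounds_add H H') K) => s.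
  by rewrite intrD; ring.
move=> x _ _; have [e /= e0 eP] := star_near (cg x) (vtx_gt0 (g x)).
exists e => // r t r0 t1 xr rx xt tx; set v := vtx (g x).
have gv y : r <= y -> y <= t -> 0 < crd (g y) v.
  by move=> ry yt; apply: eP; rewrite /= ltr_distlC; apply/andP; split; lra.
have rt := le_trans rx xt.
have gr := gv r (lexx r) rt; have gt := gv t rt (lexx t).
have H := anti_star cg rt gv (vtx_gt0 (g r)) (vtx_gt0 (g t)).
have [m1 H1] := potP (crd_adj gt (vtx_gt0 (g t))).
have [m2 H2] := potP (crd_adj gr (vtx_gt0 (g r))).
(* the two edges start at v, so the value of the potential at v cancels *)
exists (m1 - m2); apply: bounds_ext (bounds_sub (bounds_add H H1) H2) => s.
rewrite /end_term intrB.
move: (anti _ s) (anti_edge _ _ s) (anti_edge _ _ s) (anti_tail _ _ s)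
  (anti_tail _ _ s) (pot _ s) (pot v s) (pot _ s) (z s) (m1%:~R) (m2%:~R).
by move=> *; ring.
Qed.

Lemma anti_loop g : continuous g -> g 0 = g 1 -> exists m : int,
  bounds (fun s => anti g s - m%:~R * z s).
Proof.
move=> cg g01; have [m H] := anti_path cg; exists m.
have E : subpath g 0 1 = g.
  by apply/funext => t; rewrite /subpath add0r subr0 mulr1.
by apply: bounds_ext H => s; rewrite E -g01; ring.
Qed.

End potential.

Lemma anti_edge_rev a b : gadj a b ->
  bounds (fun s => anti_edge a b s + anti_edge b a s).
Proof.
move=> ab; have H := bounds_line_rev (joined_pt R ab).
have H' := bounds_line_rev (joined_pt R (flip_vert_adj ab)).
apply: bounds_ext (bounds_sub H' H) => s; rewrite /anti_edge; ring.
Qed.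

Lemma anti_edge_flip a b s :
  anti_edge (flip_vert a) (flip_vert b) s = - anti_edge a b s.
Proof. by rewrite /anti_edge !flip_vertK opprB. Qed.

Lemma anti_edgexx a : bounds (anti_edge a a).
Proof.
have H := bounds_sub (bounds_cst R (pt R (flip_vert a))) (bounds_cst R (pt R a)).
by apply: bounds_ext H => s; rewrite /anti_edge !linexx.
Qed.

Lemma flip_pt v : flip (pt R v) = pt R (flip_vert v).
Proof.
apply: crd_ext => w; rewrite crd_flip !crd_pt; congr (nat_of_bool _)%:R.
by case: w v => [w s] [v t]; rewrite !xpair_eqE; case: (w == v); case: s t => [] [].
Qed.

Lemma flip_comb r (x y : Y) : joined x y -> 0 <= r -> r <= 1 ->
  flip (comb r x y) = comb r (flip x) (flip y).
Proof.
move=> j r0 r1; have j' : joined (flip x) (flip y).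
  have [a [b [ab abP]]] := j; exists (flip_vert a), (flip_vert b); split.
    exact: flip_vert_adj.
  move=> w; rewrite !crd_flip => /abP[] E; [left|right].
    by rewrite -E; case: (w) => ? ?; rewrite /flip_vert /= negbK.
  by rewrite -E; case: (w) => ? ?; rewrite /flip_vert /= negbK.
apply: crd_ext => w; rewrite crd_flip !crd_comb//.
by rewrite !crd_flip.
Qed.

(** The path along a walk is the sum of its edges. *)
Lemma anti_edge_path v ws : path (@gadj (cover G)) v ws ->
  bounds (fun s => anti (subpath (edge_path v ws) 0 (size ws)%:R) s
    - \sum_(p <- zip (v :: ws) ws) anti_edge p.1 p.2 s).
Proof.
elim: ws v => [|w ws IH] v pws.
  have -> : subpath (edge_path v [::]) 0 0 = cst (pt R v).
    by apply/funext => t; rewrite /subpath subrr mulr0 addr0 edge_path_lo.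
  have H := bounds_sub (bounds_cst R (flip (pt R v))) (bounds_cst R (pt R v)).
  by apply: bounds_ext H => s; rewrite big_nil subr0.
have /andP[vw pw] : gadj v w && path (@gadj (cover G)) w ws by [].
have cg := edge_path_continuous (R := R) pws.
have K := bounds_anti_subpath 0 1 (size ws).+1%:R cg.
have H := IH w pw.
have E1 : anti (subpath (edge_path v (w :: ws)) 0 1) = anti_edge v w.
  have E : forall t : R, 0 <= t -> t <= 1 ->
      subpath (edge_path v (w :: ws)) 0 1 t = line (pt R v) (pt R w) t.
    by move=> t t0 t1; rewrite /subpath add0r subr0 mulr1 edge_path_head.
  apply/funext => s; rewrite /anti /anti_edge (@path_chain_eq R Y _ _ E); congr (_ - _).
  congr (_ s); apply: path_chain_eq => t t0 t1; rewrite /= E// /line.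
  rewrite flip_comb ?clip_ge ?clip_le//; last exact: joined_pt.
  by rewrite !flip_pt.
have E2 : anti (subpath (edge_path v (w :: ws)) 1 (size ws).+1%:R) =
    anti (subpath (edge_path w ws) 0 (size ws)%:R).
  have E : forall t : R, 0 <= t -> t <= 1 ->
      subpath (edge_path v (w :: ws)) 1 (size ws).+1%:R t =
      subpath (edge_path w ws) 0 (size ws)%:R t.
    move=> t t0 t1; rewrite /subpath -natr1 addrK edge_path_tail.
      by rewrite subr0 add0r addrAC subrr add0r.
    by rewrite lerDl mulr_ge0.
  apply/funext => s; rewrite /anti (@path_chain_eq R Y _ _ E); congr (_ - _).
  by congr (_ s); apply: path_chain_eq => t t0 t1; rewrite /= E.
rewrite {}E1 {}E2 in K.
apply: bounds_ext (bounds_sub H K) => s; rewrite /= big_cons /=; ring.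
Qed.

End anti_invariant.

(** * The double cover of the theta graph *)

(** The generator false changes the sheet, the generator true does not. *)
Definition theta_sgn (u v : theta) : bool :=
  if edge_letter u v is Some x then ~~ x.1 else false.

Lemma theta_sgn_id u : theta_sgn u u = false.
Proof. by move: u => [[] []]. Qed.

Lemma theta_sgn_sym (u v : theta) : gadj u v -> theta_sgn u v = theta_sgn v u.
Proof. by move: u v => [[] []] [[] []]. Qed.

Definition theta_signed : sign_graph := SignGraph theta_sgn_id theta_sgn_sym.

Definition theta2 : graph := cover theta_signed.

Definition sheeted (u : theta) (s : bool) : theta2 := (u, s).

(** Up to orientation and deck transformation the edges of the double cover are the
    spokes in the sheet false and one lift of each of the two other edges. *)
Lemma theta2_adj_ind (P : theta2 -> theta2 -> Prop) :
  (forall a, P a a) -> (forall a b, gadj a b -> P a b -> P b a) ->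
  (forall a b, P a b -> P (flip_vert a) (flip_vert b)) ->
  (forall u, P (sheeted hub false) (sheeted u false)) ->
  P (sheeted hub' false) (sheeted (leaf false) true) ->
  P (sheeted hub' false) (sheeted (leaf true) false) ->
  forall a b, gadj a b -> P a b.
Proof.
move=> refl rev flp hubP aP bP.
have rb : P (sheeted (leaf true) false) (sheeted hub' false) by exact: rev bP.
have ra : P (sheeted (leaf false) true) (sheeted hub' false) by exact: rev aP.
have rh u : P (sheeted u false) (sheeted hub false).
  by apply: rev (hubP u); move: u => [[] []].
have fgb := flp _ _ bP; have fga := flp _ _ aP.
have frb := flp _ _ rb; have fra := flp _ _ ra.
have fh u := flp _ _ (hubP u); have frh u := flp _ _ (rh u).
move=> [[[] []] []] [[[] []] []] //= ad; clear ad;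
  first [exact: refl | exact: bP | exact: aP | exact: rb | exact: ra | exact: hubP | exact: rh
  | exact: fgb | exact: fga | exact: frb | exact: fra | exact: fh | exact: frh].
Qed.

Section theta_cover.
Variable R : realType.
Local Notation Y := (geom R theta2).
Local Notation chain1 := (singular R 1 Y -> rat).
Implicit Types (a b v : theta2).

(** The triangle of the generator true, which lifts to a loop in each sheet. *)
Definition beta_walk (s : bool) : seq theta2 :=
  [:: sheeted hub' s; sheeted (leaf true) s; sheeted hub s].

Definition beta (s : bool) (t : R) : Y := edge_loop (sheeted hub s) (beta_walk s) t.

Lemma beta_continuous s : continuous (beta s).
Proof. by apply: edge_loop_continuous; case: s. Qed.

Lemma beta_loop s : beta s 0 = beta s 1.
Proof. by rewrite /beta edge_loop0 edge_loop1. Qed.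

Lemma epath_flip (G : sign_graph) (v : cover G) ws t u :
  epath (R := R) v ws t (flip_vert u) = epath (flip_vert v) (map (@flip_vert G) ws) t u.
Proof.
have E (w u' : cover G) : (flip_vert u' == w) = (u' == flip_vert w).
  by apply/eqP/eqP => [<-|->]; rewrite flip_vertK.
by elim: ws v t => [|w ws IH] v t /=; rewrite ?IH !E.
Qed.

Lemma flip_beta s : @flip theta_signed R \o beta s = beta (~~ s).
Proof.
apply/funext => t; apply: crd_ext => u; rewrite /= crd_flip.
rewrite -[(u.1, ~~ u.2)]/(flip_vert u).
have p r : path (@gadj theta2) (sheeted hub r) (beta_walk r) by case: r.
rewrite /beta /edge_loop /edge_path !to_graphE; try exact: epath_in.
by rewrite epath_flip.
Qed.

(** The difference of the two lifts of one generator, a generator of the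
    anti-invariant part of the first homology. *)
Definition zeta : chain1 := anti (beta false).

Definition spoke (u : theta) : chain1 := anti_edge (sheeted hub false) (sheeted u false).

(** The value of the potential at the hub. It is forced by antisymmetry and by the
    relation for the edge that changes the sheet, and the solution has a
    denominator 2. *)
Definition pot0 : chain1 := fun s =>
  - (anti_edge (sheeted hub' false) (sheeted (leaf false) true) s
     + spoke hub' s + spoke (leaf false) s) / 2.

(** An antisymmetric function on the vertices, with values in the chains, whose
    difference along each edge is the antisymmetrized edge, up to a multiple of
    zeta. *)
Definition pot (a : theta2) : chain1 := fun s =>
  (if a.2 then -1 else 1) * (pot0 s + spoke a.1 s).

Lemma zeta_edges : bounds (fun s => zeta s - (spoke hub' s
  + anti_edge (sheeted hub' false) (sheeted (leaf true) false) s
  + anti_edge (sheeted (leaf true) false) (sheeted hub false) s)).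
Proof.
have p : path (@gadj theta2) (sheeted hub false) (beta_walk false) by [].
have := anti_edge_path R p; apply: bounds_ext => s.
rewrite /= !big_cons big_nil /= addr0 addrA; congr (anti _ s - _).
by apply/funext => t; rewrite /subpath /beta /edge_loop subr0 add0r mulrC.
Qed.

(** The multiple of zeta is integral; this is where the scalar by which a lift acts
    becomes an integer. *)
Definition edge_exact a b := exists m : int,
  bounds (fun s => anti_edge a b s - (pot b s - pot a s + m%:~R * zeta s)).

Lemma edge_exact_rev a b : gadj a b -> edge_exact a b -> edge_exact b a.
Proof.
move=> ab [m H]; exists (- m); have K := anti_edge_rev R ab.
apply: bounds_ext (bounds_sub K H) => s; rewrite mulrNz.
by move: (anti_edge a b s) (anti_edge b a s) (zeta s) (pot a s) (pot b s)
  (m%:~R) => *; ring.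
Qed.

Lemma pot_flip a s : pot (flip_vert a) s = - pot a s.
Proof.
rewrite /pot /=; move: (pot0 s + _) => x.
by case: a.2; rewrite /= ?mulN1r ?opprK ?mul1r.
Qed.

Lemma edge_exact_flip a b : edge_exact a b -> edge_exact (flip_vert a) (flip_vert b).
Proof.
move=> [m H]; exists (- m); apply: bounds_ext (bounds_scale (-1) H) => s.
rewrite anti_edge_flip !pot_flip mulrNz.
by move: (anti_edge a b s) (zeta s) (pot a s) (pot b s) (m%:~R) => *; ring.
Qed.

Lemma edge_exact_refl a : edge_exact a a.
Proof.
exists 0; apply: bounds_ext (anti_edgexx R a) => s; rewrite mul0r.
by move: (anti_edge a a s) (pot a s) => *; ring.
Qed.

Lemma edge_exact_spoke u : edge_exact (sheeted hub false) (sheeted u false).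
Proof.
exists 0; apply: bounds_ext (anti_edgexx R (sheeted hub false)) => s.
rewrite /pot /= mul0r -/(spoke hub s) -/(spoke u s).
by move: (spoke u s) (spoke hub s) (pot0 s) => *; ring.
Qed.

Lemma edge_exact_switch : edge_exact (sheeted hub' false) (sheeted (leaf false) true).
Proof.
exists 0; apply: bounds_ext (bounds0 R Y) => s; rewrite /pot /pot0 /= mul0r.
move: (anti_edge _ _ s) (spoke hub' s) (spoke (leaf false) s) => x y z.
by field.
Qed.

(** Here zeta enters: it is the sum of the edge and of two spokes. *)
Lemma edge_exact_beta : edge_exact (sheeted hub' false) (sheeted (leaf true) false).
Proof.
exists 1.
have r := anti_edge_rev R
  (isT : @gadj theta2 (sheeted (leaf true) false) (sheeted hub false)).
apply: bounds_ext (bounds_scale (-1) (bounds_add zeta_edges r)) => s.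
rewrite /pot /= -/(spoke (leaf true) s).
move: (anti_edge (sheeted hub' _) _ s) (anti_edge (sheeted (leaf true) _) _ s)
  (spoke hub' s) (spoke (leaf true) s) (zeta s) (pot0 s) => *; ring.
Qed.

Lemma edge_exact_adj a b : gadj a b -> edge_exact a b.
Proof.
exact: (theta2_adj_ind edge_exact_refl edge_exact_rev edge_exact_flip
  edge_exact_spoke edge_exact_switch edge_exact_beta).
Qed.

(** The anti-invariant part of the first homology has rank one: the terms at the ends
    of a path cancel for a loop. *)
Lemma anti_loop_zeta (g : R -> Y) : continuous g -> g 0 = g 1 ->
  exists m : int, bounds (fun s => anti g s - m%:~R * zeta s).
Proof. exact: (@anti_loop R theta_signed pot zeta edge_exact_adj g). Qed.

(** The edge of the triangle opposite to the hub counts 1 in the sheet false and -1 in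
    the sheet true. *)
Definition wind_volt (a b : theta2) : int :=
  if (a.1 == hub') && (b.1 == leaf true) then (if a.2 then -1 else 1)
  else if (b.1 == hub') && (a.1 == leaf true) then (if a.2 then 1 else -1) else 0.

Lemma wind_volt_id a : wind_volt a a = 0.
Proof. by move: a => [[[] []] []]. Qed.

Lemma wind_volt_anti a b : gadj a b -> wind_volt b a = - wind_volt a b.
Proof. by move: a b => [[[] []] []] [[[] []] []]. Qed.

(** The winding number is additive on chains and vanishes on boundaries, but it is -2
    on zeta. *)
Lemma zeta_not_bounds : ~ bounds zeta.
Proof.
have c0 := @beta_continuous false; have c1 := @beta_continuous true.
have zE : zeta = chain_of [:: (1, singular_path c1); (-1, singular_path c0)].
  apply/funext => s; rewrite /zeta /anti flip_beta /chain_of !big_cons big_nil.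
  by rewrite addr0 mul1r mulN1r -!path_chainE.
rewrite zE => /(winding_bounds wind_volt_id wind_volt_anti).
rewrite !big_cons big_nil /= addr0.
have W s (c : continuous (beta s)) :
    winding wind_volt_id wind_volt_anti (singular_path c) = if s then -1 else 1.
  apply: winding_path.
  have -> : (if s then -1 else 1) =
      walk_volt (shift_voltage wind_volt_id wind_volt_anti) (sheeted hub s) (beta_walk s) 0.
    by case: s {c}.
  by apply: carries_edge_path => //; case: s {c}.
by rewrite !W => /eqP.
Qed.

Lemma theta2_connected : connected [set: Y].
Proof.
pose h := sheeted hub; pose h' := sheeted hub'.
pose l := sheeted (leaf false); pose r := sheeted (leaf true).
apply: (@geom_connected R theta2 (h false) [:: h false; h' false; h' false;
  l true; l true; h true; h true; h' true; h' true; l false; l false;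
  h false; r false; r false; h' false; l true; h true; r true; r true; h' true]).
  by [].
by move=> [[[] []] []] [[[] []] []].
Qed.

Lemma theta_connected : connected [set: geom R theta].
Proof.
pose h := hub; pose h' := hub'; pose l := leaf false; pose r := leaf true.
apply: (@geom_connected R theta h [:: h; h'; h'; l; l; h; r; r; h']) => //.
by move=> [[] []] [[] []].
Qed.

End theta_cover.

(** * Action of lifts on the anti-invariant class *)

Section classes.
Variables (R : realType) (Y : topologicalType).
Implicit Types c : chain R 1 Y.

Lemma homologous_refl c : homologous c c.
Proof.
by apply/homologousP; apply: bounds_ext (bounds0 R Y) => s; rewrite subrr.
Qed.

Lemma homologous_sym c c' : homologous c c' -> homologous c' c.
Proof.
move=> /homologousP h; apply/homologousP.
by apply: bounds_ext (bounds_scale (-1) h) => s; ring.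
Qed.

Lemma homologous_trans c c' c'' :
  homologous c c' -> homologous c' c'' -> homologous c c''.
Proof.
move=> /homologousP h /homologousP h'; apply/homologousP.
by apply: bounds_ext (bounds_add h h') => s; ring.
Qed.

Lemma homology_class_eq c c' : homologous c c' ->
  homology_class c = homology_class c'.
Proof.
move=> h; apply/seteqP; split=> z [cz hz]; split=> //.
  exact: homologous_trans hz h.
exact: homologous_trans hz (homologous_sym h).
Qed.

End classes.

Lemma chain_map_homologous (R : realType) (Y Z : topologicalType)
    (f : continuousType Y Z) (c c' : chain R 1 Y) :
  finitely_supported c -> finitely_supported c' -> homologous c c' ->
  homologous (chain_map f c) (chain_map f c').
Proof.
move=> fc fc' /homologousP/(bounds_chain_map f) h; apply/homologousP.
apply: bounds_ext h => s.
have -> : (fun s => c s - c' s) = (fun s => c s - 1 * c' s).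
  by apply/funext => t; rewrite mul1r.
by rewrite chain_map_lin// mul1r.
Qed.

(** The union over all representatives that defines the induced map is a union of
    equal classes. *)
Lemma H1_map_class (R : realType) (Y Z : topologicalType)
    (f : continuousType Y Z) (c : chain R 1 Y) (c' : chain R 1 Z) :
  cycle1 c -> homologous (chain_map f c) c' ->
  H1_map f (homology_class c) = homology_class c'.
Proof.
move=> cc h; have E z : homology_class c z ->
    homology_class (chain_map f z) = homology_class c'.
  move=> [cz zc]; apply: homology_class_eq; apply: homologous_trans h.
  by apply: chain_map_homologous => //; [exact: cz.1|exact: cc.1].
apply/seteqP; split=> [w [z /E <-]//|w cw].
have c0 : homology_class c c by split=> //; exact: homologous_refl.
by exists c => //; rewrite E.
Qed.

Section orbit.
Variable R : realType.
Local Notation X := (geom R theta).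
Local Notation Y := (geom R theta2).
Local Notation zeta := (@zeta R).
Local Notation beta := (@beta R).
Local Notation p := (projc R theta_signed).
Local Notation flip := (@flip theta_signed R).
Local Notation flipc := (flipc R theta_signed).

Lemma anti_finite (g : R -> Y) : continuous g ->
  finitely_supported (@anti R theta_signed g).
Proof.
move=> cg; have cfg : continuous (flip \o g).
  by apply: cont_comp cg _; exact: flip_continuous.
have := finitely_supported_lin 1 (path_chain_finite cfg) (path_chain_finite cg).
by congr finitely_supported; apply/funext => s; rewrite mul1r.
Qed.

Lemma anti_cycle (g : R -> Y) : continuous g -> g 0 = g 1 ->
  cycle1 (@anti R theta_signed g).
Proof.
move=> cg g01; split; first exact: anti_finite.
move=> t; have cfg : continuous (flip \o g).
  by apply: cont_comp cg _; exact: flip_continuous.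
have -> : @anti R theta_signed g =
    (fun s => path_chain (flip \o g) s - 1 * path_chain g s).
  by apply/funext => s; rewrite mul1r.
rewrite boundary_lin; [|exact: path_chain_finite|exact: path_chain_finite].
by rewrite !cycle1_loop ?mulr0 ?subr0//= g01.
Qed.

Lemma zeta_cycle : cycle1 zeta.
Proof. apply: anti_cycle; [exact: beta_continuous|exact: beta_loop]. Qed.

Lemma anti_eq (g g' : R -> Y) : (forall t, 0 <= t -> t <= 1 -> g t = g' t) ->
  @anti R theta_signed g = @anti R theta_signed g'.
Proof.
move=> gg'; rewrite /anti (path_chain_eq gg').
by rewrite (@path_chain_eq R Y (flip \o g) (flip \o g'))// => t t0 t1 /=; rewrite gg'.
Qed.

Lemma chain_map_anti (ft : continuousType Y Y) (g : R -> Y) :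
  (forall y, ft (flip y) = flip (ft y)) -> continuous g ->
  chain_map ft (@anti R theta_signed g) = @anti R theta_signed (ft \o g).
Proof.
move=> ftE cg; have cfg : continuous (flip \o g).
  by apply: cont_comp cg _; exact: flip_continuous.
have E : @anti R theta_signed g =
    (fun s => path_chain (flip \o g) s - 1 * path_chain g s).
  by apply/funext => s; rewrite mul1r.
apply/funext => s; rewrite E chain_map_lin; try exact: path_chain_finite.
rewrite !chain_map_path// mul1r /anti; congr (path_chain _ s - _).
by apply/funext => t /=; rewrite ftE.
Qed.

Lemma lift_unique (F F' : R -> Y) r : continuous F -> continuous F' ->
  (forall t, proj (F t) = proj (F' t)) -> F r = F' r -> F =1 F'.
Proof.
move=> cF cF' e er.
have [//|e'] := lift_dichotomy (@connected_line R) cF cF' e.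
by case: (@flip_neq theta_signed R (F' r)); rewrite -e'.
Qed.

(** The free homotopy lifts to the double cover. Its two vertical sides lift the same
    path and start at the same point, so the lifted homotopy is free as well, and
    the square gives the homology. *)
Lemma free_homotopy_lift (c : R -> Y) (K : R * R -> X) :
  continuous c -> c 0 = c 1 -> continuous K ->
  (forall s, 0 <= s -> s <= 1 -> K (s, 0) = proj (c s)) ->
  (forall t, K (0, t) = K (1, t)) ->
  exists c' : R -> Y, [/\ continuous c', c' 0 = c' 1,
    forall s, 0 <= s -> s <= 1 -> proj (c' s) = K (s, 1) &
    bounds (fun s => @anti R theta_signed c' s - @anti R theta_signed c s)].
Proof.
move=> cc c01 cK Kc K01.
have [L [cL LE L0]] := @lift_square theta_signed R K (c 0) cK (esym (Kc 0 (lexx _) ler01)).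
have cs r : continuous (fun t : R => L (t, r)).
  apply: (cont_comp (f := fun t : R => (t, r)) _ cL).
  by apply: cont_pair; [exact: cont_id|exact: cont_cst].
have ct r : continuous (fun t : R => L (r, t)).
  apply: (cont_comp (f := fun t : R => (r, t)) _ cL).
  by apply: cont_pair; [exact: cont_cst|exact: cont_id].
have bottom : (fun t => L (t, 0)) =1 c \o clip 0 1.
  apply: (@lift_unique _ _ 0) => //.
  - by apply: cont_comp cc; exact: clip_continuous.
  - by move=> t; rewrite LE /rect /= (@clip_id _ 0 1 0)// Kc ?clip_ge ?clip_le.
  - by rewrite L0 /= clip_id.
have sides : (fun t => L (0, t)) =1 (fun t => L (1, t)).
  apply: (@lift_unique _ _ 0) => //.
  - by move=> t; rewrite !LE /rect /= (@clip_id _ 0 1 0)// (@clip_id _ 0 1 1).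
  - by have /= := bottom 1; rewrite L0 clip_id// -c01.
exists (fun t => L (t, 1)); split; [exact: cs|exact: (sides 1)| |].
  by move=> s s0 s1; rewrite LE /rect /= !clip_id.
have H1 := bounds_square cL.
have cfL : continuous (flip \o L) by apply: cont_comp cL _; exact: flip_continuous.
have H2 := bounds_square cfL.
have E : @anti R theta_signed c = @anti R theta_signed (fun t => L (t, 0)).
  by apply: anti_eq => t t0 t1; rewrite [RHS]bottom /= clip_id.
rewrite E; apply: bounds_ext (bounds_sub H1 H2) => s; rewrite /anti.
have -> : (fun t => (flip \o L) (0, t)) = (fun t => (flip \o L) (1, t)).
  by apply/funext => t; congr (flip _); exact: sides.
have -> : (fun t => L (0, t)) = (fun t => L (1, t)) by exact/funext.
by rewrite /comp /=; ring.
Qed.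

(** Both sides lift the same map, hence one of the two alternatives holds on the
    connected space Y. *)
Lemma lift_flip (f : continuousType X X) (ft : continuousType Y Y) :
  is_lift p f ft ->
  (forall y, ft (flip y) = ft y) \/ (forall y, ft (flip y) = flip (ft y)).
Proof.
move=> ftf.
have cft : continuous ft by exact: cts_fun.
apply: (lift_dichotomy (@theta2_connected R) (cont_comp (@flip_continuous theta_signed R) cft) cft).
move=> y; have e z : proj (ft z) = f (proj z) := ftf z.
by rewrite /= !e proj_flip.
Qed.

Lemma homotopic_loop (g h : continuousType X X) (c : R -> Y) (b : R -> X) :
  homotopic R g h -> continuous c -> c 0 = c 1 ->
  continuous b -> b 0 = b 1 ->
  (forall s, 0 <= s -> s <= 1 -> proj (c s) = g (b s)) ->
  exists c' : R -> Y, [/\ continuous c', c' 0 = c' 1,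
    forall s, 0 <= s -> s <= 1 -> proj (c' s) = h (b s) &
    bounds (fun s => @anti R theta_signed c' s - @anti R theta_signed c s)].
Proof.
move=> [H [H0 H1]] cc c01 cb b01 cg.
pose K (z : R * R) : X := H (b z.1, clamp z.2).
have cK : continuous K.
  apply: (cont_comp (f := fun z : R * R => (b z.1, clamp z.2 : I01 R)) (g := H)).
    by apply: cont_pair; [exact: (cont_comp (@cont_fst R R) cb)|
      exact: (cont_comp (@cont_snd R R) (@clamp_continuous R))].
  exact: cts_fun.
have [||c' [cc' c'01 c'h B]] := free_homotopy_lift cc c01 cK.
- by move=> s s0 s1; rewrite /K /= clamp_I0 H0 cg.
- by move=> t; rewrite /K /= b01.
exists c'; split=> // s s0 s1.
by rewrite c'h// /K /= clamp_I1 H1.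
Qed.

Lemma homotopic_sym (f g : continuousType X X) :
  homotopic R f g -> homotopic R g f.
Proof.
move=> [H [H0 H1]].
pose K (z : X * I01 R) : X := H (z.1, clamp (1 - val z.2)).
have cK : continuous K.
  apply: (cont_comp (f := fun z : X * I01 R => (z.1, clamp (1 - val z.2) : I01 R)) (g := H)).
    apply: cont_pair; first exact: cont_fst.
    apply: (cont_comp (f := fun z : X * I01 R => 1 - val z.2)); last exact: clamp_continuous.
    apply: cont_sub; first exact: cont_cst.
    by apply: (cont_comp (@cont_snd _ _)); exact: initial_continuous.
  exact: cts_fun.
exists (mkcts cK); split=> x.
  by rewrite -[LHS]/(H (x, clamp (1 - 0))) subr0 clamp_I1.
by rewrite -[LHS]/(H (x, clamp (1 - 1))) subrr clamp_I0.
Qed.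

(** If ft T = ft then zeta is killed. Otherwise ft commutes with T and maps zeta to
    n zeta with n an integer. The free homotopies from b to f0 g b and on to f g b,
    where b is the projection of beta, lift to a free homotopy from beta to a loop
    c2 over f g b. This loop is ft D for a lift D of g b; if D did not close up, then
    neither would ft D. With T D - D = m zeta it follows that
    zeta = T c2 - c2 = m n zeta, hence m n = 1. *)
Lemma lift_action (f f0 g : continuousType X X) (ft : continuousType Y Y) :
  homotopic R (f0 \o g) idfun -> homotopic R f0 f ->
  is_lift p f ft ->
  exists e : int, [/\ [\/ e = 0, e = 1 | e = -1] &
    homologous (chain_map ft zeta) (fun s => e%:~R * zeta s)].
Proof.
move=> f0g f0f ftf.
have cft : continuous ft by exact: cts_fun.
have cb := @beta_continuous R false; have b01 := beta_loop R false.
have e z : proj (ft z) = f (proj z) := ftf z.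
have [ftE|ftE] := lift_flip ftf.
  exists 0; split; first by constructor.
  apply/homologousP; apply: bounds_ext (bounds0 R Y) => s.
  have cfb : continuous (flip \o beta false).
    by apply: cont_comp cb _; exact: flip_continuous.
  have -> : zeta = (fun s => path_chain (flip \o beta false) s - 1 * path_chain (beta false) s).
    by apply/funext => t; rewrite mul1r.
  rewrite chain_map_lin; [|exact: path_chain_finite|exact: path_chain_finite].
  rewrite !chain_map_path// mul0r subr0 mul1r.
  have -> : ft \o (flip \o beta false) = ft \o beta false.
    by apply/funext => t /=; rewrite ftE.
  by rewrite subrr.
have cfb : continuous (ft \o beta false) by apply: cont_comp cb cft.
have [n Hn] := anti_loop_zeta cfb (congr1 ft b01).
have zn : bounds (fun s => chain_map ft zeta s - n%:~R * zeta s).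
  by rewrite chain_map_anti.
suff [m mn] : exists m : int, m * n = 1.
  exists n; split; last exact/homologousP.
  have /eqP := congr1 absz mn; rewrite abszM muln_eq1 => /andP[_].
  by case: n {Hn zn mn} => [[|[|k]]|[|k]] //= _; [constructor 2|constructor 3].
pose b t := proj (beta false t).
have cpb : continuous b by apply: (cont_comp cb); exact: proj_continuous.
have pb01 : b 0 = b 1 by rewrite /b b01.
have cgb : continuous (g \o b) by apply: (cont_comp cpb); exact: cts_fun.
have gb01 : (g \o b) 0 = (g \o b) 1 by rewrite /= pb01.
have [|c1 [cc1 c101 c1E B1]] :=
  @homotopic_loop idfun (f0 \o g) (beta false) b (homotopic_sym f0g) cb b01 cpb pb01.
  by [].
have [|c2 [cc2 c201 c2E B2]] :=
  @homotopic_loop f0 f c1 (g \o b) f0f cc1 c101 cgb gb01.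
  by move=> s s0 s1; rewrite c1E.
(* one of the two lifts of g (b 0) is sent to c2 0 *)
pose y0 : Y := sect (G := theta_signed) (vtx (g (b 0))) false (g (b 0)).
have py0 : proj y0 = g (b 0) by rewrite proj_sect// vtx_gt0.
have [d0 pd0 d0E] : exists2 d0 : Y, @proj theta_signed R d0 = g (b 0) & ft d0 = c2 0.
  have : proj (c2 0) = proj (ft y0) by rewrite c2E// e py0.
  move=> /proj_eq[->|->]; first by exists y0.
  by exists (flip y0); rewrite ?proj_flip// ftE.
have [D [cD DE D0]] := @lift_path theta_signed R (g \o b) d0 cgb pd0.
have cc2' : continuous (c2 \o clip 0 1) by apply: cont_comp cc2; exact: clip_continuous.
have cftD : continuous (ft \o D) by exact: cont_comp cD cft.
have ftD : ft \o D =1 c2 \o clip 0 1.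
  apply: (@lift_unique _ _ 0) => //=.
    by move=> t; rewrite e DE c2E ?clip_ge ?clip_le.
  by rewrite D0 d0E clip_id.
have D01 : D 0 = D 1.
  have /proj_eq[//|D0f] : proj (D 0) = proj (D 1) by rewrite !DE !clip_id.
  have := ftD 0; have := ftD 1; rewrite /= !clip_id// -c201 D0f ftE => <- E.
  by case: (flip_neq E).
have [m Hm] := anti_loop_zeta cD D01.
exists m; apply: contrapT => /eqP; rewrite -subr_eq0 => mn.
apply: (@zeta_not_bounds R).
have fz : finitely_supported zeta by exact: zeta_cycle.1.
have Km := bounds_chain_map ft Hm.
have E2 : @anti R theta_signed (ft \o D) = @anti R theta_signed c2.
  by apply: anti_eq => t t0 t1; rewrite ftD /= clip_id.
have {}Km : bounds (fun s => @anti R theta_signed c2 s - m%:~R * chain_map ft zeta s).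
  apply: bounds_ext Km => s; rewrite chain_map_lin//; last exact: anti_finite.
  by rewrite chain_map_anti// E2.
(* (m n - 1) zeta bounds *)
have Q := bounds_add Km (bounds_scale m%:~R zn).
have Q' := bounds_sub Q (bounds_add B2 B1).
have Q'' := bounds_scale (- (m * n - 1)%:~R^-1) Q'.
apply: bounds_ext Q'' => s.
have u : ((m * n - 1)%:~R : rat) != 0 by rewrite intr_eq0.
rewrite -/zeta; move: u; rewrite intrB intrM.
move: (anti c2 s) (anti c1 s) (chain_map ft zeta s) (m%:~R : rat) (n%:~R : rat).
move: (zeta s) => z x1 x2 x3 m' n' u.
field; exact: u.
Qed.

End orbit.

Theorem lemma3p1 (R : realType) :
  exists (X Y : topologicalType) (p : continuousType Y X)
         (v : set (chain R 1 Y)),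
    [/\ is_graph R X,
        connected [set: X] /\ (exists x : X, pi1_isog_F2 R x),
        [/\ regular_covering p, finite_fibres p & connected [set: Y]],
        H1 R Y v /\ v <> H1_zero R Y &
        finite_set [set w : set (chain R 1 Y) |
          exists phi : set (continuousType X X), Out_of R X phi /\
          exists f : continuousType X X, phi f /\
          exists ft : continuousType Y Y, is_lift p f ft /\ w = H1_map ft v]].
Proof.
exists (geom R theta), (geom R theta2), (projc R theta_signed).
exists (homology_class (@zeta R)); split.
- exact: geom_is_graph.
- by split; [exact: theta_connected|exists (pt R hub); exact: pi1_theta].
- split; [exact: (projc_regular R theta_signed)
         |exact: (@projc_finite R theta_signed)|exact: theta2_connected].
- split; first by exists (@zeta R) => //; exact: zeta_cycle.
  move=> E; have : homology_class (@zeta R) (@zeta R).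
    by split; [exact: zeta_cycle|exact: homologous_refl].
  rewrite E => -[_ /homologousP h]; apply: (@zeta_not_bounds R).
  by apply: bounds_ext h => s; rewrite subr0.
- pose cls (e : int) := homology_class (fun s => e%:~R * @zeta R s).
  apply: (@sub_finite_set _ _ [set` [:: cls 0; cls 1; cls (-1)]]); last exact: finite_seq.
  move=> w [_ [[f0 [g [_ f0g]] <-] [f [f0f [ft [ftf ->]]]]]].
  have [e [e3 h]] := lift_action f0g f0f ftf.
  rewrite (H1_map_class (@zeta_cycle R) h) /= !inE.
  by case: e3 h => -> _; rewrite eqxx ?orbT.
Qed.
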